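(* Let $r\in(1,2]$ and let $(\mathbb{B},\|\cdot\|_{\mathbb{B}})$ be a (separable) $r$-smooth Banach space. Let $m\geq 1$ be an integer, let $(\xi_i)_{i\geq 1}$ be an i.i.d. sequence taking values in a measurable space $(S,\mathcal{S})$, and for each $\mathbf{i}\in \operatorname{Inc}^m$ let $h_{\mathbf{i}}\colon S^m\to\mathbb{B}$ be a measurable function which is degenerated with respect to $(\xi_i)_{i\geq 1}$, that is, such that for each $\ell_0\in\{1,\dots,m\}$, $$\mathbb{E}\left[h_{\mathbf{i}}(\xi_{\{1,\dots,m\}})\mid \xi_{\{1,\dots,m\}\setminus\{\ell_0\}}\right]=0 .$$ Then for each $p\in(1,r]$, each positive $t$ and $q$, and each integer $N\geq m$, $$\mathbb{P}\left(\max_{m\leq n\leq N}\Big\|\sum_{\mathbf{i}\in\operatorname{Inc}_n^m}h_{\mathbf{i}}(\xi_{\mathbf{i}})\Big\|_{\mathbb{B}}>t\right) \leq K(m,p,q,\mathbb{B})\sum_{\mathbf{i}\in\operatorname{Inc}_N^m}\int_0^1u^{q-1}\mathbb{P}\left(\|h_{\mathbf{i}}(\xi_{\{1,\dots,m\}})\|_{\mathbb{B}}>tu\right)du$$ $$+K(m,p,q,\mathbb{B})\sum_{\emptyset\subsetneq J\subsetneq\{1,\dots,m\}}\ \sum_{\mathbf{i}_J\in\mathbb{N}^{J,m}}\int_0^1u^{q-1}\mathbb{P}\left(\Big(\sum_{\mathbf{i}_{J^c}:\,\mathbf{i}_J+\mathbf{i}_{J^c}\in\operatorname{Inc}_N^m}\mathbb{E}\left[\|h_{\mathbf{i}_J+\mathbf{i}_{J^c}}(\xi_{\{1,\dots,m\}})\|_{\mathbb{B}}^p\mid\xi_J\right]\Big)^{1/p}>tu\right)du$$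 $$+K(m,p,q,\mathbb{B})\,t^{-q}\Big(\sum_{\mathbf{i}\in\operatorname{Inc}_N^m}\mathbb{E}\left[\|h_{\mathbf{i}}(\xi_{\{1,\dots,m\}})\|_{\mathbb{B}}^p\right]\Big)^{q/p},$$ where the constant $K(m,p,q,\mathbb{B})$ depends only on $m$, $p$, $q$ and $\mathbb{B}$.
   Context: A separable Banach space $(\mathbb{B},\|\cdot\|_{\mathbb{B}})$ is $r$-smooth, $1<r\leq 2$, if there exists an equivalent norm $\|\cdot\|'_{\mathbb{B}}$ on $\mathbb{B}$ such that $\sup_{t>0}\sup_{x,y\in\mathbb{B},\|x\|'_{\mathbb{B}}=\|y\|'_{\mathbb{B}}=1}\frac{\|x+ty\|'_{\mathbb{B}}+\|x-ty\|'_{\mathbb{B}}-2}{t^r}<\infty$. $S^m$ carries the product $\sigma$-algebra. $\operatorname{Inc}^m=\{\mathbf{i}=(i_1,\dots,i_m): 1\leq i_1<\dots<i_m\}$ and $\operatorname{Inc}^m_n=\{\mathbf{i}=(i_1,\dots,i_m):1\leq i_1<\dots<i_m\leq n\}$ (integer entries). For $\mathbf{i}=(i_1,\dots,i_m)$, $\xi_{\mathbf{i}}=(\xi_{i_1},\dots,\xi_{i_m})$; for a finite set $J$ of indices, $\xi_J=(\xi_j)_{j\in J}$ (so $\xi_{\{1,\dots,m\}}=(\xi_1,\dots,\xi_m)$), and conditioning on $\xi_\emptyset$ means taking the expectation. For a proper non-empty subset $J\subset\{1,\dots,m\}$, $\mathbb{N}^{J,m}=\{\sum_{j\in J}v_j\mathbf{e}_j: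 v_j\in\mathbb{N}\}\subset\mathbb{N}^m$, where $\mathbf{e}_j$ has coordinate $j$ equal to $1$ and the others $0$. $J^c=\{1,\dots,m\}\setminus J$, $\mathbf{i}_J$ denotes an element of $\mathbb{N}^{J,m}$ and $\mathbf{i}_{J^c}$ an element of $\mathbb{N}^{J^c,m}$. An empty sum is $0$. *)

(* Defs.v *)
From HB Require Import structures.
From mathcomp Require Import all_boot all_order all_algebra finmap.
From mathcomp Require Import all_classical all_reals all_analysis.
From mathcomp Require Import measurable_realfun.

Set Implicit Arguments.
Unset Strict Implicit.
Unset Printing Implicit Defensive.

Import Order.TTheory GRing.Theory Num.Theory.
Import numFieldNormedType.Exports.

Local Open Scope classical_set_scope.
Local Open Scope ring_scope.

Definition separable_space (X : topologicalType) : Prop :=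
  exists2 D : set X, countable D & dense D.

Definition is_norm (R : realType) (V : lmodType R) (N : V -> R) : Prop :=
  [/\ forall x y, N (x + y) <= N x + N y,
      forall (a : R) x, N (a *: x) = `|a| * N x
    & forall x, N x = 0 -> x = 0].

Definition equivalent_norm (R : realType) (B : normedModType R)
    (N : B -> R) : Prop :=
  is_norm N /\ exists c C : R,
    [/\ 0 < c, 0 < C & forall x, c * `|x| <= N x <= C * `|x|].

Definition smooth_space (R : realType) (B : normedModType R) (r : R) : Prop :=
  exists2 N : B -> R, equivalent_norm N &
    (ereal_sup [set z : \bar R | exists (t : R) (x y : B),
       [/\ (0 < t)%R, N x = 1%R, N y = 1%R &
           z = ((N (x + t *: y) + N (x - t *: y) - 2) / t `^ r)%:E]]
     < +oo)%E.

Notation borel B := (g_sigma_algebraType (@open B)).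

Definition measurable_wrt (T : Type) d' (V : measurableType d')
    (G : set (set T)) (Y : T -> V) : Prop :=
  forall A, measurable A -> G (Y @^-1` A).

Section bochner.
Context d (T : measurableType d) (R : realType) (P : probability T R)
  (B : normedModType R).

Definition simple_function (s : T -> B) : Prop :=
  finite_set (range s) /\ measurable_fun setT (s : T -> borel B).

Definition simple_integral (A : set T) (s : T -> B) : B :=
  \sum_(v \in range s) fine (P (A `&` s @^-1` [set v])) *: v.

Definition is_bochner_integral (A : set T) (X : T -> B) (v : B) : Prop :=
  measurable_fun setT (X : T -> borel B) /\
  exists s : nat -> T -> B,
    [/\ forall n, simple_function (s n),
        (\int[P]_(x in A) (`|X x - s n x|)%:E)%E @[n --> \oo] --> 0%E
      & simple_integral A (s n) @[n --> \oo] --> v].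

(** [Y] is a version of the conditional expectation of [X] given the
    sub-sigma-algebra [G]; the case [A = setT] of the last clause contains
    the integrability of [X] and [Y]. *)
Definition is_cond_expectation (G : set (set T)) (X Y : T -> B) : Prop :=
  measurable_wrt G (Y : T -> borel B) /\
  forall A, G A -> exists v,
    is_bochner_integral A X v /\ is_bochner_integral A Y v.

End bochner.

(** Same notion for a random variable with values in [0, +oo], which need not
    be integrable. *)
Definition is_ge0_cond_expectation d (T : measurableType d) (R : realType)
    (P : probability T R) (G : set (set T)) (X Y : T -> \bar R) : Prop :=
  [/\ forall w, (0 <= Y w)%E,
      measurable_wrt G Y
    & forall A, G A -> (\int[P]_(w in A) X w = \int[P]_(w in A) Y w)%E].

(** Versions are almost surely equal, so the choice made by [xget] does not
    affect probabilities of events expressed with it. *)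
Definition ge0_cond_expectation d (T : measurableType d) (R : realType)
    (P : probability T R) (G : set (set T)) (X : T -> \bar R) : T -> \bar R :=
  xget (cst 0%E) [set Y | is_ge0_cond_expectation P G X Y].

(** The sequence is indexed by the integers [i >= 1]: [xi 0] is unconstrained. *)
Definition iid d d' (T : measurableType d) (S : measurableType d')
    (R : realType) (P : probability T R) (xi : nat -> {RV P >-> S}) : Prop :=
  (forall (F : {fset nat}) (A : nat -> set S),
     (forall i, i \in F -> (1 <= i)%N) -> (forall i, measurable (A i)) ->
     P (\bigcap_(i in [set` F]) xi i @^-1` A i) =
     (\prod_(i <- F) P (xi i @^-1` A i))%E) /\
  (forall i A, (1 <= i)%N -> measurable A ->
     distribution P (xi i) A = distribution P (xi 1%N) A).

Arguments iid {d d' T S R} P xi.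

(** A multi-index [(i_1, ..., i_m)] is a function on ['I_m] = {0, ..., m - 1}:
    the coordinate [i_j] is the value at [j - 1]. Sets [J] of coordinates are
    shifted in the same way, so that [J : {set 'I_m}] stands for
    [{k + 1 | k \in J}]. *)

Definition Inc (m : nat) : set {ffun 'I_m -> nat} :=
  [set i | (forall k, (1 <= i k)%N) /\
           (forall k l : 'I_m, (k < l)%N -> (i k < i l)%N)].

Definition Inc_upto (m n : nat) : set {ffun 'I_m -> nat} :=
  [set i | @Inc m i /\ forall k, (i k <= n)%N].

Arguments Inc m : clear implicits.
Arguments Inc_upto m n : clear implicits.

Definition supported_on (m : nat) (J : {set 'I_m}) : set {ffun 'I_m -> nat} :=
  [set v | forall k, k \notin J -> v k = 0%N].

Definition initial (m : nat) : {ffun 'I_m -> nat} := [ffun k : 'I_m => k.+1].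

Definition xi_tuple (T S : Type) (xi : nat -> T -> S) (m : nat)
    (i : {ffun 'I_m -> nat}) (w : T) : m.-tuple S :=
  [tuple xi (i k) w | k < m].

(** Trivial if [J] is empty, so that conditioning is then the expectation. *)
Definition sigma_xi d' (T : Type) (S : measurableType d') (xi : nat -> T -> S)
    (m : nat) (J : {set 'I_m}) : set (set T) :=
  <<s [set A | exists2 k, k \in J & exists2 C, measurable C &
         A = xi (initial m k) @^-1` C] >>.

Definition degenerated d d' (T : measurableType d) (S : measurableType d')
    (R : realType) (P : probability T R) (B : normedModType R)
    (xi : nat -> {RV P >-> S}) (m : nat) (h : m.-tuple S -> B) : Prop :=
  forall l0 : 'I_m,
    is_cond_expectation P (sigma_xi xi (~: [set l0])%SET)
      (fun w => h (xi_tuple xi (initial m) w)) (cst 0).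

Arguments degenerated {d d' T S R} P {B} xi {m} h.

(* Main.v *)
(** The norm is replaced by an equivalent one [N] for which smoothness gives
    [N (x + y)^p + N (x - y)^p <= 2 N x^p + C N y^p].  Since [N] is the supremum
    of countably many functionals, a mean-zero random [g] then satisfies
    [E N (y + g)^p <= N y^p + C E N g^p].

    Fix all the variables but those of the last index [i_m] and its
    predecessors: the sum over [i_m <= n] is a martingale in [n], and a
    good-lambda inequality bounds the tail of its maximum by the tails of its
    increments, where [i_m] is frozen, and of its conditional variation, where
    the variable of [i_m] is averaged out.  To iterate, the inequality is stated
    for finite families of such martingales depending on extra averaged
    variables.  Good-lambda inequalities can be summed over the levels [L / 64^j]
    with the weights [64^(-j q / p)]; this discretizes the integrals
    [u^(q - 1) P(Y > t u)] over [0, 1].  After [m] steps every index is either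
    frozen (the set [J]) or averaged, and integrating out the averaged variables
    is conditioning on [xi_J].  The three terms of the bound correspond to [J]
    full, [J] proper and non-empty, and [J] empty; in the last case the quantity
    is deterministic and its weighted series is a power of it. *)

Require Import Defs.
From HB Require Import structures.
From mathcomp Require Import all_boot all_order all_algebra finmap.
From mathcomp Require Import all_classical all_reals all_analysis.
From mathcomp Require Import measurable_realfun.
From mathcomp Require Import ring lra.

Set Implicit Arguments.
Unset Strict Implicit.
Unset Printing Implicit Defensive.

Import Order.TTheory GRing.Theory Num.Theory.
Import numFieldNormedType.Exports.

Local Open Scope classical_set_scope.
Local Open Scope ring_scope.

(** * Norming functionals *)

(** No filtration enters the iteration. Everything is transported to powers of one law [mu], where
    integrating a resampled coordinate plays the role of conditioning and invariance under
    resampling that of measurability. The iteration lives on [m + n] coordinates: the last [n] carry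
    the sequence, the first [m] receive the variables that get frozen, so that in the end only the
    law of the first [m] variables is left, as in the bound.

    One good-lambda inequality serves at every stage because its martingales take values in a space
    of type l^p(L^p), whose norm to the power [p] is a sum of integrals of [N^p] and inherits the
    bound for mean-zero perturbations with the same constant.

    The ratio 64 comes from [N(x + y)^p <= 4 (N(x)^p + N(y)^p)]: a path whose increments are below
    [a] leaves level [a] below [8 a], and reaching [64 a] from there takes an increment above
    [64 a / 4 - 8 a = 8 a].

    Degeneracy is given through Bochner integrals; testing it on a countable norming sequence turns
    it into one almost sure property of sections. *)

Section hahn_banach.
Context (R : realType) (V : lmodType R) (N : V -> R).
Hypothesis ND : forall x y, N (x + y) <= N x + N y.
Hypothesis NZ : forall (a : R) x, N (a *: x) = `|a| * N x.

(** Partial functionals are encoded as subspaces of [V * R]. They are automatically single-valued: a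
    difference [(0, r)] of two values satisfies [r <= N 0 = 0], and so does its opposite. *)
Let dominated (G : set (V * R)) :=
  [/\ G !=set0,
      forall a u v, G u -> G v -> G (a *: u.1 + v.1, a * u.2 + v.2)
    & forall u, G u -> u.2 <= N u.1].

Let dominated_total G : dominated G ->
  (forall G', G `<` G' -> ~ dominated G') -> forall v, exists r, G (v, r).
Proof.
move=> [[g0 Gg0] Glin GN] Gmax v; apply: contrapT => nGv.
have G0 : G (0, 0).
  have := Glin (-1) _ _ Gg0 Gg0.
  by rewrite scaleN1r addNr mulN1r addNr.
have cross u w : G u -> G w -> u.2 - N (u.1 - v) <= N (w.1 + v) - w.2.
  move=> Gu Gw; have := GN _ (Glin 1 _ _ Gu Gw).
  rewrite /= scale1r mul1r => uw.
  have := ND (u.1 - v) (w.1 + v); rewrite addrACA addNr addr0 => h.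
  lra.
pose E := [set u.2 - N (u.1 - v) | u in G].
have E0 : E !=set0 by exists (0 - N (0 - v)); exists (0, 0).
have Eub : has_ubound E.
  by exists (N (0 + v) - 0) => _ [u Gu <-]; exact: (cross u (0, 0)).
(* [s] becomes the value at [v]. By [cross], the constraints coming from negative and from positive
   multiples of [v] are compatible. *)
pose s := sup E.
have s_ge u : G u -> u.2 - N (u.1 - v) <= s.
  by move=> Gu; apply: ub_le_sup => //; exists u.
have s_le w : G w -> s <= N (w.1 + v) - w.2.
  by move=> Gw; apply: ge_sup => // _ [u Gu <-]; exact: cross.
pose G' := [set w | exists u c, G u /\ w = (u.1 + c *: v, u.2 + c * s)].
apply: (Gmax G').
  split.
    move=> u Gu; exists u, 0; split => //.
    by rewrite scale0r addr0 mul0r addr0 -surjective_pairing.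
  move=> /(_ (v, s)) G'G; apply: nGv; exists s; apply: G'G.
  by exists (0, 0), 1; split => //=; rewrite scale1r mul1r !add0r.
split.
- by exists (0, 0), (0, 0), 0; split => //=; rewrite scale0r mul0r !addr0.
- move=> a _ _ [u [c [Gu ->]]] [w [e [Gw ->]]].
  exists (a *: u.1 + w.1, a * u.2 + w.2), (a * c + e); split => /=.
    exact: Glin.
  congr pair; last ring.
  by rewrite scalerDr scalerDl scalerA addrACA.
- move=> _ [u [c [Gu ->]]] /=.
  have Gs a : G (a *: u.1, a * u.2).
    by have := Glin a _ _ Gu G0; rewrite /= !addr0.
  have [->|/lt_total /orP[c0|c0]] := eqVneq c 0.
  + by rewrite mul0r scale0r !addr0; exact: GN.
  + have c'0 : 0 < - c by rewrite oppr_gt0.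
    have := s_ge _ (Gs (- c)^-1) => /=.
    rewrite -[X in N (_ - X)](scale1r v) -(mulVf (lt0r_neq0 c'0)) -scalerA.
    rewrite -scalerBr NZ ger0_norm; last by rewrite invr_ge0 ltW.
    move=> h.
    have := ler_wpM2l (ltW c'0) h.
    rewrite mulrBr !mulrA mulfV ?gt_eqF// !mul1r scaleNr opprK.
    lra.
  + have := s_le _ (Gs c^-1) => /=.
    rewrite -[X in N (_ + X)](scale1r v) -(mulVf (lt0r_neq0 c0)) -scalerA.
    rewrite -scalerDr NZ ger0_norm; last by rewrite invr_ge0 ltW.
    move=> h.
    have := ler_wpM2l (ltW c0) h.
    by rewrite mulrBr !mulrA mulfV ?gt_eqF// !mul1r; lra.
Qed.

Lemma hahn_banach x0 : exists f : V -> R,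
  [/\ forall a x y, f (a *: x + y) = a * f x + f y,
      forall x, f x <= N x & f x0 = N x0].
Proof.
have N0 : N 0 = 0 by rewrite -(scale0r 0) NZ normr0 mul0r.
have Nge0 x : 0 <= N x.
  have := ND x (- x); rewrite subrr N0 -scaleN1r NZ normrN1 mul1r.
  lra.
pose G0 := [set w | exists c : R, w = (c *: x0, c * N x0)].
(* Zorn's lemma also asks about the empty chain, whose union is empty; adding the line [G0] through
   [(x0, N x0)] settles that case and forces [f x0 = N x0]. *)
pose Q G := dominated (G0 `|` G).
have [|G [QG Gmax]] := @Zorn_bigcup _ Q.
  move=> F FQ Ftot.
  have [->|/set0P[G1 FG1]] := eqVneq F set0.
    rewrite /Q bigcup_set0 setU0; split.
    - by exists (0 *: x0, 0 * N x0), 0.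
    - move=> a _ _ [b ->] [c ->]; exists (a * b + c) => /=.
      by rewrite scalerDl scalerA mulrDl mulrA.
    - move=> _ [c ->] /=; rewrite NZ ler_wpM2r//; exact: ler_norm.
  split.
  - by have [[g Gg] _ _] := FQ _ FG1; exists g; case: Gg; [left|right; exists G1].
  - move=> a u v Fu Fv.
    have [G2 [FG2 [u2 v2]]] : exists G2, F G2 /\ (G0 `|` G2) u /\ (G0 `|` G2) v.
      case: Fu => [u0|[Gu FGu uGu]]; case: Fv => [v0|[Gv FGv vGv]].
      + by exists G1; do !split => //; left.
      + by exists Gv; do !split => //; [left|right].
      + by exists Gu; do !split => //; [right|left].
      + have [uv|vu] := Ftot _ _ FGu FGv.
          by exists Gv; do !split => //; right => //; exact: uv.
        by exists Gu; do !split => //; right => //; exact: vu.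
    have [_ /(_ a _ _ u2 v2) h _] := FQ _ FG2.
    by case: h; [left|right; exists G2].
  - move=> u [u0|[G2 FG2 uG2]].
      by have [_ _ h] := FQ _ FG1; apply: h; left.
    by have [_ _ h] := FQ _ FG2; apply: h; right.
have Gmax' G' : G0 `|` G `<` G' -> ~ dominated G'.
  move=> [GG' nG'G] dG'; apply: (Gmax G').
    split; first by move=> w Gw; apply: GG'; right.
    by move=> G'G; apply: nG'G => w /G'G; right.
  rewrite /Q; suff -> : G0 `|` G' = G' by [].
  by apply/setUidPr => w G0w; apply: GG'; left.
have /choice[f Gf] := dominated_total QG Gmax'.
have [_ Glin GN] := QG.
have funG v r : (G0 `|` G) (v, r) -> r = f v.
  have le r1 r2 : (G0 `|` G) (v, r1) -> (G0 `|` G) (v, r2) -> r1 <= r2.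
    move=> h1 h2; have := GN _ (Glin (-1) _ _ h2 h1).
    by rewrite /= scaleN1r addNr N0 mulN1r; lra.
  by move=> h; apply/eqP; rewrite eq_le !le.
exists f; split.
- by move=> a x y; apply/esym/funG; exact: (Glin a _ _ (Gf x) (Gf y)).
- by move=> x; exact: (GN _ (Gf x)).
- by apply/esym/funG; left; exists 1; rewrite scale1r mul1r.
Qed.

End hahn_banach.

Definition bounded_linear (R : realType) (B : normedModType R) (f : B -> R) :=
  (forall a x y, f (a *: x + y) = a * f x + f y) /\
  exists C, forall x, `|f x| <= C * `|x|.

Definition norming (R : realType) (B : normedModType R) (N : B -> R)
    (f : nat -> B -> R) :=
  [/\ forall k, bounded_linear (f k), forall k x, f k x <= N x
    & forall x e, 0 < e -> exists k, N x < f k x + e].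

Section equivalent_norms.
Context (R : realType) (B : normedModType R).
Implicit Types N : B -> R.

Section norm.
Variables (N : B -> R) (eN : equivalent_norm N).

Lemma norm_le_add x y : N (x + y) <= N x + N y.
Proof. by case: eN => -[h _ _] _; exact: h. Qed.

Lemma norm_scale a x : N (a *: x) = `|a| * N x.
Proof. by case: eN => -[_ h _] _; exact: h. Qed.

Lemma norm_zero : N 0 = 0.
Proof. by rewrite -(scale0r 0) norm_scale normr0 mul0r. Qed.

Lemma norm_opp x : N (- x) = N x.
Proof. by rewrite -scaleN1r norm_scale normrN1 mul1r. Qed.

Lemma norm_nonneg x : 0 <= N x.
Proof.
have := norm_le_add x (- x); rewrite subrr norm_zero norm_opp.
by rewrite -mulr2n pmulrn_lge0.
Qed.

End norm.

Lemma equivalent_norm_norm : equivalent_norm (fun x : B => `|x|).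
Proof.
split; first by split=> [x y|a x|x /normr0_eq0//]; [exact: ler_normD|exact: normrZ].
by exists 1, 1; split => // x; rewrite !mul1r lexx.
Qed.

(** Functionals that norm the points of a countable dense set suffice: if [f y = N y], then
    [N x <= f x + 2 N (x - y)]. *)
Lemma exists_norming N : separable_space B -> equivalent_norm N ->
  exists f, norming N f.
Proof.
move=> [D cD dD] eN; have [ND [c [C [c0 C0 cNC]]]] := eN.
have [g ginj] := countable_injP _ cD.
have [y0 [_ Dy0]] : [set: B] `&` D !=set0.
  by apply: dD; [exists 0|exact: openT].
pose e n := xget y0 [set x | D x /\ g x = n].
have eE x : D x -> e (g x) = x.
  move=> Dx; rewrite /e; case: xgetP => [y _ [Dy gyx]|/(_ x)].
    by apply: ginj => //; rewrite inE.
  by move=> /= h; exfalso; exact: h.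
have /choice[f fP] : forall n, exists f : B -> R,
    [/\ forall a x y, f (a *: x + y) = a * f x + f y,
        forall x, f x <= N x & f (e n) = N (e n)].
  by move=> n; apply: hahn_banach; [exact: norm_le_add|exact: norm_scale].
have flin k a x y : f k (a *: x + y) = a * f k x + f k y.
  by case: (fP k) => + _ _; apply.
have fN k x : f k x <= N x by case: (fP k) => _ + _; apply.
have f0 k : f k 0 = 0.
  by have := flin k 1 0 0; rewrite scale1r addr0 mul1r; lra.
have fB k x y : f k (x - y) = f k x - f k y.
  by rewrite addrC -scaleN1r flin mulN1r addrC.
exists f; split => //.
  move=> k; split => //; exists C => x.
  have /andP[_ le1] := cNC x.
  rewrite ler_norml (le_trans (fN k x) le1) andbT.
  have := fN k (0 - x); rewrite fB f0 !sub0r norm_opp// => h.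
  by rewrite lerNl (le_trans h).
move=> x d d0.
(* With this radius [N (x - y) < d / 4], since [N] is at most [C] times the norm. *)
pose r := d / (2 * C) / 2.
have r0 : 0 < r by rewrite !divr_gt0 ?mulr_gt0.
have [y [yx Dy]] : (ball x r)^° `&` D !=set0.
  apply: dD; last exact: open_interior.
  by exists x; apply: nbhsx_ballx.
exists (g y).
have fy : f (g y) y = N y by case: (fP (g y)) => _ _; rewrite eE.
have /interior_subset := yx; rewrite -ball_normE /= => xy.
have := fN (g y) (y - x); rewrite fB fy => h1.
have := norm_le_add eN (x - y) y; rewrite subrK => h2.
have : N (x - y) < d / 2 / 2.
  have /andP[_ le1] := cNC (x - y).
  move: xy; rewrite -(ltr_pM2l C0) => xy.
  rewrite (le_lt_trans le1)// (lt_le_trans xy)// /r.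
  suff -> : C * (d / (2 * C) / 2) = d / 2 / 2 by [].
  by field; rewrite gt_eqF.
have NE : N (x - y) = N (y - x) by rewrite -(norm_opp eN (x - y)) opprB.
lra.
Qed.

End equivalent_norms.

Section bounded_linear.
Context (R : realType) (B : normedModType R) (f : B -> R).
Hypothesis bf : bounded_linear f.

Lemma bounded_linearD x y : f (x + y) = f x + f y.
Proof. by case: bf => h _; have := h 1 x y; rewrite scale1r mul1r. Qed.

Lemma bounded_linear0 : f 0 = 0.
Proof. by have := bounded_linearD 0 0; rewrite addr0; lra. Qed.

Lemma bounded_linearZ a x : f (a *: x) = a * f x.
Proof.
by case: bf => h _; have := h a x 0; rewrite !addr0 bounded_linear0 addr0.
Qed.

Lemma bounded_linearN x : f (- x) = - f x.
Proof. by rewrite -scaleN1r bounded_linearZ mulN1r. Qed.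

Lemma bounded_linearB x y : f (x - y) = f x - f y.
Proof. by rewrite bounded_linearD bounded_linearN. Qed.

Lemma bounded_linear_sum (I : Type) (r : seq I) (Q : pred I) (F : I -> B) :
  f (\sum_(i <- r | Q i) F i) = \sum_(i <- r | Q i) f (F i).
Proof.
exact: (big_morph f bounded_linearD bounded_linear0).
Qed.

Lemma continuous_bounded_linear : continuous f.
Proof.
case: bf => _ [C fC] x.
apply/cvgrPdist_lt => e e0.
have C1 : 0 < `|C| + 1 by rewrite ltr_pwDr.
near=> y.
rewrite -bounded_linearB (le_lt_trans (fC _))//.
have : `|x - y| < e / (`|C| + 1).
  by near: y; apply: cvgr_dist_lt => //; rewrite divr_gt0.
rewrite ltr_pdivlMr// => h; rewrite (le_lt_trans _ h)// mulrC ler_wpM2l//.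
by rewrite (le_trans (ler_norm C))// lerDl.
Unshelve. all: by end_near.
Qed.

End bounded_linear.

(* Strong measurability, tested on functionals: for separable [B] this is Borel
   measurability, but it is visibly stable under sums. *)
Definition wmeasurable d (T : measurableType d) (R : realType)
    (B : normedModType R) (F : T -> B) :=
  forall f, bounded_linear f -> measurable_fun setT (f \o F).

Section wmeasurable.
Context (R : realType) (B : normedModType R).

Lemma borel_wmeasurable d (T : measurableType d) (F : T -> B) :
  measurable_fun setT (F : T -> borel B) -> wmeasurable F.
Proof.
move=> mF f bf; apply: (measurability _ (RGenOInfty.measurableE R)).
move=> _ [_ [r ->] <-]; rewrite setTI comp_preimage.
rewrite -[X in measurable X]setTI; apply: mF => //.
apply: sub_sigma_algebra; apply: open_comp => //.
by move=> x _; exact: continuous_bounded_linear.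
Qed.

Section closure.
Context d (T : measurableType d).
Implicit Types F G : T -> B.

Lemma wmeasurable_cst v : wmeasurable (cst v : T -> B).
Proof. by move=> f _; exact: (@measurable_cst _ _ _ _ _ (f v)). Qed.

Lemma wmeasurableD F G : wmeasurable F -> wmeasurable G ->
  wmeasurable (fun x => F x + G x).
Proof.
move=> mF mG f bf.
rewrite (_ : _ \o _ = (fun x => (f \o F) x + (f \o G) x)).
  by apply: measurable_funD; [exact: mF|exact: mG].
by apply/funext => x /=; rewrite bounded_linearD.
Qed.

Lemma wmeasurable_sum (I : Type) (r : seq I) (Q : pred I) (F : I -> T -> B) :
  (forall i, Q i -> wmeasurable (F i)) ->
  wmeasurable (fun x => \sum_(i <- r | Q i) F i x).
Proof.
move=> mF; elim: r => [|i r IH].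
  by under eq_fun do rewrite big_nil; exact: wmeasurable_cst.
under eq_fun do rewrite big_cons.
by case: (boolP (Q i)) => // Qi; apply: wmeasurableD => //; exact: mF.
Qed.

Lemma wmeasurableZ (g : T -> R) F : measurable_fun setT g -> wmeasurable F ->
  wmeasurable (fun x => g x *: F x).
Proof.
move=> mg mF f bf.
rewrite (_ : _ \o _ = (fun x => g x * (f \o F) x)).
  by apply: measurable_funM => //; exact: mF.
by apply/funext => x /=; rewrite bounded_linearZ.
Qed.

Lemma wmeasurableN F : wmeasurable F -> wmeasurable (fun x => - F x).
Proof.
move=> mF; under eq_fun do rewrite -scaleN1r.
exact: wmeasurableZ.
Qed.

Lemma wmeasurable_comp d' (T' : measurableType d') (g : T' -> T) F :
  measurable_fun setT g -> wmeasurable F -> wmeasurable (F \o g).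
Proof.
by move=> mg mF f bf; rewrite compA; apply: measurableT_comp => //; exact: mF.
Qed.

(** [N] is the supremum of the sequence [f], so its superlevel sets are countable unions of those of
    the functionals. *)
Lemma wmeasurable_norm N f F : norming N f -> wmeasurable F ->
  measurable_fun setT (N \o F).
Proof.
move=> [bf fN Nf] mF; apply: (measurability _ (RGenOInfty.measurableE R)).
move=> _ [_ [r ->] <-]; rewrite setTI.
rewrite (_ : _ @^-1` _ = \bigcup_k ((f k \o F) @^-1` `]r, +oo[)).
  apply: bigcup_measurable => k _.
  by rewrite -[X in measurable X]setTI; apply: (mF _ (bf k)).
apply/seteqP; split => x /=; rewrite ?in_itv/= ?andbT.
  move=> rN; have [k] := Nf (F x) (N (F x) - r) ltac:(by rewrite subr_gt0).
  by move=> h; exists k => //=; rewrite in_itv/= andbT; lra.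
by move=> [k _] /=; rewrite in_itv/= andbT => h; exact: lt_le_trans h (fN _ _).
Qed.

End closure.
End wmeasurable.

(** * Smoothness and mean-zero perturbations *)

(** The tangent of [x^p] at [c] lies below the graph; this is Young's inequality with exponents [p]
    and [p / (p - 1)]. *)
Lemma powR_young (R : realType) (p a c : R) : 1 < p -> 0 <= a -> 0 <= c ->
  p * c `^ (p - 1) * a <= a `^ p + (p - 1) * c `^ p.
Proof.
move=> p1 a0 c0; have p0 : 0 < p by lra.
have := @conjugate_powR R a (c `^ (p - 1)) p (p / (p - 1)) a0 (powR_ge0 _ _).
have p10 : p - 1 != 0 by rewrite subr_eq0 gt_eqF.
rewrite -powRrM mulrCA divff// mulr1 invf_div.
move=> /(_ p0 ltac:(by rewrite divr_gt0//; lra)).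
have -> : p^-1 + (p - 1) / p = 1 by field; rewrite gt_eqF.
move=> /(_ erefl) h.
have := ler_wpM2l (ltW p0) h.
rewrite mulrDr !mulrA [p * a `^ p]mulrC mulfK ?gt_eqF// => h1.
rewrite -mulrA [_ `^ _ * a]mulrC mulrA (le_trans h1)// lerD2l.
suff -> : p * c `^ p * (p - 1) / p = (p - 1) * c `^ p by [].
by field; rewrite gt_eqF.
Qed.

Lemma powR_bernoulli (R : realType) (s u : R) : 0 < s <= 1 -> -1 <= u ->
  (1 + u) `^ s <= 1 + s * u.
Proof.
move=> /andP[s0 s1] u1.
have u0 : 0 <= 1 + u by lra.
have [->|sn1] := eqVneq s 1; first by rewrite powRr1// mul1r.
have s1' : s < 1 by rewrite lt_neqAle sn1.
have := @powR_young R s^-1 ((1 + u) `^ s) 1.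
rewrite invf_gt1// => /(_ s1' (powR_ge0 _ _) ler01).
rewrite !powR1 mulr1 -powRrM divff ?gt_eqF// powRr1// mulr1.
move=> /(ler_wpM2l (ltW s0)); rewrite mulrA divff ?gt_eqF// mul1r.
move=> /le_trans; apply.
by rewrite mulrDr mulrBr divff ?gt_eqF// mulr1; lra.
Qed.

(** Factor out [1 + u] and apply Bernoulli with exponent [p - 1 <= 1]; the remainder [(p - 1) u^2]
    is at most [|u|^p] because [|u| <= 1] and [p <= 2]. *)
Lemma powR_taylor_le (R : realType) (p u : R) : 1 < p <= 2 -> `|u| <= 1 ->
  (1 + u) `^ p <= 1 + p * u + `|u| `^ p.
Proof.
move=> /andP[p1 p2] u1.
have u1' : -1 <= u by move: u1; rewrite ler_norml => /andP[].
have u0 : 0 <= 1 + u by lra.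
have pE : p = (p - 1) + 1 by lra.
have -> : (1 + u) `^ p = (1 + u) * (1 + u) `^ (p - 1).
  have [->|un] := eqVneq (1 + u) 0.
    by rewrite mul0r powR0// gt_eqF//; lra.
  by rewrite {1}pE powRD ?un ?implybT// powRr1// mulrC.
have h : (1 + u) `^ (p - 1) <= 1 + (p - 1) * u by apply: powR_bernoulli; lra.
have := ler_wpM2l u0 h => /le_trans; apply.
have u2 : `|u| ^+ 2 <= `|u| `^ p.
  have [->|un] := eqVneq u 0; first by rewrite normr0 expr0n /= powR_ge0.
  rewrite -powR_mulrn//.
  by apply: ger_powR => //; rewrite normr_gt0 un.
have u20 : 0 <= u ^+ 2 by exact: sqr_ge0.
rewrite real_normK ?num_real// in u2.
have : (p - 1) * u ^+ 2 <= u ^+ 2 by rewrite ler_piMl//; lra.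
by rewrite !expr2 in u2 u20 *; nra.
Qed.

Section smooth.
Context (R : realType) (B : normedModType R) (N : B -> R) (p : R).
Hypotheses (eN : equivalent_norm N).

Definition two_point (C : R) := 0 < C /\ forall x y,
  N (x + y) `^ p + N (x - y) `^ p <= 2 * N x `^ p + C * N y `^ p.

(** By homogeneity, let [N x = 1] and let [y] be [t] times a unit vector. For [t <= 1], expand both
    powers around 1: the first-order terms add up to [p] times the quantity that smoothness bounds
    by [M t^r <= M t^p]. For [t > 1], each power is at most [(2 t)^p <= 4 t^p]. *)
Lemma smooth_two_point r : 1 < p -> p <= r <= 2 ->
  (ereal_sup [set z : \bar R | exists (t : R) (x y : B),
       [/\ (0 < t)%R, N x = 1%R, N y = 1%R &
           z = ((N (x + t *: y) + N (x - t *: y) - 2) / t `^ r)%:E]]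
     < +oo)%E -> exists C, two_point C.
Proof.
move=> p1 /andP[pr r2] sup_fin.
have [M [M0 hM]] : exists M : R, 0 <= M /\ forall t x y, 0 < t -> N x = 1 ->
    N y = 1 -> N (x + t *: y) + N (x - t *: y) - 2 <= M * t `^ r.
  move: sup_fin; set E := [set _ | _]; set s := ereal_sup E => sfin.
  exists (Num.max 0 (fine s)); split; first by rewrite le_max lexx.
  move=> t x y t0 Nx Ny.
  have Ez : E ((N (x + t *: y) + N (x - t *: y) - 2) / t `^ r)%:E.
    by exists t, x, y.
  have := ereal_sup_ubound Ez; rewrite -/s.
  have tr0 : 0 < t `^ r by rewrite powR_gt0.
  rewrite -ler_pdivrMr//.
  case: s sfin => [s _|//|]/=; last by rewrite leeNy_eq.
  by rewrite lee_fin => h; rewrite le_max h orbT.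
have p0 : 0 < p by lra.
have N0 x : 0 <= N x by exact: norm_nonneg.
(* [p * M] pays for the first-order terms; 8 covers the two terms [4 t^p] when [t > 1] and the
   remainders [2 t^p] when [t <= 1]. *)
pose C := p * M + 8.
have C8 : 8 <= C by rewrite /C lerDr mulr_ge0// ltW.
have C0 : 0 < C by lra.
have unit_case t x y : 0 < t -> N x = 1 -> N y = 1 ->
    N (x + t *: y) `^ p + N (x - t *: y) `^ p <= 2 + C * t `^ p.
  move=> t0 Nx Ny.
  have Nty : N (t *: y) = t by rewrite (norm_scale eN)// Ny mulr1 gtr0_norm.
  have a1 : N (x + t *: y) <= 1 + t.
    by have := norm_le_add eN x (t *: y); rewrite Nx Nty.
  have b1 : N (x - t *: y) <= 1 + t.
    by have := norm_le_add eN x (- (t *: y)); rewrite (norm_opp eN)// Nx Nty.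
  have a2 : 1 - t <= N (x + t *: y).
    have := norm_le_add eN (x + t *: y) (- (t *: y)).
    by rewrite addrK (norm_opp eN)// Nx Nty; lra.
  have b2 : 1 - t <= N (x - t *: y).
    have := norm_le_add eN (x - t *: y) (t *: y).
    by rewrite subrK Nx Nty; lra.
  have tp0 : 0 <= t `^ p by exact: powR_ge0.
  have [t1|t1] := leP t 1.
    have ta u : 1 - t <= u -> u <= 1 + t ->
        u `^ p <= 1 + p * (u - 1) + t `^ p.
      move=> u1 u2; have ut : `|u - 1| <= t by rewrite ler_norml; lra.
      have := @powR_taylor_le _ p (u - 1).
      rewrite (_ : 1 + (u - 1) = u); last by lra.
      move=> /(_ ltac:(lra) (le_trans ut t1)) /le_trans; apply.
      rewrite lerD2l; apply: ge0_ler_powR => //; rewrite ?nnegrE//; lra.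
    have := ta _ a2 a1; have := ta _ b2 b1.
    have := hM t x y t0 Nx Ny.
    have tr : t `^ r <= t `^ p by apply: ger_powR => //; rewrite t0 t1.
    have := ler_wpM2l M0 tr.
    set A := N _; set A' := N _; set Ap := A `^ p; set Ap' := A' `^ p.
    move=> h1 h2 h3 h4.
    have h5 : p * (A + A' - 2) <= p * (M * t `^ p).
      by rewrite ler_pM2l//; lra.
    rewrite /C; lra.
  have le4 u : 0 <= u -> u <= 1 + t -> u `^ p <= 4 * t `^ p.
    move=> u0 u1.
    apply: (@le_trans _ _ ((2 * t) `^ p)).
      by apply: ge0_ler_powR => //; rewrite ?nnegrE//; lra.
    rewrite powRM//; last lra.
    rewrite ler_wpM2r//.
    rewrite (_ : 4 = 2 `^ 2); last by rewrite powR_mulrn// expr2; lra.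
    by apply: ler_powR => //; lra.
  have := le4 _ (N0 _) a1; have := le4 _ (N0 _) b1.
  have := ler_wpM2r tp0 C8; lra.
exists C; split => // x y.
have Nzero v : N v = 0 -> v = 0 by case: eN => -[_ _ h] _; exact: h.
have [/Nzero ->|y0] := eqVneq (N y) 0.
  by rewrite addr0 subr0 (norm_zero eN)// powR0 ?gt_eqF// mulr0; lra.
have Ny0 : 0 < N y by rewrite lt_neqAle eq_sym y0 N0.
have Cy0 : 0 <= N y `^ p by exact: powR_ge0.
have [/Nzero ->|x0] := eqVneq (N x) 0.
  rewrite add0r sub0r (norm_opp eN)// (norm_zero eN)// powR0 ?gt_eqF// mulr0.
  have := ler_wpM2r Cy0 C8; lra.
have Nx0 : 0 < N x by rewrite lt_neqAle eq_sym x0 N0.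
have Nu v : 0 < N v -> N ((N v)^-1 *: v) = 1.
  by move=> v0; rewrite (norm_scale eN)// ger0_norm ?invr_ge0// mulVf ?gt_eqF.
have := unit_case (N y / N x) _ _ (divr_gt0 Ny0 Nx0) (Nu _ Nx0) (Nu _ Ny0).
rewrite scalerA mulrAC mulfV// mul1r -scalerDr -scalerBr !(norm_scale eN)//.
rewrite ger0_norm ?invr_ge0// !powRM ?invr_ge0// => h.
have Np0 : 0 < N x `^ p by rewrite powR_gt0.
have := ler_wpM2l (ltW Np0) h.
have E z : N x `^ p * ((N x)^-1 `^ p * z) = z.
  by rewrite mulrA -powRM ?invr_ge0// mulfV// powR1 mul1r.
rewrite mulrDr !E mulrDr [N x `^ p * (C * _)]mulrCA [N y `^ p * _]mulrC E.
by lra.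
Qed.

(** Tested on the sequence [f] only: countably many scalar conditions, which can hold together off
    one null set. *)
Definition mean_zero d (S : measurableType d)
    (mu : {measure set S -> \bar R}) (f : nat -> B -> R) (g : S -> B) :=
  forall k, mu.-integrable setT (EFin \o (f k \o g)) /\
            (\int[mu]_s (f k (g s))%:E = 0)%E.

End smooth.

Lemma probability_integral_cst d (S : measurableType d) (R : realType)
    (mu : probability S R) (a : \bar R) : (\int[mu]_s a = a)%E.
Proof.
rewrite (integral_cst _ measurableT) [X in (_ * X)%E](_ : _ = 1%E) ?mule1//.
exact: probability_setT.
Qed.

Section smooth_mean_zero.
Context (R : realType) (B : normedModType R) (N : B -> R) (p : R).
Hypotheses (eN : equivalent_norm N).

Section mean_zero.
Context d (S : measurableType d) (mu : probability S R) (f : nat -> B -> R).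
Hypothesis nf : norming N f.

Let bf k : bounded_linear (f k). Proof. by case: nf. Qed.

Lemma mean_zeroD g h : mean_zero mu f g -> mean_zero mu f h ->
  mean_zero mu f (fun s => g s + h s).
Proof.
move=> mg mh k; have [gi g0] := mg k; have [hi h0] := mh k.
split.
  rewrite (_ : EFin \o _ = (EFin \o (f k \o g)) \+ (EFin \o (f k \o h)))%E.
    exact: integrableD.
  by apply/funext => s /=; rewrite (bounded_linearD (bf k)).
under eq_integral do rewrite (bounded_linearD (bf k)) EFinD.
by rewrite integralD//= g0 h0 adde0.
Qed.

(** The two-point inequality leaves [2 N(y)^p - N(y - g)^p] besides the [C] term. A Jensen-type
    bound of the mean of [N(y - g)^p] from below by [N(y)^p] removes one of the two copies; it comes
    from the tangent of the power and a functional that nearly norms [y]. *)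
Lemma two_point_integral C g y : two_point N p C -> 1 < p -> wmeasurable g ->
  mean_zero mu f g ->
  (\int[mu]_s (N (y + g s) `^ p)%:E <=
   (N y `^ p)%:E + C%:E * \int[mu]_s (N (g s) `^ p)%:E)%E.
Proof.
move=> [C0 hC] p1 mg zg.
have Nge0 := norm_nonneg eN.
have mNp h : wmeasurable h -> measurable_fun setT (fun s : S => (N (h s) `^ p)%:E).
  move=> mh; apply/measurable_EFinP.
  apply: (@measurableT_comp _ _ _ _ _ _ (fun x => x `^ p)); first exact: measurable_powR.
  exact: wmeasurable_norm nf mh.
set J := (\int[mu]_s (N (g s) `^ p)%:E)%E.
have J0 : (0 <= J)%E by apply: integral_ge0 => s _; rewrite lee_fin powR_ge0.
have [Joo|Jfin] := eqVneq J +oo%E.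
  by rewrite Joo gt0_muley ?lte_fin// addey// leey.
have Ng_int : mu.-integrable setT (fun s => (N (g s) `^ p)%:E).
  apply/integrableP; split; first exact: mNp.
  under eq_integral do rewrite gee0_abs ?lee_fin ?powR_ge0//.
  by rewrite ltey.
set c := N y.
have c0 : 0 <= c by exact: Nge0.
have cp0 : 0 <= p * c `^ (p - 1) by rewrite mulr_ge0 ?powR_ge0//; lra.
(* The lower bound [N(y - g)^p >= p c^(p-1) f_k(y - g) - (p-1) c^p], with
   [c = N y], has an explicit mean. *)
have key k : (\int[mu]_s (N (y + g s) `^ p)%:E <=
    ((p + 1) * c `^ p - p * c `^ (p - 1) * f k y)%:E + C%:E * J)%E.
  have [gi gz] := zg k.
  set A := (p + 1) * c `^ p - _.
  pose h s := (A%:E + (C%:E * (N (g s) `^ p)%:E +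
                (p * c `^ (p - 1))%:E * (f k (g s))%:E))%E.
  have le s : ((N (y + g s) `^ p)%:E <= h s)%E.
    rewrite /h -!EFinM -!EFinD lee_fin.
    have := hC y (g s); rewrite -/c.
    have := powR_young p1 (Nge0 (y - g s)) c0.
    have : p * c `^ (p - 1) * f k (y - g s) <= p * c `^ (p - 1) * N (y - g s).
      by rewrite ler_wpM2l//; case: nf.
    rewrite (bounded_linearB (bf k)) /A; lra.
  have Ai : mu.-integrable setT (cst A%:E) by exact: finite_measure_integrable_cst.
  have Ci : mu.-integrable setT (fun s => C%:E * (N (g s) `^ p)%:E)%E.
    exact: integrableZl.
  have ki : mu.-integrable setT (fun s => (p * c `^ (p - 1))%:E * (f k (g s))%:E)%E.
    exact: integrableZl.
  have hi : mu.-integrable setT h.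
    by apply: integrableD => //; exact: integrableD.
  have /integrableP[mh _] := hi.
  apply: (@le_trans _ _ (\int[mu]_s h s)%E).
    apply: ge0_le_integral => //.
    - by move=> s _; rewrite lee_fin powR_ge0.
    - by apply: mNp; apply: wmeasurableD => //; exact: wmeasurable_cst.
  rewrite /h integralD//; last exact: integrableD.
  rewrite integralD// !integralZl// gz mule0 adde0.
  by rewrite (probability_integral_cst mu).
apply/lee_addgt0Pr => e e0.
(* The [+ 1] keeps the denominator positive when [N y = 0]. *)
have cp1 : 0 < p * c `^ (p - 1) + 1 by lra.
have [k hk] : exists k, c < f k y + e / (p * c `^ (p - 1) + 1).
  by case: nf => _ _; apply; rewrite divr_gt0.
apply: (le_trans (key k)).
rewrite addeAC leeD2r// -EFinD lee_fin.
have E1 : p * c `^ (p - 1) * c = p * c `^ p.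
  have [->|cn] := eqVneq c 0; first by rewrite !powR0 ?mulr0 ?gt_eqF//; lra.
  rewrite -mulrA -[X in _ * (_ * X)]powRr1// -powRD ?cn ?implybT//.
  by rewrite subrK.
have := ler_wpM2l cp0 (ltW hk).
rewrite mulrDr E1.
have : p * c `^ (p - 1) * (e / (p * c `^ (p - 1) + 1)) <= e.
  rewrite mulrCA ler_piMr ?(ltW e0)// ler_pdivrMr// mul1r; lra.
lra.
Qed.

End mean_zero.
End smooth_mean_zero.

(** * Laws of i.i.d. tuples *)

Definition upd (S : Type) n (x : n.-tuple S) (j : 'I_n) (s : S) : n.-tuple S :=
  [tuple if k == j then s else tnth x k | k < n].

Lemma tnth_upd (S : Type) n (x : n.-tuple S) (j k : 'I_n) (s : S) :
  tnth (upd x j s) k = if k == j then s else tnth x k.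
Proof. by rewrite tnth_mktuple. Qed.

Lemma measurable_upd d (S : measurableType d) n (j : 'I_n) :
  measurable_fun setT (fun z : n.-tuple S * S => upd z.1 j z.2).
Proof.
apply/measurable_fun_tnthP => k.
rewrite (_ : _ \o _ = fun z : n.-tuple S * S =>
    if k == j then z.2 else tnth z.1 k).
  case: (k == j); first exact: measurable_snd.
  apply: (@measurableT_comp _ _ _ _ _ _ (fun x : n.-tuple S => tnth x k)) => //=.
  exact: measurable_tnth.
by apply/funext => z /=; rewrite tnth_upd.
Qed.

Lemma exists_law d d' (T : measurableType d) (T' : measurableType d')
    (R : realType) (P : probability T R) (X : T -> T') :
  measurable_fun setT X -> exists law : probability T' R,
    (forall A, law A = P (X @^-1` A)) /\
    forall f : T' -> \bar R, measurable_fun setT f -> (forall x, 0 <= f x)%E ->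
    (\int[law]_x f x = \int[P]_w f (X w))%E.
Proof.
move=> mX.
pose X' : {RV P >-> T'} := HB.pack X (isMeasurableFun.Build _ _ _ _ X mX).
exists (distribution P X'); split => // f mf f0.
by rewrite ge0_integral_distribution.
Qed.

Section power.
Context d (S : measurableType d) (R : realType).

Definition box n (A : 'I_n -> set S) : set (n.-tuple S) :=
  [set x | forall j, A j (tnth x j)].

Lemma measurable_box n (A : 'I_n -> set S) :
  (forall j, measurable (A j)) -> measurable (box A).
Proof.
move=> mA; rewrite (_ : box A = \bigcap_(j in setT) ((@tnth n S)^~ j @^-1` A j)).
  apply: fin_bigcap_measurable => // j _.
  by rewrite -[X in measurable X]setTI; exact: measurable_tnth.
by apply/seteqP; split => x /= h j; [move=> _|]; exact: h.
Qed.

Lemma box_measure_unique n (m1 m2 : probability (n.-tuple S) R) :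
  (forall A : 'I_n -> set S, (forall j, measurable (A j)) ->
    m1 (box A) = m2 (box A)) ->
  forall E, measurable E -> m1 E = m2 E.
Proof.
move=> m12.
pose G := [set E | exists2 A : 'I_n -> set S,
  (forall j, measurable (A j)) & E = box A].
apply: (@measure_unique _ _ _ G (fun=> setT)).
- apply/seteqP; split.
    apply: smallest_sub; first exact: smallest_sigma_algebra.
    move=> E; rewrite -bigcup_seq => -[/= j _ [C mC <-]].
    apply: sub_sigma_algebra; exists (fun k => if k == j then C else setT).
      by move=> k; case: ifP.
    apply/seteqP; split => x /=.
      by move=> [_ Cx] k; case: eqP => // ->.
    by move=> /(_ j); rewrite eqxx; split.
  apply: smallest_sub; first exact: sigma_algebra_measurable.
  by move=> _ [A mA ->]; exact: measurable_box.
- move=> _ _ [A mA ->] [C mC ->]; exists (fun j => A j `&` C j).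
    by move=> j; exact: measurableI.
  apply/seteqP; split => x /=; first by move=> [hA hC] j; split.
  by move=> h; split => j; case: (h j).
- move=> _; exists (fun=> setT) => //.
  by apply/seteqP; split.
- by rewrite bigcup_const.
- by move=> _ [A mA ->]; exact: m12.
- by move=> k; rewrite (le_lt_trans (probability_le1 _ _))// ltry.
Qed.

(* [law] is the [n]-th power of [mu], in the form used to resample one
   coordinate. *)
Definition is_power n (mu : probability S R) (law : probability (n.-tuple S) R) :=
  forall (j : 'I_n) (f : n.-tuple S -> \bar R), measurable_fun setT f ->
  (forall x, 0 <= f x)%E ->
  (\int[law]_x f x = \int[law]_x \int[mu]_s f (upd x j s))%E.

(** [law] and the image of [law \x mu] under replacement of coordinate [j] agree on boxes, hence
    everywhere. *)
Lemma box_is_power n (mu : probability S R) (law : probability (n.-tuple S) R) :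
  (forall A : 'I_n -> set S, (forall j, measurable (A j)) ->
    law (box A) = \prod_(j < n) mu (A j))%E ->
  is_power mu law.
Proof.
move=> lawE j f mf f0.
pose P2 : probability _ R := (law \x mu)%E.
have [nu [nuE nui]] := exists_law P2 (@measurable_upd _ S n j).
have law_nu E : measurable E -> law E = nu E.
  apply: box_measure_unique => A mA.
  rewrite nuE lawE// (_ : _ @^-1` _ =
    box (fun k => if k == j then setT else A k) `*` A j).
    transitivity (law (box (fun k => if k == j then setT else A k)) * mu (A j))%E.
    rewrite lawE; last by move=> k; case: ifP.
    rewrite (bigD1 j)//= muleC; congr (_ * _)%E.
    rewrite [RHS](bigD1 j)//= eqxx [X in (X * _)%E](_ : _ = 1%E).
      by rewrite mul1e; apply: eq_bigr => k /negbTE ->.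
    exact: probability_setT.
    apply/esym/product_measure1E => //.
    by apply: measurable_box => k; case: ifP.
  apply/seteqP; split => -[x s] /=.
    move=> h; split => [k|] /=.
      by case: eqP => // /eqP kj; have := h k; rewrite tnth_upd (negbTE kj).
    by have := h j; rewrite tnth_upd eqxx.
  move=> [/= h hs] k; rewrite tnth_upd; case: eqP => [->//|/eqP kj].
  by have := h k; rewrite (negbTE kj).
rewrite (eq_measure_integral nu); last by move=> A mA _; exact: law_nu.
rewrite nui// /P2 fubini_tonelli1//.
exact: (measurableT_comp mf (@measurable_upd _ S n j)).
Qed.

End power.

Section iid_power.
Context d d' (T : measurableType d) (S : measurableType d') (R : realType).
Context (P : probability T R) (xi : nat -> {RV P >-> S}).
Hypothesis iid_xi : iid P xi.

Lemma measurable_xi_tuple n : measurable_fun setT (xi_tuple xi (initial n)).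
Proof.
apply/measurable_fun_tnthP => k.
rewrite (_ : _ \o _ = xi k.+1); first exact: measurable_funPT.
by apply/funext => w /=; rewrite tnth_mktuple ffunE.
Qed.

Lemma iid_power : exists mu : probability S R, forall n,
  exists law : probability (n.-tuple S) R,
  [/\ forall A, law A = P (xi_tuple xi (initial n) @^-1` A),
      forall f : n.-tuple S -> \bar R, measurable_fun setT f ->
        (forall x, 0 <= f x)%E ->
        (\int[law]_x f x = \int[P]_w f (xi_tuple xi (initial n) w))%E
    & is_power mu law].
Proof.
have [mu [muE _]] := exists_law P (measurable_funPT (xi 1%N)).
exists mu => n.
have [law [lawE lawi]] := exists_law P (@measurable_xi_tuple n).
exists law; split => //; apply: box_is_power => A mA.
have [indep ident] := iid_xi.
case: n => [|n] in law lawE lawi A mA *.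
  rewrite big_ord0 (_ : box A = setT) ?probability_setT//.
  by apply/seteqP; split => // x _ [].
(* The sequence starts at 1 while tuple coordinates start at 0. *)
pose A' i := A (inord i.-1).
have := indep [fset i in iota 1 n.+1]%fset A'.
have Fi i : (i \in [fset i in iota 1 n.+1]%fset) = (i \in iota 1 n.+1).
  by rewrite in_fset.
move=> /(_ _ _)/[!lawE]; rewrite (_ : \bigcap_(i in _) _ =
    xi_tuple xi (initial n.+1) @^-1` box A); last first.
  apply/seteqP; split => w /=.
    move=> h j; rewrite tnth_mktuple ffunE.
    have := h j.+1; rewrite /= Fi mem_iota /A' /= inord_val; apply.
    by rewrite add1n ltnS ltn_ord.
  move=> h i; rewrite /= Fi mem_iota add1n /A' => /andP[i0 iN].
  have := h (inord i.-1); rewrite tnth_mktuple ffunE inordK ?prednK//.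
move=> ->; last 2 first.
- by move=> i; rewrite Fi mem_iota => /andP[].
- by move=> i; exact: mA.
rewrite (perm_big (iota 1 n.+1)); last first.
  by apply: uniq_perm; [exact: fset_uniq|exact: iota_uniq|exact: Fi].
rewrite (_ : iota 1 n.+1 = index_iota 1 n.+2); last by rewrite /index_iota subSS subn0.
rewrite big_add1 big_mkord; apply: eq_bigr => j _.
rewrite /A' /= inord_val muE; exact: (ident j.+1).
Qed.

End iid_power.

(** * Measurability of compositions and iterated integrals *)

Section measurable_combinators.
Context d0 d1 d2 (T : measurableType d0) (T1 : measurableType d1)
  (T2 : measurableType d2).

Lemma measurable_fun_comp (g : T1 -> T2) (a : T -> T1) :
  measurable_fun setT g -> measurable_fun setT a ->
  measurable_fun setT (fun x => g (a x)).
Proof. exact: measurableT_comp. Qed.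

Lemma measurable_fun_fst (a : T -> T1 * T2) :
  measurable_fun setT a -> measurable_fun setT (fun x => (a x).1).
Proof. by move=> ma; apply: measurableT_comp; first exact: measurable_fst. Qed.

Lemma measurable_fun_snd (a : T -> T1 * T2) :
  measurable_fun setT a -> measurable_fun setT (fun x => (a x).2).
Proof. by move=> ma; apply: measurableT_comp; first exact: measurable_snd. Qed.

End measurable_combinators.

Lemma measurable_fun_comp2 d0 d1 d2 d3 (T : measurableType d0)
  (T1 : measurableType d1) (T2 : measurableType d2) (T3 : measurableType d3)
  (g : T1 -> T2 -> T3) (a : T -> T1) (b : T -> T2) :
  measurable_fun setT (fun z : T1 * T2 => g z.1 z.2) ->
  measurable_fun setT a -> measurable_fun setT b ->
  measurable_fun setT (fun x => g (a x) (b x)).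
Proof.
move=> mg ma mb.
exact: (measurable_fun_comp mg (measurable_fun_pair ma mb)).
Qed.


Ltac measurable_proj := repeat first
  [ exact: measurable_id | exact: measurable_cst | exact: measurable_fst
  | exact: measurable_snd | assumption | apply: measurable_fun_pair
  | apply: measurable_fun_fst | apply: measurable_fun_snd ].

Section tonelli.
Context d1 d2 (T1 : measurableType d1) (T2 : measurableType d2) (R : realType).
Variables (m1 : probability T1 R) (m2 : probability T2 R).
Variable f : T1 -> T2 -> \bar R.
Hypotheses (mf : measurable_fun setT (fun z : T1 * T2 => f z.1 z.2)).
Hypothesis f0 : forall x y, (0 <= f x y)%E.

Lemma measurable_integral2 : measurable_fun setT (fun x => \int[m2]_y f x y)%E.
Proof. by apply: (measurable_fun_fubini_tonelli_F _ mf). Qed.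

Lemma integral_pairE :
  (\int[m1 \x m2]_z f z.1 z.2 = \int[m1]_x \int[m2]_y f x y)%E.
Proof. by rewrite (fubini_tonelli1 _ mf). Qed.

Lemma integral_swap :
  (\int[m1]_x \int[m2]_y f x y = \int[m2]_y \int[m1]_x f x y)%E.
Proof.
by apply: (@fubini_tonelli _ _ _ _ _ m1 m2 (fun z => f z.1 z.2)).
Qed.

End tonelli.
Arguments measurable_integral2 {d1 d2 T1 T2 R m2} f.
Arguments integral_pairE {d1 d2 T1 T2 R m1 m2} f.
Arguments integral_swap {d1 d2 T1 T2 R m1 m2} f.


Section npow.
Context (R : realType) (B : normedModType R) (N : B -> R) (p : R).
Hypotheses (eN : equivalent_norm N) (p1 : 1 < p) (p2 : p <= 2).

Definition npow (v : B) : \bar R := (N v `^ p)%:E.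

Lemma npow_ge0 v : (0 <= npow v)%E.
Proof. by rewrite lee_fin powR_ge0. Qed.

Lemma npow0 : npow 0 = 0%E.
Proof. by rewrite /npow (norm_zero eN) powR0// gt_eqF// (lt_trans ltr01). Qed.

(** The factor is [2^p <= 4], from [N (u + v) <= 2 max (N u) (N v)]. *)
Lemma npowD u v : (npow (u + v)%R <= 4%:E * (npow u + npow v))%E.
Proof.
rewrite /npow -EFinD -EFinM lee_fin.
have p0 : 0 <= p by rewrite (le_trans ler01)// ltW.
have p2' : p <= 2 := p2.
have Nu := norm_nonneg eN u; have Nv := norm_nonneg eN v.
have : N (u + v) `^ p <= (2 * Num.max (N u) (N v)) `^ p.
  apply: ge0_ler_powR; rewrite ?nnegrE ?(norm_nonneg eN)//.
    by rewrite mulr_ge0// le_max Nu.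
  rewrite (le_trans (norm_le_add eN u v))//.
  have : N u <= Num.max (N u) (N v) by rewrite le_max lexx.
  have : N v <= Num.max (N u) (N v) by rewrite le_max lexx orbT.
  lra.
rewrite powRM ?le_max ?Nu//.
move=> /le_trans; apply.
apply: ler_pM; rewrite ?powR_ge0//.
  rewrite (_ : 4 = 2 `^ 2); last by rewrite powR_mulrn// expr2; lra.
  by apply: ler_powR => //; lra.
have := powR_ge0 (N u) p; have := powR_ge0 (N v) p.
by rewrite /Num.max; case: ifP => _; lra.
Qed.

Lemma measurable_npow f d (T : measurableType d) (F : T -> B) : norming N f ->
  wmeasurable F -> measurable_fun setT (fun x => npow (F x)).
Proof.
move=> nf mF; apply/measurable_EFinP.
apply: (@measurableT_comp _ _ _ _ _ _ (fun x => x `^ p)).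
  exact: measurable_powR.
exact: wmeasurable_norm nf mF.
Qed.

End npow.

Section resample.
Context (R : realType) (B : normedModType R) (N : B -> R) (p C : R).
Context (f : nat -> B -> R).
Hypotheses (eN : equivalent_norm N) (nf : norming N f) (p1 : 1 < p).
Hypothesis C2 : two_point N p C.
Context dX dS dZ (X : measurableType dX) (S : measurableType dS)
  (Z : measurableType dZ).
Context (lam : probability X R) (mu : probability S R) (rho : probability Z R).
Variable u : X -> S -> X.
Hypothesis mu_ : measurable_fun setT (fun z : X * S => u z.1 z.2).
Hypothesis resample : forall g : X -> \bar R, measurable_fun setT g ->
  (forall x, 0 <= g x)%E ->
  (\int[lam]_x g x = \int[lam]_x \int[mu]_s g (u x s))%E.

Local Notation npow := (npow N p).

(** Since [y] and [A] ignore the resampled coordinate, writing [x] as [u x s] leaves [s] in [dd]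
    alone. Then [two_point_integral] applies for almost every fixed [(x, z)], and the result is
    integrated. *)
Lemma two_point_resample (y dd : X -> Z -> B) (A : set X) :
  measurable A ->
  wmeasurable (fun z : X * Z => y z.1 z.2) ->
  wmeasurable (fun z : X * Z => dd z.1 z.2) ->
  (forall x s z, y (u x s) z = y x z) ->
  (forall x s, A (u x s) <-> A x) ->
  {ae (lam \x rho)%E, forall z, mean_zero mu f (fun s => dd (u z.1 s) z.2)} ->
  (\int[lam]_x \int[rho]_z npow (y x z + \1_A x *: dd x z)%R <=
   \int[lam]_x \int[rho]_z npow (y x z) +
   C%:E * \int[lam]_x ((\1_A x)%:E *
     \int[mu]_s \int[rho]_z npow (dd (u x s) z)))%E.
Proof.
move=> mA my md yu Au dz.
have C0 : 0 < C by case: C2.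
have m1A : measurable_fun setT (\1_A : X -> R) by exact: measurable_indic.
have mw d' (T : measurableType d') (h : X -> Z -> B) a b :
    wmeasurable (fun z : X * Z => h z.1 z.2) ->
    measurable_fun setT a -> measurable_fun setT b ->
    wmeasurable (fun w : T => h (a w) (b w)).
  by move=> mh ma mb; exact: (wmeasurable_comp (measurable_fun_pair ma mb) mh).
have mn d' (T : measurableType d') (h : X -> Z -> B) a b :
    wmeasurable (fun z : X * Z => h z.1 z.2) ->
    measurable_fun setT a -> measurable_fun setT b ->
    measurable_fun setT (fun w : T => npow (h (a w) (b w))).
  by move=> mh ma mb; apply: (measurable_npow _ nf); exact: mw.
have mu2 d' (T : measurableType d') (a : T -> X) (b : T -> S) :
    measurable_fun setT a -> measurable_fun setT b ->
    measurable_fun setT (fun w => u (a w) (b w)).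
  exact: measurable_fun_comp2.
pose G x s z := npow (y x z + \1_A x *: dd (u x s) z).
have G0 x s z : (0 <= G x s z)%E by exact: npow_ge0.
have mG d' (T : measurableType d') (a : T -> X) b c :
    measurable_fun setT a -> measurable_fun setT b -> measurable_fun setT c ->
    measurable_fun setT (fun w => G (a w) (b w) (c w)).
  move=> ma mb mc; apply: (measurable_npow _ nf); apply: wmeasurableD.
    exact: mw.
  apply: wmeasurableZ; last by apply: mw => //; exact: mu2.
  exact: measurable_fun_comp.
have mAdd : wmeasurable (fun z : X * Z => y z.1 z.2 + \1_A z.1 *: dd z.1 z.2).
  apply: wmeasurableD => //; apply: wmeasurableZ => //.
  by apply: measurable_fun_comp => //; measurable_proj.
have step1 : (\int[lam]_x \int[rho]_z npow (y x z + \1_A x *: dd x z)%R =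
    \int[lam]_x \int[mu]_s \int[rho]_z G x s z)%E.
  rewrite resample; last 2 first.
  - apply: (measurable_integral2 (fun x z => npow (y x z + \1_A x *: dd x z))).
      exact: (measurable_npow _ nf).
    by move=> ? ?; exact: npow_ge0.
  - by move=> x; apply: integral_ge0 => z _; exact: npow_ge0.
  apply: eq_integral => x _; apply: eq_integral => s _.
  apply: eq_integral => z _; rewrite /G yu.
  suff -> : \1_A (u x s) = \1_A x :> R by [].
  rewrite !indicE (_ : (u x s \in A) = (x \in A))//.
  by apply/idP/idP; rewrite !inE => /Au.
have step2 : (\int[lam]_x \int[mu]_s \int[rho]_z G x s z =
    \int[lam \x rho]_w \int[mu]_s G w.1 s w.2)%E.
  rewrite (integral_pairE (fun x z => \int[mu]_s G x s z)%E); last 2 first.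
  - apply: (measurable_integral2 (fun w s => G w.1 s w.2)) => //.
    by apply: mG; measurable_proj.
  - by move=> x z; apply: integral_ge0.
  apply: eq_integral => x _; apply: (integral_swap (G x)) => //.
  by apply: mG; measurable_proj.
rewrite step1 step2.
pose g1 (w : X * Z) := npow (y w.1 w.2).
pose g2 (w : X * Z) := (\int[mu]_s npow (dd (u w.1 s) w.2))%E.
have mg1 : measurable_fun setT g1 by apply: mn => //; measurable_proj.
have mg2 : measurable_fun setT g2.
  apply: (measurable_integral2 (fun w s => npow (dd (u w.1 s) w.2))).
  - by apply: mn => //; [apply: mu2|]; measurable_proj.
  - by move=> *; exact: npow_ge0.
have g20 w : (0 <= g2 w)%E by apply: integral_ge0 => *; exact: npow_ge0.
have m1A1 : measurable_fun setT (fun w : X * Z => (\1_A w.1)%:E : \bar R).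
  apply/measurable_EFinP.
  by apply: measurable_fun_comp => //; measurable_proj.
have mAg2 : measurable_fun setT (fun w : X * Z => ((\1_A w.1)%:E * g2 w)%E).
  exact: emeasurable_funM.
have Ag20 w : (0 <= (\1_A w.1)%:E * g2 w)%E by rewrite mule_ge0// lee_fin indicE.
apply: (@le_trans _ _ (\int[lam \x rho]_w
    (g1 w + C%:E * ((\1_A w.1)%:E * g2 w)))%E).
  apply: (ae_ge0_le_integral measurableT).
  - by move=> w _; apply: integral_ge0.
  - apply: (measurable_integral2 (fun w s => G w.1 s w.2)) => //.
    by apply: mG; measurable_proj.
  - by move=> w _; rewrite adde_ge0 ?npow_ge0// mule_ge0// lee_fin ltW.
  - by apply: emeasurable_funD => //; exact: measurable_funeM.
  apply: filterS dz => w dz _.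
  rewrite /G /g1 /g2 indicE; case: (boolP (w.1 \in A)) => wA /=.
    under eq_integral do rewrite scale1r.
    rewrite mul1e; apply: (two_point_integral eN nf _ C2) => //.
    by apply: mw => //; apply: mu2; measurable_proj.
  under eq_integral do rewrite scale0r addr0.
  by rewrite probability_integral_cst mul0e mule0 adde0.
rewrite ge0_integralD//; last 3 first.
- by move=> w _; exact: npow_ge0.
- by move=> w _; rewrite mule_ge0// lee_fin ltW.
- exact: measurable_funeM.
rewrite (integral_pairE (fun x z => npow (y x z))%E)//; last first.
  by move=> *; exact: npow_ge0.
rewrite leeD2l// ge0_integralZl//; last by rewrite lee_fin ltW.
rewrite lee_pmul2l ?lte_fin// (integral_pairE
  (fun x z => ((\1_A x)%:E * \int[mu]_s npow (dd (u x s) z))%E)%E)//; last first.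
  by move=> x z; have := Ag20 (x, z).
rewrite le_eqVlt; apply/orP; left; apply/eqP; apply: eq_integral => x _.
rewrite (@ge0_integralZl _ _ _ rho _ measurableT
  (fun z => \int[mu]_s npow (dd (u x s) z))%E); last 3 first.
- apply: (measurable_integral2 (fun z s => npow (dd (u x s) z))).
    by apply: mn => //; apply: mu2; measurable_proj.
  by move=> *; exact: npow_ge0.
- by move=> z _; have := g20 (x, z).
- by rewrite lee_fin indicE.
congr (_ * _)%E; apply: (integral_swap (fun z s => npow (dd (u x s) z))).
- by apply: mn => //; apply: mu2; measurable_proj.
- by move=> *; exact: npow_ge0.
Qed.

End resample.

(** * Good-lambda inequality *)

Lemma measure_le_setU3 d (T : measurableType d) (R : realType)
    (m : {measure set T -> \bar R}) (E A B C : set T) :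
  measurable E -> measurable A -> measurable B -> measurable C ->
  E `<=` A `|` B `|` C -> (m E <= m A + m B + m C)%E.
Proof.
move=> mE mA mB mC EABC.
have mAB : measurable (A `|` B) by exact: measurableU.
apply: (@le_trans _ _ (m (A `|` B `|` C))).
  by apply: le_measure => //; rewrite inE//; exact: measurableU.
apply: (@le_trans _ _ (m (A `|` B) + m C)%E); first exact: measureU2.
by rewrite leeD2r//; exact: measureU2.
Qed.

Section good_lambda.
Context (R : realType) (B : normedModType R) (N : B -> R) (p C : R).
Context (f : nat -> B -> R).
Hypotheses (eN : equivalent_norm N) (nf : norming N f) (p1 : 1 < p)
  (p2 : p <= 2) (C2 : two_point N p C).
Context dX dS dZ (X : measurableType dX) (S : measurableType dS)
  (Z : measurableType dZ).
Context (lam : probability X R) (mu : probability S R) (rho : probability Z R).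
Context (I : Type) (r : seq I) (L : nat).
(** [u l x s] puts [s] in the coordinate of time [l]. Invariance under [u k] for all later [k]
    replaces measurability with respect to the past. *)
Variable u : nat -> X -> S -> X.
Hypothesis mu_ : forall l, measurable_fun setT (fun z : X * S => u l z.1 z.2).
Hypothesis resample : forall l (g : X -> \bar R), (l < L)%N ->
  measurable_fun setT g -> (forall x, 0 <= g x)%E ->
  (\int[lam]_x g x = \int[lam]_x \int[mu]_s g (u l x s))%E.
Hypothesis uC : forall k l x s s', (k < l)%N -> (l < L)%N ->
  u k (u l x s) s' = u l (u k x s') s.
Hypothesis uK : forall l x s s', (l < L)%N -> u l (u l x s) s' = u l x s'.
Variable D : nat -> I -> X -> Z -> B.
Hypothesis mD : forall l b, wmeasurable (fun z : X * Z => D l b z.1 z.2).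
Hypothesis adapted : forall l k b x s z, (l < k)%N -> (k < L)%N ->
  D l b (u k x s) z = D l b x z.
Hypothesis centered : forall l b, (l < L)%N ->
  {ae (lam \x rho)%E, forall z, mean_zero mu f (fun s => D l b (u l z.1 s) z.2)}.

Local Notation npow := (npow N p).

(** The [p]-th power of the norm of [F] in l^p over [r] of L^p of [rho], with values in [B] normed
    by [N]. *)
Definition Vp (F : I -> Z -> B) : \bar R :=
  (\sum_(b <- r) \int[rho]_z npow (F b z))%E.

Definition partial (n : nat) (x : X) (b : I) (z : Z) : B :=
  \sum_(l < n) D l b x z.

(** Conditional expectation of the [Vp] of the increment given the past: coordinate [l] is
    integrated out. *)
Definition predicted (l : nat) (x : X) : \bar R :=
  (\int[mu]_s Vp (fun b z => D l b (u l x s) z))%E.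

Definition bracket (n : nat) (x : X) : \bar R := (\sum_(l < n) predicted l x)%E.

Definition exceeds (n : nat) (a : R) : set X :=
  [set x | exists2 k, (k <= n)%N & (a%:E < Vp (partial k x))%E].

Let C0 : 0 < C. Proof. by case: C2. Qed.

Lemma Vp_ge0 F : (0 <= Vp F)%E.
Proof.
by apply: sume_ge0 => b _; apply: integral_ge0 => z _; exact: npow_ge0.
Qed.

Lemma Vp0 : Vp (fun _ _ => 0) = 0%E.
Proof.
rewrite /Vp big1// => b _.
by under eq_integral do rewrite (npow0 eN p1); rewrite integral0.
Qed.

Lemma VpD F G : (forall b, wmeasurable (F b)) -> (forall b, wmeasurable (G b)) ->
  (Vp (fun b z => F b z + G b z)%R <= 4%:E * (Vp F + Vp G))%E.
Proof.
move=> mF mG; rewrite /Vp -big_split/= ge0_sume_distrr; last first.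
  by move=> b _; rewrite adde_ge0//; apply: integral_ge0 => z _; exact: npow_ge0.
apply: lee_sum => b _.
have mn H : wmeasurable H -> measurable_fun setT (fun z : Z => npow (H z)).
  by move=> mH; apply: (measurable_npow _ nf).
have n0 (H : Z -> B) z : [set: Z] z -> (0 <= npow (H z))%E.
  by move=> _; exact: npow_ge0.
rewrite -ge0_integralD//; [|exact: n0|exact: mn|exact: n0|exact: mn].
have mFG : measurable_fun setT (fun z => npow (F b z) + npow (G b z))%E.
  by apply: emeasurable_funD; exact: mn.
rewrite -ge0_integralZl//; last by move=> z _; rewrite adde_ge0 ?npow_ge0.
apply: (ge0_le_integral _ measurableT).
- exact: n0.
- by apply: mn; exact: wmeasurableD.
- exact: measurable_funeM.
- by move=> z _; apply: npowD.
Qed.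

Lemma measurable_npow2 d' (T : measurableType d') (h : T -> Z -> B) :
  wmeasurable (fun w : T * Z => h w.1 w.2) ->
  measurable_fun setT (fun w : T * Z => npow (h w.1 w.2)).
Proof. by move=> mh; apply: (measurable_npow _ nf). Qed.

Lemma measurable_Vp d' (T : measurableType d') (h : T -> I -> Z -> B) :
  (forall b, wmeasurable (fun w : T * Z => h w.1 b w.2)) ->
  measurable_fun setT (fun x => Vp (h x)).
Proof.
move=> mh; apply: emeasurable_sum => b.
apply: (measurable_integral2 (fun x z => npow (h x b z))).
  exact: (@measurable_npow2 _ _ (fun x => h x b)).
by move=> *; exact: npow_ge0.
Qed.

Lemma integral_Vp d' (T : measurableType d') (m : probability T R)
    (h : T -> I -> Z -> B) :
  (forall b, wmeasurable (fun w : T * Z => h w.1 b w.2)) ->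
  (\int[m]_x Vp (h x) = \sum_(b <- r) \int[m]_x \int[rho]_z npow (h x b z))%E.
Proof.
move=> mh; rewrite /Vp ge0_integral_sum//.
- move=> b; apply: (measurable_integral2 (fun x z => npow (h x b z))).
    exact: (@measurable_npow2 _ _ (fun x => h x b)).
  by move=> *; exact: npow_ge0.
- by move=> b x _; apply: integral_ge0 => z _; exact: npow_ge0.
Qed.

Lemma wmeasurable_partial n b :
  wmeasurable (fun w : X * Z => partial n w.1 b w.2).
Proof. by apply: wmeasurable_sum => l _; exact: mD. Qed.

Lemma wmeasurable_Du d' (T : measurableType d') l b (a : T -> X) c e :
  measurable_fun setT a -> measurable_fun setT c -> measurable_fun setT e ->
  wmeasurable (fun w : T => D l b (u l (a w) (c w)) (e w)).
Proof.
move=> ma mc me.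
apply: (wmeasurable_comp (g := fun w => (u l (a w) (c w), e w)) _ (mD l b)).
by apply: measurable_fun_pair => //; exact: measurable_fun_comp2.
Qed.

Lemma predicted_ge0 l x : (0 <= predicted l x)%E.
Proof. by apply: integral_ge0 => *; exact: Vp_ge0. Qed.

Lemma measurable_predicted l : measurable_fun setT (predicted l).
Proof.
apply: (measurable_integral2 (fun x s => Vp (fun b z => D l b (u l x s) z))).
  apply: (@measurable_Vp _ _ (fun w b z => D l b (u l w.1 w.2) z)) => b.
  by apply: wmeasurable_Du; measurable_proj.
by move=> *; exact: Vp_ge0.
Qed.

Lemma measurable_bracket n : measurable_fun setT (bracket n).
Proof. by apply: emeasurable_sum => l; exact: measurable_predicted. Qed.

Lemma measurable_set_gt (g : X -> \bar R) (a : \bar R) :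
  measurable_fun setT g -> measurable [set x | (a < g x)%E].
Proof.
move=> mg; rewrite -[X in measurable X]setTI.
exact: emeasurable_fun_o_infty.
Qed.

Lemma measurable_set_le (g : X -> \bar R) (a : \bar R) :
  measurable_fun setT g -> measurable [set x | (g x <= a)%E].
Proof.
move=> mg; rewrite -[X in measurable X]setTI.
exact: emeasurable_fun_infty_c.
Qed.

Lemma measurable_exceeds n a : measurable (exceeds n a).
Proof.
rewrite (_ : exceeds n a =
    \bigcup_(k in [set k | (k <= n)%N]) [set x | (a%:E < Vp (partial k x))%E]).
  apply: bigcup_measurable => k _; apply: measurable_set_gt.
  by apply: measurable_Vp => b; exact: wmeasurable_partial.
by apply/seteqP; split => x [k]; exists k.
Qed.

Section level.
Variables (a delta : R).
Hypotheses (a0 : 0 < a) (delta0 : 0 < delta) (delta1 : delta <= 1).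

(* Times at which the partial sums are between the two levels while the
   conditional variation is still small; predictable. *)
Definition active (l : nat) : set X :=
  exceeds l a `&` ~` exceeds l (64 * a) `&`
  [set x | (bracket l.+1 x <= (delta * a)%:E)%E].

Definition transform (n : nat) (x : X) (b : I) (z : Z) : B :=
  \sum_(l < n) \1_(active l) x *: D l b x z.

Lemma measurable_active l : measurable (active l).
Proof.
apply: measurableI.
  apply: measurableI; first exact: measurable_exceeds.
  exact/measurableC/measurable_exceeds.
exact/measurable_set_le/measurable_bracket.
Qed.

Lemma wmeasurable_transform n b :
  wmeasurable (fun w : X * Z => transform n w.1 b w.2).
Proof.
apply: wmeasurable_sum => l _; apply: wmeasurableZ => //.
apply: (@measurable_fun_comp _ _ _ _ _ _ (\1_(active l) : X -> R) fst).
  exact/measurable_indic/measurable_active.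
exact: measurable_fst.
Qed.

Lemma partial_u k l x s : (k <= l)%N -> (l < L)%N ->
  partial k (u l x s) = partial k x.
Proof.
move=> kl lL; apply/funext => b; apply/funext => z.
apply: eq_bigr => j _; rewrite adapted//.
exact: leq_trans (ltn_ord j) kl.
Qed.

Lemma exceeds_u k l x s c : (k <= l)%N -> (l < L)%N ->
  exceeds k c (u l x s) <-> exceeds k c x.
Proof.
move=> kl lL; split=> -[j jk h]; exists j; first exact: jk.
- by have <- := partial_u x s (leq_trans jk kl) lL; exact: h.
- exact: jk.
- by have -> := partial_u x s (leq_trans jk kl) lL; exact: h.
Qed.

Lemma predicted_u k l x s : (k <= l)%N -> (l < L)%N ->
  predicted k (u l x s) = predicted k x.
Proof.
move=> kl lL; apply: eq_integral => s' _; apply: eq_bigr => b _.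
apply: eq_integral => z _; move: kl; rewrite leq_eqVlt => /orP[/eqP ->|kl].
  by rewrite uK.
by rewrite uC// adapted.
Qed.

(** Predictability, which includes [k = l]: [exceeds l] only involves increments of times before
    [l], and the last term of [bracket l.+1] is [predicted l], where coordinate [l] is integrated
    out. *)
Lemma active_u k l x s : (k <= l)%N -> (l < L)%N ->
  active k (u l x s) <-> active k x.
Proof.
move=> kl lL.
have sE : bracket k.+1 (u l x s) = bracket k.+1 x.
  apply: eq_bigr => j _; apply: predicted_u => //.
  by rewrite (leq_trans _ kl)// -ltnS.
have h1 := exceeds_u x s a kl lL; have h2 := exceeds_u x s (64 * a) kl lL.
split=> -[[e1 e2] e3]; (split; first split).
- exact: (proj1 h1 e1).
- exact: (fun h => e2 (proj2 h2 h)).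
- by move: e3; rewrite /mkset sE.
- exact: (proj2 h1 e1).
- exact: (fun h => e2 (proj1 h2 h)).
- by rewrite /mkset sE.
Qed.

(** A one-sided orthogonality of martingale differences: adding the increment of time [n] costs at
    most [C] times its predicted size, by [two_point_resample] with [A] the predictable event
    [active n]. *)
Lemma integral_transform n : (n <= L)%N ->
  (\int[lam]_x Vp (transform n x) <=
   C%:E * \int[lam]_x \sum_(l < n) (\1_(active l) x)%:E * predicted l x)%E.
Proof.
have m1 l : measurable_fun setT (fun x => (\1_(active l) x)%:E : \bar R).
  exact/measurable_EFinP/measurable_indic/measurable_active.
have mA l : measurable_fun setT (fun x => (\1_(active l) x)%:E * predicted l x)%E.
  by apply: emeasurable_funM => //; exact: measurable_predicted.
have A0 l x : (0 <= (\1_(active l) x)%:E * predicted l x)%E.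
  by rewrite mule_ge0 ?predicted_ge0// lee_fin indicE.
elim: n => [|n IH] nL.
  rewrite (_ : (\int[lam]_x Vp _ = 0)%E).
    by under eq_integral do rewrite big_ord0; rewrite integral0 mule0.
  rewrite (_ : (fun x => _) = cst 0%E) ?integral0//; apply/funext => x.
  rewrite -[RHS]Vp0; congr Vp; apply/funext => b; apply/funext => z.
  by rewrite /transform big_ord0.
under [X in (_ <= _ * X)%E]eq_integral do rewrite big_ord_recr/=.
rewrite ge0_integralD//; last 2 first.
- by move=> x _; apply: sume_ge0 => l _.
- by apply: emeasurable_sum => l.
rewrite ge0_muleDr; last 2 first.
- by apply: integral_ge0 => x _; apply: sume_ge0 => l _.
- by apply: integral_ge0 => x _.
apply: (le_trans _ (leeD2r _ (IH (ltnW nL)))).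
rewrite !integral_Vp; last 2 first.
- by move=> b; exact: wmeasurable_transform.
- by move=> b; exact: wmeasurable_transform.
rewrite [X in (_ <= _ + _ * X)%E](_ : _ = \sum_(b <- r) \int[lam]_x
    ((\1_(active n) x)%:E * \int[mu]_s \int[rho]_z npow (D n b (u n x s) z)))%E;
    last first.
  rewrite -ge0_integral_sum//.
  - apply: eq_integral => x _; rewrite -ge0_sume_distrr; last first.
      move=> b _; apply: integral_ge0 => s _; apply: integral_ge0 => z _.
      exact: npow_ge0.
    congr (_ * _)%E; apply: integral_Vp => b.
    by apply: wmeasurable_Du; measurable_proj.
  - move=> b; apply: emeasurable_funM => //.
    apply: (measurable_integral2
      (fun x s => \int[rho]_z npow (D n b (u n x s) z))%E).
      apply: (measurable_integral2 (fun w z => npow (D n b (u n w.1 w.2) z))).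
        apply: (measurable_npow _ nf).
        by apply: wmeasurable_Du; measurable_proj.
      by move=> *; exact: npow_ge0.
    by move=> *; apply: integral_ge0 => z _; exact: npow_ge0.
  - move=> b x _; rewrite mule_ge0//.
    by apply: integral_ge0 => s _; apply: integral_ge0 => z _; exact: npow_ge0.
rewrite ge0_sume_distrr; last first.
  move=> b _; apply: integral_ge0 => x _; rewrite mule_ge0//.
  by apply: integral_ge0 => s _; apply: integral_ge0 => z _; exact: npow_ge0.
rewrite -big_split/=; apply: lee_sum => b _.
under eq_integral do under eq_integral do rewrite /transform big_ord_recr/=.
apply: (two_point_resample eN nf p1 C2 (mu_ n) (fun g => @resample n g nL)
  (y := fun x z => transform n x b z) (dd := D n b)).
- exact: measurable_active.
- exact: wmeasurable_transform.
- exact: mD.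
- move=> x s z; apply: eq_bigr => l _.
  rewrite (adapted b x s z (ltn_ord l) nL).
  have h := active_u x s (ltnW (ltn_ord l)) nL.
  have -> : \1_(active l) (u n x s) = \1_(active l) x :> R.
    have [xa|nxa] := pselect (active l x).
      by rewrite !indicE (mem_set (proj2 h xa)) (mem_set xa).
    by rewrite !indicE (memNset nxa) (memNset (fun e => nxa (proj1 h e))).
  exact: erefl.
- by move=> x s; apply: active_u; first exact: leqnn.
- exact: centered.
Qed.

Lemma exceedsS k l c : (k <= l)%N -> exceeds k c `<=` exceeds l c.
Proof.
by move=> kl x [j jk h]; exists j; [exact: leq_trans jk kl|exact: h].
Qed.

(** Look at the last active time: the sum up to it is at most the bracket including that time, which
    activity bounds by [delta * a]. *)
Lemma active_sum_le n x : (n <= L)%N ->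
  (\sum_(l < n) (\1_(active l) x)%:E * predicted l x <=
   (delta * a)%:E * (\1_(exceeds L a) x)%:E)%E.
Proof.
move=> nL; rewrite indicE; case: (boolP (x \in exceeds L a)) => /= xa; last first.
  rewrite mule0 big1// => l _; rewrite indicE.
  case: (boolP (x \in active l)) => xl; last by rewrite mul0e.
  move: xa => /negP[]; move: xl; rewrite !inE => -[[xl _] _].
  apply: exceedsS xl; exact: ltnW (leq_trans (ltn_ord l) nL).
rewrite mule1; elim: n nL => [|n IH] nL.
  by rewrite big_ord0 lee_fin mulr_ge0// ltW.
rewrite big_ord_recr/= indicE; case: (boolP (x \in active n)) => xn; last first.
  by rewrite mul0e adde0; exact: IH (ltnW nL).
rewrite mul1e; move: xn; rewrite inE => -[_]; rewrite /mkset; apply: le_trans.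
rewrite /bracket big_ord_recr/= leeD2r//; apply: lee_sum => l _.
rewrite indicE; case: (x \in _); first by rewrite mul1e.
by rewrite mul0e predicted_ge0.
Qed.

Lemma wmeasurable_section (h : I -> X -> Z -> B) x :
  (forall b, wmeasurable (fun w : X * Z => h b w.1 w.2)) ->
  forall b, wmeasurable (h b x).
Proof.
move=> mh b.
by apply: (wmeasurable_comp (g := fun z : Z => (x, z)) _ (mh b)); measurable_proj.
Qed.

(* At the last time the level [64 a] is first exceeded, the transform is the
   increment of the partial sums since the level [a] was first exceeded. *)
Lemma exceeds_transform x :
  (forall l, (l < L)%N -> (Vp (fun b z => D l b x z) <= (delta * a)%:E)%E) ->
  (bracket L x <= (delta * a)%:E)%E ->
  exceeds L (64 * a) x -> ((8 * a)%:E < Vp (transform L x))%E.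
Proof.
move=> smallD smallB.
have da : delta * a <= a by rewrite ler_piMl// ltW.
have mDx l := wmeasurable_section x (mD l).
have mU n b : wmeasurable (partial n x b).
  by apply: wmeasurable_sum => l _; exact: mDx.
have mY n b : wmeasurable (transform n x b).
  by apply: wmeasurable_sum => l _; apply: wmeasurableZ => //; exact: mDx.
have mW n b : wmeasurable (fun z => partial n x b z - transform n x b z).
  by apply: wmeasurableD => //; exact: wmeasurableN.
have smallBn n : (n <= L)%N -> (bracket n x <= (delta * a)%:E)%E.
  move=> nL; apply: le_trans smallB; rewrite /bracket.
  rewrite -!(big_mkord xpredT (fun l => predicted l x)).
  rewrite (big_cat_nat (leq0n n) nL)/= leeDl// sume_ge0// => l _.
  exact: predicted_ge0.
have excS n c : exceeds n.+1 c x -> ~ exceeds n c x ->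
    (c%:E < Vp (partial n.+1 x))%E.
  move=> [k]; rewrite leq_eqVlt => /orP[/eqP ->//|kn h] nexc.
  by exfalso; apply: nexc; exists k.
have nexc n c : ~ exceeds n c x -> (Vp (partial n x) <= c%:E)%E.
  by move=> nexc; rewrite leNgt; apply/negP => h; apply: nexc; exists n.
(* Three phases, sizes being measured by [Vp]. When [a] is first exceeded, the partial sum is at
   most [4 (a + delta a) <= 8 a]. This part stays constant while the transform collects the
   increments. When [64 a] is first exceeded, [64 a < 4 (Vp(transform) + 8 a)] leaves more than
   [8 a], and afterwards the transform no longer changes. *)
have inv n : (n <= L)%N ->
  [\/ ~ exceeds n a x /\ transform n x = (fun _ _ => 0),
     [/\ exceeds n a x, ~ exceeds n (64 * a) x &
        (Vp (fun b z => partial n x b z - transform n x b z)%R <= (8 * a)%:E)%E] |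
     exceeds n (64 * a) x /\ ((8 * a)%:E < Vp (transform n x))%E].
  elim: n => [_|n IH nL].
    apply: Or31; split.
      move=> [k]; rewrite leqn0 => /eqP ->.
      rewrite (_ : partial 0 x = fun _ _ => 0); last first.
        by apply/funext => b; apply/funext => z; rewrite /partial big_ord0.
      by rewrite Vp0 lte_fin ltNge ltW.
    by apply/funext => b; apply/funext => z; rewrite /transform big_ord0.
  have YS : transform n.+1 x = (fun b z => transform n x b z +
      \1_(active n) x *: D n b x z).
    by apply/funext => b; apply/funext => z; rewrite /transform big_ord_recr.
  have US : partial n.+1 x = (fun b z => partial n x b z + D n b x z).
    by apply/funext => b; apply/funext => z; rewrite /partial big_ord_recr.
  have inact : ~ active n x -> transform n.+1 x = transform n x.
    move=> nx; rewrite YS indicE (negbTE (_ : x \notin active n)); last first.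
      by apply/negP; rewrite inE.
    by apply/funext => b; apply/funext => z; rewrite scale0r addr0.
  have [[na Y0]|[ea nea W8]|[e64 Y8]] := IH (ltnW nL).
  - have Y0' : transform n.+1 x = (fun _ _ => 0).
      by rewrite inact// => -[[]].
    have V8 : (Vp (partial n.+1 x) <= (8 * a)%:E)%E.
      rewrite US; apply: (le_trans (VpD (mU n) (mDx n))).
      rewrite (_ : (8 * a)%:E = 4%:E * (a%:E + a%:E))%E; last first.
        by rewrite -EFinD -EFinM; congr EFin; ring.
      rewrite lee_pmul2l ?lte_fin// leeD ?nexc//.
      by rewrite (le_trans (smallD _ nL))// lee_fin.
    have [e|ne] := pselect (exceeds n.+1 a x); last by apply: Or31.
    apply: Or32; split; [exact: e| |]; last first.
      rewrite Y0' (_ : (fun b z => _) = partial n.+1 x); first exact: V8.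
      by apply/funext => b; apply/funext => z; rewrite subr0.
    move=> [k]; rewrite leq_eqVlt => /orP[/eqP ->|kn h].
      move=> h; have := lt_le_trans h V8; rewrite lte_fin.
      by rewrite ltr_pM2r//; apply/negP; rewrite -leNgt ler_nat.
    apply: na; exists k => //; apply: le_lt_trans h.
    by rewrite lee_fin ler_peMl ?ltW// ltr1n.
  - have act : active n x.
      by do !split => //; exact: smallBn.
    have WE : (fun b z => partial n.+1 x b z - transform n.+1 x b z) =
        (fun b z => partial n x b z - transform n x b z).
      apply/funext => b; apply/funext => z.
      rewrite US YS indicE (_ : x \in active n); last by rewrite inE.
      by rewrite scale1r opprD addrACA subrr addr0.
    have [e|ne] := pselect (exceeds n.+1 (64 * a) x); last first.
      apply: Or32; split; [exact: exceedsS ea|exact: ne|].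
      by rewrite WE.
    apply: Or33; split => //.
    have := excS _ _ e nea.
    have -> : partial n.+1 x = (fun b z => transform n.+1 x b z +
        (partial n.+1 x b z - transform n.+1 x b z)).
      by apply/funext => b; apply/funext => z; rewrite addrC subrK.
    move=> /lt_le_trans /(_ (VpD (mY _) (mW _))); rewrite WE => h.
    have h2 : ((64 * a)%:E < 4%:E * (Vp (transform n.+1 x) + (8 * a)%:E))%E.
      by apply: (lt_le_trans h); rewrite lee_pmul2l ?lte_fin// leeD2l.
    move: h2; case: (Vp (transform n.+1 x)) (Vp_ge0 (transform n.+1 x)) => //=.
      move=> v _; rewrite -EFinD -EFinM !lte_fin.
      have a0' : 0 < a := a0.
      lra.
    by move=> _ _; exact: ltry.
  - apply: Or33; split; first exact: exceedsS e64.
    by rewrite inact// => -[[_ h] _].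
move=> e64.
have [[na _]|[_ ne _]|[_ //]] := inv L (leqnn L).
- exfalso; apply: na; case: e64 => k kL h; exists k => //; apply: le_lt_trans h.
  by rewrite lee_fin ler_peMl ?ltW// ltr1n.
- by exfalso.
Qed.

(** Off the two exceptional events, exceeding [64 a] forces the transform above [8 a]; its mean is
    at most [C delta a] times the measure of exceeding [a], and Markov's inequality gives the factor
    [C delta / 8]. *)
Lemma good_lambda :
  (lam (exceeds L (64 * a)) <= (C * delta / 8)%:E * lam (exceeds L a) +
    \sum_(l < L) lam [set x | (delta * a)%:E < Vp (fun b z => D l b x z)] +
    lam [set x | (delta * a)%:E < bracket L x])%E.
Proof.
pose E1 := [set x | ((8 * a)%:E < Vp (transform L x))%E].
pose E2 (l : nat) := [set x | ((delta * a)%:E < Vp (fun b z => D l b x z))%E].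
pose E3 := [set x | ((delta * a)%:E < bracket L x)%E].
have mVY : measurable_fun setT (fun x => Vp (transform L x)).
  by apply: measurable_Vp => b; exact: wmeasurable_transform.
have mE1 : measurable E1 by exact: measurable_set_gt.
have mE2 l : measurable (E2 l).
  apply: measurable_set_gt.
  by apply: (@measurable_Vp _ _ (fun x b z => D l b x z)) => b; exact: mD.
have mE3 : measurable E3 by apply: measurable_set_gt; exact: measurable_bracket.
have mE2' : measurable (\big[setU/set0]_(l < L) E2 l).
  by apply: bigsetU_measurable => l _; exact: mE2.
have sub : exceeds L (64 * a) `<=` E1 `|` \big[setU/set0]_(l < L) E2 l `|` E3.
  move=> x e; have [x3|n3] := pselect (E3 x); first by right.
  left; have [x2|n2] := pselect ((\big[setU/set0]_(l < L) E2 l) x); first by right.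
  left; apply: exceeds_transform => //.
    move=> l lL; rewrite leNgt; apply/negP => h; apply: n2.
    by rewrite -bigcup_mkord; exists l.
  by rewrite leNgt; apply/negP.
have mexc := measurable_exceeds L (64 * a).
have mea1 := measure_le_setU3 lam mexc mE1 mE2' mE3 sub.
apply: (le_trans mea1); rewrite leeD2r// leeD//; last first.
  by apply: Boole_inequality => l _; exact: mE2.
rewrite -(@lee_pmul2l _ (8 * a)%:E) ?lte_fin ?mulr_gt0//.
have m1 : measurable_fun setT (fun x => (\1_E1 x)%:E : \bar R).
  exact/measurable_EFinP/measurable_indic.
apply: (@le_trans _ _ (\int[lam]_x Vp (transform L x))%E).
  rewrite -[X in (_ * lam X)%E]setIT -integral_indic//.
  rewrite -(ge0_integralZl lam measurableT m1); last 2 first.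
  - by move=> x _; rewrite lee_fin indicE.
  - by rewrite lee_fin mulr_ge0// ltW.
  apply: (ge0_le_integral _ measurableT).
  - by move=> x _; rewrite mule_ge0// lee_fin ?indicE// mulr_ge0// ltW.
  - exact: measurable_funeM.
  - exact: mVY.
  - move=> x _; rewrite indicE; case: (boolP (x \in E1)) => /=.
      by rewrite inE mule1 => /ltW.
    by rewrite mule0 => _; exact: Vp_ge0.
apply: (le_trans (integral_transform (leqnn L))).
have m2 : measurable_fun setT (fun x => (\1_(exceeds L a) x)%:E : \bar R).
  exact/measurable_EFinP/measurable_indic/measurable_exceeds.
apply: (@le_trans _ _ (C%:E * \int[lam]_x
    ((delta * a)%:E * (\1_(exceeds L a) x)%:E))%E).
  rewrite lee_pmul2l ?lte_fin//; apply: (ge0_le_integral _ measurableT).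
  - move=> x _; apply: sume_ge0 => l _.
    by rewrite mule_ge0 ?predicted_ge0// lee_fin indicE.
  - apply: emeasurable_sum => l; apply: emeasurable_funM.
      exact/measurable_EFinP/measurable_indic/measurable_active.
    exact: measurable_predicted.
  - exact: measurable_funeM.
  - by move=> x _; exact: active_sum_le.
rewrite (ge0_integralZl lam measurableT m2); last 2 first.
- by move=> x _; rewrite lee_fin indicE.
- by rewrite lee_fin mulr_ge0// ltW.
rewrite integral_indic//; last exact: measurable_exceeds.
rewrite setIT !muleA -!EFinM le_eqVlt; apply/orP; left; apply/eqP.
by congr (_%:E * _)%E; field.
Qed.

End level.
End good_lambda.

(** * Peeling off one index at a time *)

Section agree.
Context (J I : finType).
Implicit Types (A : {set J}) (a b c : {ffun J -> I}) (j : J) (l : I).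

(** Summing over such [b] lets the coordinates in [A] vary and fixes the others at [a]. *)
Definition agree A a b := [forall j, (j \notin A) ==> (a j == b j)].

Definition reset b j l : {ffun J -> I} := [ffun i => if i == j then l else b i].

Lemma agreeP A a b :
  reflect (forall j, j \notin A -> a j = b j) (agree A a b).
Proof.
apply: (iffP forallP) => [h j jA|h j]; last by apply/implyP => /h ->.
by apply/eqP; exact: (implyP (h j)).
Qed.

Lemma resetE b j l i : reset b j l i = if i == j then l else b i.
Proof. by rewrite ffunE. Qed.

Lemma agree_reset A a b j l : j \notin A ->
  agree (j |: A) a b && (b j == l) = agree A (reset a j l) b.
Proof.
move=> jA; apply/andP/agreeP => [[/agreeP h /eqP bj] i iA|h].
  rewrite resetE; case: eqP => [->//|/eqP ij].
  by rewrite h// in_setU1 negb_or ij.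
split; last by rewrite -h// resetE eqxx.
apply/agreeP => i; rewrite in_setU1 negb_or => /andP[ij iA].
by rewrite -h// resetE (negbTE ij).
Qed.

Lemma agree_reset2 A a b j l : j \notin A -> a j = b j ->
  agree A (reset a j l) (reset b j l) = agree A a b.
Proof.
move=> jA abj; apply/agreeP/agreeP => h i iA; last first.
  by rewrite !resetE; case: eqP => // _; exact: h.
by have := h i iA; rewrite !resetE; case: eqP => // ->.
Qed.

Context (R : Type) (idx : R) (op : Monoid.com_law idx).

Lemma big_agree_reset A a j l (F : {ffun J -> I} -> R) : j \notin A ->
  \big[op/idx]_(b | agree A a b) F (reset b j l) =
  \big[op/idx]_(b | agree A (reset a j l) b) F b.
Proof.
move=> jA; rewrite [RHS](reindex_onto (fun b => reset b j l)
    (fun b => reset b j (a j))) /=; last first.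
  move=> b /agreeP h; apply/ffunP => i; rewrite !resetE; case: eqP => // ->.
  by rewrite -h// resetE eqxx.
apply: eq_bigl => b; apply/idP/andP => [ab|[ab /eqP bE]].
  have abj : a j = b j by exact: (agreeP _ _ _ ab).
  rewrite agree_reset2//; split => //.
  by apply/eqP/ffunP => i; rewrite !resetE; case: eqP => // ->.
by rewrite -(agree_reset2 l jA)// -bE resetE eqxx.
Qed.

Lemma big_agree_split A a j (F : {ffun J -> I} -> R) : j \notin A ->
  \big[op/idx]_(b | agree (j |: A) a b) F b =
  \big[op/idx]_l \big[op/idx]_(b | agree A (reset a j l) b) F b.
Proof.
move=> jA; rewrite (partition_big (fun b => b j) xpredT)//=.
apply: eq_bigr => l _; apply: eq_bigl => b; exact: agree_reset.
Qed.

End agree.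

(** * Tuples mixing sampled and averaged coordinates *)

Definition updn (S : Type) n (x : n.-tuple S) (l : nat) (s : S) : n.-tuple S :=
  [tuple if k == l :> nat then s else tnth x k | k < n].

Lemma tnth_updn (S : Type) n (x : n.-tuple S) (l : nat) (k : 'I_n) (s : S) :
  tnth (updn x l s) k = if k == l :> nat then s else tnth x k.
Proof. by rewrite tnth_mktuple. Qed.

Lemma updn_upd (S : Type) n (x : n.-tuple S) (j : 'I_n) (s : S) :
  updn x j s = upd x j s.
Proof. by apply: eq_from_tnth => k; rewrite !tnth_mktuple. Qed.

Lemma measurable_updn d (S : measurableType d) n (l : nat) :
  measurable_fun setT (fun z : n.-tuple S * S => updn z.1 l z.2).
Proof.
apply/measurable_fun_tnthP => k.
rewrite (_ : _ \o _ = fun z : n.-tuple S * S =>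
    if k == l :> nat then z.2 else tnth z.1 k); last first.
  by apply/funext => z /=; rewrite tnth_updn.
case: (k == l :> nat); first exact: measurable_snd.
apply: (measurable_fun_comp (g := fun x : n.-tuple S => tnth x k)) => //.
exact: measurable_tnth.
Qed.

Definition mix (S : Type) K m (t : 'I_m -> option 'I_K) (x : K.-tuple S)
    (z : m.-tuple S) : m.-tuple S :=
  [tuple if t j is Some i then tnth x i else tnth z j | j < m].

Lemma tnth_mix (S : Type) K m (t : 'I_m -> option 'I_K) (x : K.-tuple S)
    (z : m.-tuple S) j :
  tnth (mix t x z) j = if t j is Some i then tnth x i else tnth z j.
Proof. by rewrite tnth_mktuple. Qed.

Lemma mix_upd (S : Type) K m (t : 'I_m -> option 'I_K) (x : K.-tuple S)
    (z : m.-tuple S) j i s : t j = Some i ->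
  (forall j' i', t j' = Some i' -> j' <> j -> i' <> i) ->
  mix t (upd x i s) z = mix (fun j' => if j' == j then None else t j') x (upd z j s).
Proof.
move=> tj tinj; apply: eq_from_tnth => j'; rewrite !tnth_mix.
case: eqP => [->|/eqP j'j]; first by rewrite tj !tnth_upd !eqxx.
case tj' : (t j') => [i'|]; rewrite tnth_upd ?(negbTE j'j)//.
by case: eqP => // /(tinj _ _ tj') h; exfalso; apply: h; exact/eqP.
Qed.

Section mix.
Context d (S : measurableType d) (K m : nat).
Implicit Types (t : 'I_m -> option 'I_K).

Lemma measurable_mix t :
  measurable_fun setT (fun w : K.-tuple S * m.-tuple S => mix t w.1 w.2).
Proof.
apply/measurable_fun_tnthP => k.
rewrite (_ : _ \o _ = fun w : K.-tuple S * m.-tuple S =>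
    if t k is Some i then tnth w.1 i else tnth w.2 k); last first.
  by apply/funext => z /=; rewrite tnth_mix.
case: (t k) => [i|].
  apply: (measurable_fun_comp (g := fun x : K.-tuple S => tnth x i)) => //.
  exact: measurable_tnth.
apply: (measurable_fun_comp (g := fun x : m.-tuple S => tnth x k)) => //.
exact: measurable_tnth.
Qed.

Context (R : realType) (mu : probability S R) (lam : probability (K.-tuple S) R)
  (rho : probability (m.-tuple S) R).
Hypotheses (lamP : is_power mu lam) (rhoP : is_power mu rho).

(** Induction on the number of sampled positions: resampling one of them in [x], or its position in
    [z], produces the same integrand, so it can be moved to [z]. Injectivity of [t] where defined
    ensures that no other position reads the same coordinate. *)
Lemma integral_mix t (f : m.-tuple S -> \bar R) :
  (forall j j' i, t j = Some i -> t j' = Some i -> j = j') ->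
  measurable_fun setT f -> (forall x, 0 <= f x)%E ->
  (\int[lam]_x \int[rho]_z f (mix t x z) = \int[rho]_z f z)%E.
Proof.
move=> tinj mf f0.
have [k tk] := ubnP #|[pred j | t j != None]|.
elim: k t tinj tk => // k IH t tinj tk.
have mfm t' : measurable_fun setT
    (fun w : K.-tuple S * m.-tuple S => f (mix t' w.1 w.2)).
  exact: (measurable_fun_comp mf (@measurable_mix t')).
have [t0|] := pickP (fun j => t j != None); last first.
  move=> t0; rewrite (_ : (fun x => _) = cst (\int[rho]_z f z)%E).
    exact: probability_integral_cst.
  apply/funext => x; apply: eq_integral => z _; congr f.
  apply: eq_from_tnth => j; rewrite tnth_mix.
  by have /negbFE/eqP -> := t0 j.
case tj : (t t0) => [i|//] _.
pose t' j' := if j' == t0 then None else t j'.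
rewrite -(IH t'); last 2 first.
- move=> j j' i'; rewrite /t'; case: eqP => // _; case: eqP => // _.
  exact: tinj.
- rewrite -ltnS; apply: leq_trans tk.
  rewrite ltnS; apply: proper_card; apply/properP; split.
    by apply/fintype.subsetP => j; rewrite !inE /t'; case: (j == t0).
  by exists t0; rewrite !inE /t' ?tj// eqxx.
rewrite (lamP i); last 2 first.
- exact: (measurable_integral2 (fun x z => f (mix t x z))).
- by move=> x; exact: integral_ge0.
apply: eq_integral => x _.
transitivity (\int[mu]_s \int[rho]_z f (mix t' x (upd z t0 s)))%E.
  apply: eq_integral => s _; apply: eq_integral => z _; congr f.
  apply: mix_upd => // j' i' tj' j'j i'i; apply: j'j; apply: (tinj _ _ i') => //.
  by rewrite tj i'i.
rewrite (rhoP t0 (f := fun z => f (mix t' x z))); last 2 first.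
- apply: (measurable_fun_comp2 (g := fun x z => f (mix t' x z))) => //.
- by [].
apply: (integral_swap (fun s z => f (mix t' x (upd z t0 s)))) => //.
apply: (measurable_fun_comp2 (g := fun x z => f (mix t' x z))) => //.
apply: (measurable_fun_comp2 (g := fun x s => upd x t0 s)); measurable_proj.
exact: measurable_upd.
Qed.

End mix.

Lemma ae_mix d (S : measurableType d) (R : realType) (K m : nat)
    (mu : probability S R) (lam : probability (K.-tuple S) R)
    (rho : probability (m.-tuple S) R) (t : 'I_m -> option 'I_K)
    (Q : m.-tuple S -> Prop) :
  is_power mu lam -> is_power mu rho ->
  (forall j j' i, t j = Some i -> t j' = Some i -> j = j') ->
  {ae rho, forall x, Q x} ->
  {ae (lam \x rho)%E, forall w, Q (mix t w.1 w.2)}.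
Proof.
move=> lamP rhoP tinj [E [mE E0 QE]].
have mEm : measurable ((fun w : K.-tuple S * m.-tuple S => mix t w.1 w.2) @^-1` E).
  by rewrite -[X in measurable X]setTI; apply: measurable_mix.
exists ((fun w => mix t w.1 w.2) @^-1` E); split => //.
  have m1 : measurable_fun setT (fun x : m.-tuple S => (\1_E x)%:E : \bar R).
    exact/measurable_EFinP/measurable_indic.
  have m10 (x : m.-tuple S) : (0 <= (\1_E x)%:E :> \bar R)%E.
    by rewrite lee_fin indicE.
  have := integral_mix lamP rhoP tinj m1 m10.
  rewrite integral_indic// setIT => hE.
  transitivity (\int[lam]_x \int[rho]_z (\1_E (mix t x z))%:E)%E; last first.
    by rewrite hE; exact: E0.
  rewrite -(integral_pairE (fun x z => (\1_E (mix t x z))%:E)).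
  - apply: esym; apply: etrans (integral_indic _ measurableT mEm) _.
    by rewrite setIT.
  - exact: (measurable_fun_comp m1 (@measurable_mix _ S K m t)).
  - by move=> *.
by move=> w /= nQ; apply: QE.
Qed.

Section step.
Context (R : realType) (B : normedModType R) (N : B -> R) (p C : R).
Context (f : nat -> B -> R).
Hypotheses (eN : equivalent_norm N) (nf : norming N f) (p1 : 1 < p)
  (p2 : p <= 2) (C2 : two_point N p C).
Context d (S : measurableType d) (mu : probability S R) (m n : nat).
Context (lam : probability ((m + n).-tuple S) R)
  (rho : probability (m.-tuple S) R).
Hypotheses (lamP : is_power mu lam) (rhoP : is_power mu rho).
Variable h : {ffun 'I_m -> 'I_n} -> m.-tuple S -> B.
Hypothesis mh : forall c, wmeasurable (h c).
Hypothesis h_inc : forall (c : {ffun 'I_m -> 'I_n}) (j j' : 'I_m) x, (j < j')%N -> ~~ (c j < c j')%N ->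
  h c x = 0.
Hypothesis h_centered : forall c j,
  {ae rho, forall x, mean_zero mu f (fun s => h c (upd x j s))}.

Local Notation npow := (npow N p).
Implicit Types (a b c : {ffun 'I_m -> 'I_n}) (J : {set 'I_m}).
Implicit Types (x : (m + n).-tuple S) (z : m.-tuple S) (s : S).

Definition low (k : nat) : {set 'I_m} := [set j : 'I_m | (j < k)%N]%SET.

Definition averaged (k : nat) J : {set 'I_m} :=
  [set j : 'I_m | (k <= j)%N && (j \notin J)]%SET.

(* Coordinates below [k] are summed inside the norm and carry the variable of
   their index; coordinates of [J] are frozen, the others are averaged. *)
Definition source (k : nat) J c (j : 'I_m) : option 'I_(m + n) :=
  if (j < k)%N then Some (rshift m (c j))
  else if j \in J then Some (lshift n j) else None.

Definition inner (k : nat) J b (x : (m + n).-tuple S) (z : m.-tuple S) : B :=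
  \sum_(c | agree (low k) b c) h c (mix (source k J c) x z).

(** At [k = m] the whole sum is inside the norm, at [k = 0] each term stands alone. When [J]
    contains no position below [k], only the values of [a] on [J] count: [b] overrides the averaged
    ones and [c] those below [k]. *)
Definition W (k : nat) J a (x : (m + n).-tuple S) : \bar R :=
  (\sum_(b | agree (averaged k J) a b) \int[rho]_z npow (inner k J b x z))%E.

Lemma wmeasurable_term (t : 'I_m -> option 'I_(m + n)) c :
  wmeasurable (fun w : (m + n).-tuple S * m.-tuple S => h c (mix t w.1 w.2)).
Proof. exact: (wmeasurable_comp (@measurable_mix _ S _ m t) (mh c)). Qed.

Lemma wmeasurable_inner k J b : wmeasurable
  (fun w : (m + n).-tuple S * m.-tuple S => inner k J b w.1 w.2).
Proof. by apply: wmeasurable_sum => c _; exact: wmeasurable_term. Qed.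

Lemma measurable_W k J a : measurable_fun setT (W k J a).
Proof.
rewrite /W; under eq_fun do rewrite -big_filter.
apply: emeasurable_sum => b.
apply: (measurable_integral2 (fun x z => npow (inner k J b x z))).
  exact: (measurable_npow _ nf (wmeasurable_inner k J b)).
by move=> *; exact: npow_ge0.
Qed.

Section one_coordinate.
Variables (j0 : 'I_m) (J : {set 'I_m}) (a : {ffun 'I_m -> 'I_n}).
Hypothesis J_high : forall j, j \in J -> (j0 < j)%N.

(** The martingale difference of time [l]: for increasing [c], the positions below [j0] have indices
    smaller than [c j0 = l]. *)
Definition layer (l : nat) b (x : (m + n).-tuple S) (z : m.-tuple S) : B :=
  \sum_(c | agree (low j0.+1) b c && (c j0 == l :> nat))
    h c (mix (source j0.+1 J c) x z).

Let r := [seq b <- index_enum {ffun 'I_m -> 'I_n} | agree (averaged j0.+1 J) a b].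

Let J0 : j0 \notin J.
Proof. by apply/negP => /J_high; rewrite ltnn. Qed.

Lemma low_succ : low j0.+1 = (j0 |: low j0)%SET.
Proof. by apply/setP => j; rewrite !inE ltnS leq_eqVlt. Qed.

Lemma averaged_pred : averaged j0 J = (j0 |: averaged j0.+1 J)%SET.
Proof.
apply/setP => j; rewrite !inE (leq_eqVlt j0) [j0 == j :> nat]eq_sym.
have [/val_inj ->|jj0] /= := eqVneq (j : nat) j0; first by rewrite eqxx J0.
by case: eqP => [jE|]//; rewrite jE eqxx in jj0.
Qed.

Lemma averaged_predU : averaged j0 (j0 |: J)%SET = averaged j0.+1 J.
Proof.
apply/setP => j; rewrite !inE negb_or (leq_eqVlt j0) [j0 == j :> nat]eq_sym.
have [/val_inj ->|jj0] /= := eqVneq (j : nat) j0; first by rewrite eqxx ltnn.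
by case: eqP => [jE|]//; rewrite jE eqxx in jj0.
Qed.

Lemma j0_low : j0 \notin low j0. Proof. by rewrite inE ltnn. Qed.

Lemma j0_averaged : j0 \notin averaged j0.+1 J. Proof. by rewrite inE ltnn. Qed.

(** Position [j0] alone reads the variable of index [l]: smaller positions have smaller indices, and
    frozen ones read the first [m] coordinates. Replacing this variable is the same as writing [s]
    in the averaged copy. *)
Lemma mix_averaged c x z s (l : 'I_n) : c j0 = l ->
  (forall j : 'I_m, (j < j0)%N -> (c j < l)%N) ->
  mix (source j0.+1 J c) (updn x (m + l) s) z =
  mix (source j0 J c) x (upd z j0 s).
Proof.
move=> cl cj; apply: eq_from_tnth => j; rewrite !tnth_mix /source ltnS.
have [jj0|jj0|jj0] := ltngtP (j : nat) j0.
- by rewrite tnth_updn /= eqn_add2l ltn_eqF// cj.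
- case: ifP => jJ; last by rewrite tnth_upd -val_eqE /= gtn_eqF.
  by rewrite tnth_updn /= ltn_eqF// ltn_addr.
- have -> : j = j0 by exact: val_inj.
  by rewrite (negbTE J0) tnth_updn tnth_upd /= cl !eqxx.
Qed.

(** The same variable can be stored in slot [j0] of the first [m] coordinates, still free since [j0]
    is not in [J]. *)
Lemma mix_frozen c x z s (l : 'I_n) : c j0 = l ->
  (forall j : 'I_m, (j < j0)%N -> (c j < l)%N) ->
  mix (source j0.+1 J c) (updn x (m + l) s) z =
  mix (source j0 (j0 |: J)%SET c) (updn x j0 s) z.
Proof.
move=> cl cj; apply: eq_from_tnth => j; rewrite !tnth_mix /source ltnS.
have [jj0|jj0|jj0] := ltngtP (j : nat) j0.
- rewrite !tnth_updn /= eqn_add2l ltn_eqF ?cj// gtn_eqF//.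
  by rewrite (leq_trans (ltn_ord j0))// leq_addr.
- rewrite in_setU1 -val_eqE /= [(j : nat) == j0]gtn_eqF//=; case: ifP => jJ //.
  by rewrite !tnth_updn /= ltn_eqF ?ltn_addr// gtn_eqF.
- have -> : j = j0 by exact: val_inj.
  by rewrite in_setU1 eqxx /= !tnth_updn /= cl !eqxx.
Qed.

Lemma layer_resample (G : {ffun 'I_m -> 'I_n} -> B) (l : 'I_n) b x z s :
  (forall c, c j0 = l -> (forall j : 'I_m, (j < j0)%N -> (c j < l)%N) ->
    h c (mix (source j0.+1 J c) (updn x (m + l) s) z) = G c) ->
  (forall c (j : 'I_m), (j < j0)%N -> ~~ (c j < c j0)%N -> G c = 0) ->
  layer l b (updn x (m + l) s) z =
  \sum_(c | agree (low j0) (reset b j0 l) c) G c.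
Proof.
move=> hG G0; rewrite /layer low_succ; apply: eq_big => [c|c /andP[_ /eqP cl]].
  by rewrite -agree_reset ?j0_low.
have {}cl : c j0 = l by exact: val_inj.
have [inc|] := pselect (forall j : 'I_m, (j < j0)%N -> (c j < l)%N).
  exact: hG.
move=> /existsNP[j /not_implyP[jj0 /negP cjl]].
have ncj : ~~ (c j < c j0)%N by rewrite cl.
by rewrite (h_inc _ jj0 ncj) (G0 _ _ jj0 ncj).
Qed.

Lemma layer_averaged (l : 'I_n) b x z s :
  layer l b (updn x (m + l) s) z =
  inner j0 J (reset b j0 l) x (upd z j0 s).
Proof.
apply: layer_resample => [c cl cj|c j jj0 ncj]; first by rewrite (mix_averaged _ _ _ cl cj).
exact: h_inc jj0 ncj.
Qed.

Lemma layer_frozen (l : 'I_n) b x z s :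
  layer l b (updn x (m + l) s) z =
  inner j0 (j0 |: J)%SET (reset b j0 l) (updn x j0 s) z.
Proof.
apply: layer_resample => [c cl cj|c j jj0 ncj]; first by rewrite (mix_frozen _ _ _ cl cj).
exact: h_inc jj0 ncj.
Qed.

Lemma layer_sum b x z : \sum_(l < n) layer l b x z = inner j0.+1 J b x z.
Proof. by rewrite /inner (partition_big (fun c => c j0) xpredT). Qed.

Lemma layer_adapted l l' b x s z : (l < l')%N -> (l' < n)%N ->
  layer l b (updn x (m + l') s) z = layer l b x z.
Proof.
move=> ll' l'n; apply: eq_bigr => c /andP[_ /eqP cl].
have [inc|] := pselect (forall j : 'I_m, (j < j0)%N -> (c j < c j0)%N).
  congr h; apply: eq_from_tnth => j; rewrite !tnth_mix /source ltnS.
  case: ifP => jj0.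
    rewrite tnth_updn /= eqn_add2l ltn_eqF//.
    apply: leq_ltn_trans ll'; rewrite -cl.
    by move: jj0; rewrite leq_eqVlt => /orP[/eqP/val_inj ->//|/inc/ltnW].
  case: ifP => // jJ.
  by rewrite tnth_updn /= ltn_eqF// ltn_addr.
move=> /existsNP[j /not_implyP[jj0 /negP ncj]].
by rewrite !(h_inc _ jj0 ncj).
Qed.

Lemma mix_upd_averaged c x z s :
  mix (source j0 J c) x (upd z j0 s) = upd (mix (source j0 J c) x z) j0 s.
Proof.
apply: eq_from_tnth => j; rewrite tnth_upd !tnth_mix /source.
have [->|jj0] := eqVneq j j0; first by rewrite ltnn (negbTE J0) tnth_upd eqxx.
by case: ifP => //; case: ifP => // _ _; rewrite tnth_upd (negbTE jj0).
Qed.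

Lemma mean_zero_cst0 : mean_zero mu f (fun=> 0).
Proof.
move=> k; have -> : EFin \o (f k \o (fun=> 0)) = cst 0%E :> (S -> \bar R).
  by apply/funext => s /=; case: nf => /(_ k)/bounded_linear0 ->.
split; first exact: integrable0.
by case: nf => /(_ k)/bounded_linear0 -> _ _; rewrite integral0.
Qed.

(** For increasing [c] the map [source] is injective where defined, so [ae_mix] carries over the
    null set of [h_centered]; the other [c] contribute 0. *)
Lemma ae_centered_inner b :
  {ae (lam \x rho)%E, forall w,
    mean_zero mu f (fun s => inner j0 J b w.1 (upd w.2 j0 s))}.
Proof.
rewrite /inner; elim: (index_enum _) => [|c s IH].
  by apply: nearW => w; under eq_fun do rewrite big_nil; exact: mean_zero_cst0.
have hc : {ae (lam \x rho)%E, forall w, mean_zero mu f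
    (fun s => h c (mix (source j0 J c) w.1 (upd w.2 j0 s)))}.
  have [inc|] := pselect (forall j j' : 'I_m, (j < j')%N -> (c j < c j')%N).
    have inj j j' i : source j0 J c j = Some i -> source j0 J c j' = Some i -> j = j'.
      rewrite /source; case: ifP => _; case: ifP => _.
      - move=> /Some_inj <- /Some_inj/rshift_inj/esym cE; apply: val_inj.
        by have [/inc|/inc|//] := ltngtP j j'; rewrite cE ltnn.
      - move=> /Some_inj iE; case: ifP => _; last by congruence.
        by rewrite -iE => /Some_inj/eqP; rewrite eq_lrshift.
      - move=> /Some_inj iE; case: ifP => _.
          by rewrite -iE => /Some_inj/eqP; rewrite eq_rlshift.
        case: ifP => _; last by congruence.
        by rewrite -iE => /Some_inj/lshift_inj/esym.
      - by congruence.
    apply: filterS (ae_mix lamP rhoP inj (h_centered c j0)) => w.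
    by under eq_fun do rewrite -mix_upd_averaged.
  move=> /existsNP[j /existsNP[j' /not_implyP[jj' /negP ncj]]].
  apply: nearW => w; under eq_fun do rewrite (h_inc _ jj' ncj).
  exact: mean_zero_cst0.
apply: filterS2 hc IH => w hw IHw.
under eq_fun do rewrite big_cons.
by case: (agree _ _ _) => //; exact: (mean_zeroD nf hw IHw).
Qed.

Let u (l : nat) x s := updn x (m + l) s.

Lemma W_partial x : W j0.+1 J a x = Vp N p rho r (partial layer n x).
Proof.
rewrite /Vp big_filter; apply: eq_bigr => b _; apply: eq_integral => z _.
by rewrite /partial layer_sum.
Qed.

Lemma Vp_layer_frozen (l : 'I_n) x s :
  Vp N p rho r (fun b z => layer l b (u l x s) z) =
  W j0 (j0 |: J)%SET (reset a j0 l) (updn x j0 s).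
Proof.
rewrite /Vp /W big_filter averaged_predU.
apply: etrans (big_agree_reset _ a l (fun b => \int[rho]_z
  npow (inner j0 (j0 |: J)%SET b (updn x j0 s) z))%E j0_averaged).
apply: eq_bigr => b _; apply: eq_integral => z _.
by rewrite /u layer_frozen.
Qed.

(** Integrating the variable of index [l] moves it into the averaged copy, and summing over [l] adds
    [j0] to the averaged coordinates: the bracket is of the same kind, with one index fewer inside
    the norm. *)
Lemma bracket_W x : bracket N p mu rho r u layer n x = W j0 J a x.
Proof.
rewrite /W averaged_pred (big_agree_split _ _ _ j0_averaged); apply: eq_bigr => l _.
rewrite -(big_agree_reset _ a l (fun b => \int[rho]_z
  npow (inner j0 J b x z))%E j0_averaged).
rewrite -big_filter -/r /predicted /Vp.
have mn b : measurable_fun setT (fun w : S * m.-tuple S =>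
    npow (inner j0 J b x (upd w.2 j0 w.1))).
  apply: (measurable_npow _ nf).
  apply: (wmeasurable_comp (g := fun w => (x, upd w.2 j0 w.1)) _
    (wmeasurable_inner j0 J b)).
  apply: measurable_fun_pair; first exact: measurable_cst.
  apply: (measurable_fun_comp2 (g := fun z s => upd z j0 s)); measurable_proj.
  exact: measurable_upd.
rewrite ge0_integral_sum//; last 2 first.
- move=> b; under eq_fun do under eq_integral do rewrite /u layer_averaged.
  apply: (measurable_integral2
    (fun s z => npow (inner j0 J (reset b j0 l) x (upd z j0 s)))) => //.
  by move=> *; exact: npow_ge0.
- by move=> b s _; apply: integral_ge0 => *; exact: npow_ge0.
apply: eq_bigr => b _.
under eq_integral do under eq_integral do rewrite /u layer_averaged.
rewrite (integral_swap (fun s z =>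
  npow (inner j0 J (reset b j0 l) x (upd z j0 s)))) //; last first.
  by move=> *; exact: npow_ge0.
rewrite -(rhoP j0 (f := fun z => npow (inner j0 J (reset b j0 l) x z)))//.
  apply: (measurable_npow _ nf).
  apply: (wmeasurable_comp (g := fun z => (x, z)) _
    (wmeasurable_inner j0 J _)).
  by measurable_proj.
by move=> *; exact: npow_ge0.
Qed.

Lemma wmeasurable_layer l b : wmeasurable
  (fun w : (m + n).-tuple S * m.-tuple S => layer l b w.1 w.2).
Proof. by apply: wmeasurable_sum => c _; exact: wmeasurable_term. Qed.

Lemma measurable_gt (g : (m + n).-tuple S -> \bar R) (y : \bar R) :
  measurable_fun setT g -> measurable [set x | (y < g x)%E].
Proof.
move=> mg; rewrite -[X in measurable X]setTI.
exact: emeasurable_fun_o_infty.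
Qed.

Lemma lam_resample (A A' : set ((m + n).-tuple S)) (i i' : 'I_(m + n)) :
  measurable A -> measurable A' ->
  (forall x s, A (upd x i s) <-> A' (upd x i' s)) -> lam A = lam A'.
Proof.
move=> mA mA' AA'.
have lamE E : measurable E -> lam E = (\int[lam]_x (\1_E x)%:E)%E.
  by move=> mE; rewrite integral_indic// setIT.
have m1 E : measurable E ->
    measurable_fun setT (fun x : (m + n).-tuple S => (\1_E x)%:E : \bar R).
  by move=> mE; exact/measurable_EFinP/measurable_indic.
have i0 (E : set ((m + n).-tuple S)) x : (0 <= (\1_E x)%:E :> \bar R)%E.
  by rewrite lee_fin indicE.
rewrite (lamE _ mA) (lamE _ mA') (lamP i (m1 _ mA) (i0 A)).
rewrite (lamP i' (m1 _ mA') (i0 A')).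
apply: eq_integral => x _; apply: eq_integral => s _; congr (_%:E).
have [xa|nxa] := pselect (A (upd x i s)).
  by rewrite !indicE (mem_set xa) (mem_set (proj1 (AA' x s) xa)).
by rewrite !indicE (memNset nxa) (memNset (fun e => nxa (proj2 (AA' x s) e))).
Qed.

Lemma layer_law (l : 'I_n) (y : R) :
  lam [set x | (y%:E < Vp N p rho r (fun b z => layer l b x z))%E] =
  lam [set x | (y%:E < W j0 (j0 |: J)%SET (reset a j0 l) x)%E].
Proof.
apply: (@lam_resample _ _ (rshift m l) (lshift n j0)).
- apply: measurable_gt; apply: (measurable_Vp p nf rho r
    (h := fun x b z => layer l b x z)) => b.
  exact: wmeasurable_layer.
- by apply: measurable_gt; exact: measurable_W.
- move=> x s; rewrite /mkset -!updn_upd.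
  by rewrite -(Vp_layer_frozen l x s).
Qed.

Lemma step_good_lambda (y delta : R) : 0 < y -> 0 < delta -> delta <= 1 ->
  (lam (exceeds N p rho r layer n (64 * y)) <=
    (C * delta / 8)%:E * lam (exceeds N p rho r layer n y) +
    \sum_(l < n)
      lam [set x | (delta * y)%:E < W j0 (j0 |: J)%SET (reset a j0 l) x] +
    lam [set x | (delta * y)%:E < W j0 J a x])%E.
Proof.
move=> y0 d0 d1.
under [X in (_ <= _ + X + _)%E]eq_bigr do rewrite -layer_law.
have -> : W j0 J a = bracket N p mu rho r u layer n.
  by apply/funext => x; rewrite bracket_W.
have updE l x s (ln : (l < n)%N) :
  u l x s = upd x (rshift m (Ordinal ln)) s by rewrite /u -updn_upd.
apply: (good_lambda eN nf p1 p2 C2 r (L := n) (u := u)) y0 d0 d1.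
- by move=> l; exact: measurable_updn.
- move=> l g ln mg g0; rewrite (lamP (rshift m (Ordinal ln)) mg g0).
  by apply: eq_integral => x _; apply: eq_integral => s _; rewrite updE.
- move=> k l x s s' kl ln; apply: eq_from_tnth => i; rewrite !tnth_updn.
  by case: eqP => // ->; rewrite eqn_add2l ltn_eqF.
- move=> l x s s' ln; apply: eq_from_tnth => i; rewrite !tnth_updn.
  by case: eqP.
- by move=> l b; exact: wmeasurable_layer.
- by move=> l k b x s z lk kn; exact: layer_adapted.
- move=> l b ln; apply: filterS (ae_centered_inner (reset b j0 (Ordinal ln))) => w.
  congr (mean_zero mu f); apply/funext => s.
  by rewrite -layer_averaged.
Qed.

End one_coordinate.
End step.

(** * Weighted series over geometric levels *)

Section dyadic.
Context (R : realType) (w L0 : R).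
Hypotheses (w0 : 0 < w) (w1 : w < 1) (L00 : 0 < L0).
Implicit Types E F : R -> \bar R.

(* A discrete substitute for the integral of [q u^(q-1) P(Y > t u)] over
   [0, 1], on the grid of levels [L0 / 64^j], with [w = 64^(-q/p)]. *)
Definition Psi E : \bar R :=
  (\sum_(0 <= j <oo) (w ^+ j)%:E * E (L0 / 64 ^+ j)%R)%E.

Let wj0 j : (0 <= (w ^+ j)%:E)%E.
Proof. by rewrite lee_fin exprn_ge0// ltW. Qed.

Let lev0 j : 0 < L0 / 64 ^+ j.
Proof. by rewrite divr_gt0// exprn_gt0. Qed.

Lemma Psi_ge0 E : (forall y, 0 <= E y)%E -> (0 <= Psi E)%E.
Proof. by move=> E0; apply: nneseries_ge0 => j _ _; rewrite mule_ge0. Qed.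

Lemma le_Psi E F : (forall y, 0 <= E y)%E -> (forall y, 0 < y -> (E y <= F y)%E) ->
  (Psi E <= Psi F)%E.
Proof.
move=> E0 EF; apply: lee_nneseries => [j _ _|j _]; first by rewrite mule_ge0.
by rewrite lee_wpmul2l// EF.
Qed.

Lemma PsiD E F : (forall y, 0 <= E y)%E -> (forall y, 0 <= F y)%E ->
  Psi (fun y => E y + F y)%E = (Psi E + Psi F)%E.
Proof.
move=> E0 F0; rewrite /Psi -nneseriesD; last 2 first.
- by move=> j _ _; rewrite mule_ge0.
- by move=> j _ _; rewrite mule_ge0.
by apply: eq_eseriesr => j _; rewrite ge0_muleDr.
Qed.

Lemma Psi_sum (I : Type) (s : seq I) (Q : pred I) (G : I -> R -> \bar R) :
  (forall i y, 0 <= G i y)%E ->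
  Psi (fun y => \sum_(i <- s | Q i) G i y)%E = (\sum_(i <- s | Q i) Psi (G i))%E.
Proof.
move=> G0; rewrite /Psi -nneseries_sum; last by move=> i j _; rewrite mule_ge0.
by apply: eq_eseriesr => j _; rewrite ge0_sume_distrr.
Qed.

Lemma PsiZ c E : (forall y, 0 <= E y)%E ->
  Psi (fun y => c%:E * E y)%E = (c%:E * Psi E)%E.
Proof.
move=> E0; rewrite /Psi -nneseriesZl; last by move=> j _; rewrite mule_ge0.
by apply: eq_eseriesr => j _; rewrite muleCA.
Qed.

(** Lowering the levels by [64 ^+ i] shifts the series by [i] terms, and each shift costs a factor
    [w^-1]. *)
Lemma Psi_shift i E : (forall y, 0 <= E y)%E ->
  (Psi (fun y => E (y / 64 ^+ i)%R) <= (w ^- i)%:E * Psi E)%E.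
Proof.
move=> E0.
have T0 j : (0 <= (w ^+ j)%:E * E (L0 / 64 ^+ j)%R)%E by rewrite mule_ge0.
have wi : 0 < w ^+ i by rewrite exprn_gt0.
have -> : Psi (fun y => E (y / 64 ^+ i)%R) = ((w ^- i)%:E *
    \sum_(0 <= j <oo) (w ^+ (j + i))%:E * E (L0 / 64 ^+ (j + i))%R)%E.
  rewrite -nneseriesZl; last by move=> j _; rewrite mule_ge0.
  apply: eq_eseriesr => j _; rewrite muleA -EFinM exprD mulrCA mulVf ?gt_eqF//.
  by rewrite mulr1 exprD invfM mulrA.
apply: lee_wpmul2l; first by rewrite lee_fin invr_ge0 ltW.
rewrite (nneseries_addn (f := fun j => (w ^+ j)%:E * E (L0 / 64 ^+ j)%R)%E)//.
rewrite /Psi; have -> := @nneseries_split R (fun j => (w ^+ j)%:E * E (L0 / 64 ^+ j)%R)%E 0 i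
  (fun k _ => T0 k).
by rewrite add0n leeDr// sume_ge0.
Qed.

Lemma Psi_le_geometric E : (forall y, 0 <= E y)%E -> (forall y, E y <= 1)%E ->
  (Psi E <= ((1 - w)^-1)%:E)%E.
Proof.
move=> E0 E1.
apply: lime_le; first by apply: is_cvg_nneseries => j _ _; rewrite mule_ge0.
apply: nearW => n.
apply: (@le_trans _ _ (\sum_(0 <= j < n) (w ^+ j)%:E)%E).
  by apply: lee_sum => j _; rewrite -[leRHS]mule1 lee_wpmul2l.
rewrite sumEFin lee_fin.
have := @geometric_le_lim R n 1 w ler01 w0; rewrite gtr0_norm// => /(_ w1).
by rewrite /series /geometric /= mul1r; under eq_bigr do rewrite mul1r.
Qed.

(* Absorption: a good-lambda inequality between consecutive levels bounds the
   weighted series, as soon as the factor [eps] beats the ratio of weights. *)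
Lemma Psi_good_lambda (i : nat) (eps : R) E F :
  (forall y, 0 <= E y)%E -> (forall y, E y <= 1)%E -> (forall y, 0 <= F y)%E ->
  0 <= eps -> eps <= w / 2 ->
  (forall y, 0 < y ->
    (E (64 * y)%R <= eps%:E * E y + F (64 ^- i * y)%R)%E) ->
  (Psi E <= (2 * w ^- i.+1)%:E * Psi F)%E.
Proof.
move=> E0 E1 F0 eps0 epsw EF.
have H : (Psi E <= Psi (fun y => eps%:E * E (y / 64 ^+ 1)%R + F (y / 64 ^+ i.+1)%R))%E.
  apply: le_Psi => // y y0.
  have y64 : 0 < y / 64 by rewrite divr_gt0.
  have := EF _ y64.
  rewrite mulrCA mulfV// mulr1 expr1.
  suff -> : 64 ^- i * (y / 64) = y / 64 ^+ i.+1 by [].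
  by rewrite exprSr invfM mulrCA mulrC -mulrA.
(* Of the [i + 1] shifts of [F], one comes from the ratio 64 and [i] from the factor [64 ^- i]. The
   [E] term needs a single shift, so its factor is [eps / w <= 1 / 2]. *)
have H1 : (Psi E <= (2^-1)%:E * Psi E + (w ^- i.+1)%:E * Psi F)%E.
  apply: (le_trans H); rewrite PsiD; last 2 first.
  - by move=> y; rewrite mule_ge0.
  - by move=> y.
  rewrite leeD//; last exact: Psi_shift.
  rewrite PsiZ//; apply: (@le_trans _ _ (eps%:E * ((w ^- 1)%:E * Psi E))%E).
    by rewrite lee_wpmul2l//; exact: Psi_shift.
  rewrite muleA -EFinM lee_wpmul2r ?Psi_ge0// lee_fin expr1.
  by rewrite ler_pdivrMr// mulrC.
(* [E] is bounded by 1, so [Psi E] is finite and half of it can be moved to the left. *)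
have := le_lt_trans (Psi_le_geometric E0 E1) (ltry _); have := Psi_ge0 E0.
move: H1; case: (Psi E) => // e; rewrite -EFinM => H1 _ _.
have := Psi_ge0 F0; move: H1; case: (Psi F) => [v|_ _|//].
  rewrite -!EFinM -EFinD !lee_fin => h _.
  have := ler_wpM2l (ltW (@ltr0Sn R 1)) h.
  rewrite mulrDr mulrA mulfV// mul1r.
  by rewrite -mulrA; lra.
by rewrite gt0_muley ?leey// lte_fin mulr_gt0// invr_gt0 exprn_gt0.
Qed.

End dyadic.

Lemma le_sume_term (R : realType) (I : finType) (Q : pred I) (F : I -> \bar R)
    (i : I) :
  Q i -> (forall j, Q j -> (0 <= F j)%E) -> (F i <= \sum_(j | Q j) F j)%E.
Proof.
move=> Qi F0; rewrite (bigD1 i)//= leeDl// sume_ge0// => j /andP[Qj _].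
exact: F0.
Qed.

(** * Iteration over the coordinates *)

Section unroll.
Context (R : realType) (B : normedModType R) (N : B -> R) (p C : R).
Context (f : nat -> B -> R).
Hypotheses (eN : equivalent_norm N) (nf : norming N f) (p1 : 1 < p)
  (p2 : p <= 2) (C2 : two_point N p C).
Context d (S : measurableType d) (mu : probability S R) (m n : nat).
Context (lam : probability ((m + n).-tuple S) R)
  (rho : probability (m.-tuple S) R).
Hypotheses (lamP : is_power mu lam) (rhoP : is_power mu rho).
Variable h : {ffun 'I_m -> 'I_n} -> m.-tuple S -> B.
Hypothesis mh : forall c, wmeasurable (h c).
Hypothesis h_inc : forall (c : {ffun 'I_m -> 'I_n}) (j j' : 'I_m) x,
  (j < j')%N -> ~~ (c j < c j')%N -> h c x = 0.
Hypothesis h_centered : forall c j,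
  {ae rho, forall x, mean_zero mu f (fun s => h c (upd x j s))}.
Variables (w L0 : R) (i : nat).
Hypotheses (w0 : 0 < w) (w1 : w < 1) (L00 : 0 < L0).
Hypothesis small : C * 64 ^- i / 8 <= w / 2.
Implicit Types (a b c : {ffun 'I_m -> 'I_n}) (J : {set 'I_m}).

Local Notation W := (W N p rho h).
Local Notation Psi := (Psi w L0).
Local Notation K1 := (2 * w ^- i.+1).

Definition PsiW (k : nat) J a : \bar R :=
  Psi (fun y => lam [set x | (y%:E < W k J a x)%E]).

Definition leaves (k : nat) J a : \bar R :=
  (\sum_(J' : {set 'I_m} | (J \subset J') && (J' :\: J \subset low m k)%SET)
     \sum_(a' | agree (J' :\: J)%SET a a') PsiW 0 J' a')%E.

Definition PsiMax (j0 : 'I_m) J a : \bar R :=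
  Psi (fun y => lam (exceeds N p rho
    [seq b <- index_enum {ffun 'I_m -> 'I_n} | agree (averaged j0.+1 J) a b]
    (layer h j0 J) n y)).

Lemma PsiW_ge0 k J a : (0 <= PsiW k J a)%E.
Proof. by apply: Psi_ge0 => // y; exact: measure_ge0. Qed.

(** This is [step_good_lambda] with [delta = 64 ^- i]: by [small], its factor [C delta / 8] is at
    most [w / 2], as absorption requires. *)
Lemma PsiMax_le (j0 : 'I_m) J a : (forall j, j \in J -> (j0 < j)%N) ->
  (PsiMax j0 J a <= K1%:E *
    (\sum_(l < n) PsiW j0 (j0 |: J)%SET (reset a j0 l) + PsiW j0 J a))%E.
Proof.
move=> Jj0; rewrite /PsiW -Psi_sum// -PsiD//; last first.
  by move=> y; apply: sume_ge0 => *; exact: measure_ge0.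
apply: (Psi_good_lambda w0 w1 L00 _ _ _ _ small).
- by move=> y; exact: measure_ge0.
- move=> y; apply: probability_le1; apply: (measurable_exceeds p nf rho) => l b.
  exact: wmeasurable_layer.
- by move=> y; apply: adde_ge0; [apply: sume_ge0 => *|]; exact: measure_ge0.
- rewrite divr_ge0// mulr_ge0// ?invr_ge0 ?exprn_ge0//.
  by case: C2 => /ltW.
move=> y y0; rewrite addeA.
apply: (step_good_lambda eN nf p1 p2 C2 lamP rhoP mh h_inc h_centered) => //.
by rewrite invf_le1 ?exprn_gt0// exprn_ege1// ler1n.
Qed.

Lemma PsiW_le_PsiMax (j0 : 'I_m) J a : (forall j, j \in J -> (j0 < j)%N) ->
  (PsiW j0.+1 J a <= PsiMax j0 J a)%E.
Proof.
move=> Jj0; apply: le_Psi => // y y0; apply: le_measure; rewrite ?inE.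
- by apply: measurable_gt; apply: (measurable_W p nf rho mh).
- apply: (measurable_exceeds p nf rho) => l b; exact: wmeasurable_layer.
- move=> x; rewrite /mkset (W_partial N p rho h j0 J a) => yW.
  by exists n.
Qed.

(** The sets [J'] are sorted by whether they contain [j0]; if so, [l] is the index at which [j0] is
    frozen. *)
Lemma leaves_succ (j0 : 'I_m) J a : (forall j, j \in J -> (j0 < j)%N) ->
  leaves j0.+1 J a =
  (\sum_(l < n) leaves j0 (j0 |: J)%SET (reset a j0 l) + leaves j0 J a)%E.
Proof.
move=> Jj0.
have j0J : j0 \notin J by apply/negP => /Jj0; rewrite ltnn.
rewrite /leaves (bigID (fun J' : {set 'I_m} => j0 \in J'))/=; congr (_ + _)%E.
  rewrite exchange_big/=; apply: eq_big => [J'|J' /andP[/andP[JJ' _] j0J']].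
    rewrite finset.subUset finset.sub1set; case: (boolP (j0 \in J')) => /=; last by rewrite andbF.
    move=> j0J'; rewrite andbT; congr (_ && _).
    apply/fintype.subsetP/fintype.subsetP => sub j; have := sub j; rewrite !inE.
      rewrite negb_or => jP /andP[/andP[jj0 jJ] jJ'].
      have := jP ltac:(by rewrite jJ jJ'); rewrite ltnS leq_eqVlt.
      by case/orP => // /eqP/val_inj jE; rewrite jE eqxx in jj0.
    move=> jP /andP[jJ jJ']; rewrite ltnS leq_eqVlt.
    have [->|jj0] := eqVneq j j0; first by rewrite eqxx.
    by rewrite jP ?orbT// negb_or jj0 jJ jJ'.
  have -> : (J' :\: J = j0 |: (J' :\: (j0 |: J)))%SET.
    apply/setP => j; rewrite !inE negb_or.
    by have [->|//] := eqVneq j j0; rewrite j0J j0J'.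
  by rewrite (big_agree_split _ _ _ (j := j0))// !inE eqxx.
apply: eq_bigl => J'; rewrite -andbA; congr (_ && _).
apply/andP/idP => [[/fintype.subsetP sub j0J']|/fintype.subsetP sub].
  apply/fintype.subsetP => j jJ; have := sub _ jJ; rewrite !inE ltnS leq_eqVlt.
  case/orP => [/eqP/val_inj jj0|//].
  by move: jJ; rewrite jj0 !inE (negbTE j0J') andbF.
split.
  by apply/fintype.subsetP => j /sub; rewrite !inE => /ltnW.
apply/negP => j0J'; have := sub j0; rewrite !inE j0J j0J' ltnn => /(_ isT).
by [].
Qed.

Lemma leaves_ge0 k J a : (0 <= leaves k J a)%E.
Proof. by do 2 apply: sume_ge0 => ? _; exact: PsiW_ge0. Qed.

(** Each of the [k] remaining coordinates costs one absorption, hence the power of [K1]. *)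
Lemma PsiW_le_leaves k J a : (k <= m)%N -> (forall j, j \in J -> (k <= j)%N) ->
  (PsiW k J a <= (K1 ^+ k)%:E * leaves k J a)%E.
Proof.
have K10 : 0 <= K1 by rewrite mulr_ge0// invr_ge0 exprn_ge0// ltW.
elim: k J a => [|k IH] J a km Jk.
  rewrite expr0 mul1e.
  have aa : agree (J :\: J)%SET a a by apply/agreeP.
  apply: (le_trans (le_sume_term aa _)); last apply: (le_sume_term _ _).
  - by move=> a' _; exact: PsiW_ge0.
  - by rewrite subxx finset.setDv finset.sub0set.
  - by move=> J' _; apply: sume_ge0 => a' _; exact: PsiW_ge0.
pose j0 : 'I_m := Ordinal km.
have Jj0 : forall j, j \in J -> (j0 < j)%N by exact: Jk.
apply: (le_trans (@PsiW_le_PsiMax j0 J a Jj0)).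
apply: (le_trans (PsiMax_le _ Jj0)).
rewrite (leaves_succ _ Jj0) (exprS K1 k) (EFinM K1) -muleA lee_wpmul2l ?lee_fin//.
rewrite ge0_muleDr ?leaves_ge0//; last by apply: sume_ge0 => *; exact: leaves_ge0.
rewrite ge0_sume_distrr; last by move=> *; exact: leaves_ge0.
apply: leeD; last by apply: IH; [exact: ltnW|move=> j /Jj0/ltnW].
apply: lee_sum => l _; apply: IH; first exact: ltnW.
by move=> j; rewrite in_setU1 => /orP[/eqP ->//|/Jj0/ltnW].
Qed.

(** A genuine maximum is estimated at the last index; the lower ones enter through final sums, which
    [PsiW_le_leaves] bounds by maxima. *)
Lemma PsiMax_le_leaves (j0 : 'I_m) a : m = j0.+1 ->
  (PsiMax j0 finset.set0 a <= (K1 ^+ m)%:E *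
     \sum_(J : {set 'I_m}) \sum_(a' | agree J a a') PsiW 0 J a')%E.
Proof.
move=> mE.
have K10 : 0 <= K1 by rewrite mulr_ge0// invr_ge0 exprn_ge0// ltW.
have J0 : forall j, j \in (finset.set0 : {set 'I_m}) -> (j0 < j)%N.
  by move=> j; rewrite inE.
have -> : (\sum_(J : {set 'I_m}) \sum_(a' | agree J a a') PsiW 0 J a' =
    leaves j0.+1 finset.set0 a)%E.
  rewrite /leaves; apply: eq_big => [J|J _].
    rewrite finset.sub0set finset.setD0; apply/esym/fintype.subsetP => j _.
    by rewrite inE -mE.
  by rewrite finset.setD0.
apply: (le_trans (PsiMax_le _ J0)).
have -> : K1 ^+ m = K1 * K1 ^+ j0 by rewrite [in LHS]mE (exprS K1).
rewrite (leaves_succ _ J0) (EFinM K1) -muleA lee_wpmul2l ?lee_fin//.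
rewrite ge0_muleDr ?leaves_ge0//; last by apply: sume_ge0 => *; exact: leaves_ge0.
rewrite ge0_sume_distrr; last by move=> *; exact: leaves_ge0.
apply: leeD; last by apply: PsiW_le_leaves; [exact: ltnW|move=> j; rewrite inE].
apply: lee_sum => l _; apply: PsiW_le_leaves; first exact: ltnW.
by move=> j; rewrite in_setU1 inE orbF => /eqP ->.
Qed.

End unroll.

(** * Conditioning and degeneracy *)

(** If [r < s], then [A] is null: [s P(A)] is at most the integral of [Y] over [A], equal to that of
    [Y0], which is at most [r P(A)]. Rational [r], [s] cover the set where [Y0 < Y]. Since [Y0] is
    bounded on [A], the total integrals may be infinite. *)
Lemma ae_le_of_integral_eq d (T : measurableType d) (R : realType)
    (P : probability T R) (Y0 Y : T -> \bar R) :
  measurable_fun setT Y0 -> measurable_fun setT Y ->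
  (forall w, 0 <= Y0 w)%E -> (forall w, 0 <= Y w)%E ->
  (forall r s : R, let A := [set w | (Y0 w < r%:E)%E] `&` [set w | (s%:E < Y w)%E] in
    \int[P]_(w in A) Y0 w = \int[P]_(w in A) Y w)%E ->
  {ae P, forall w, (Y w <= Y0 w)%E}.
Proof.
move=> mY0 mY Y00 Y0' eqY.
pose A (r s : R) := [set w | (Y0 w < r%:E)%E] `&` [set w | (s%:E < Y w)%E].
have mA r s : measurable (A r s).
  apply: measurableI; rewrite -[X in measurable X]setTI.
    exact: emeasurable_fun_infty_o.
  exact: emeasurable_fun_o_infty.
have A0 r s : r < s -> P (A r s) = 0%E.
  move=> rs; have [r0|r0] := leP r 0.
    rewrite (_ : A r s = set0) ?measure0//; apply/seteqP; split => // w [/= h _].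
    by have := lt_le_trans h (lee_tofin r0); rewrite ltNge Y00.
  have s0 : 0 < s by exact: lt_trans rs.
  have h1 : (s%:E * P (A r s) <= \int[P]_(w in A r s) Y w)%E.
    rewrite -integral_cst//; apply: (ge0_le_integral _ (mA r s)).
    - by move=> w _; rewrite lee_fin ltW.
    - exact: measurable_cst.
    - exact: measurable_funTS.
    - by move=> w [_ /= /ltW].
  have h2 : (\int[P]_(w in A r s) Y0 w <= r%:E * P (A r s))%E.
    rewrite -integral_cst//; apply: (ge0_le_integral _ (mA r s)).
    - by move=> w _.
    - exact: measurable_funTS.
    - exact: measurable_cst.
    - by move=> w [/= /ltW].
  have fin : (P (A r s) \is a fin_num) by rewrite fin_num_measure.
  have := le_trans h1; rewrite -eqY => /(_ _ h2).
  rewrite -(fineK fin) -!EFinM lee_fin => h3.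
  congr EFin; apply/eqP; rewrite eq_le fine_ge0// andbT.
  rewrite -(@pmulr_rle0 _ (s - r)) ?subr_gt0// mulrBl; lra.
pose F k : set T := if (choice.unpickle k : option (rat * rat)) is Some rs then
  (if rs.1 < rs.2 then A (ratr rs.1) (ratr rs.2) else set0) else set0.
have [E [mE E0 sE]] : P.-negligible (\bigcup_k F k).
  apply: negligible_bigcup => k; rewrite /F.
  case: (choice.unpickle k) => [[r s]/=|]; last exact: negligible_set0.
  case: ifPn => rs; last exact: negligible_set0.
  by exists (A (ratr r) (ratr s)); split => //; apply: A0; rewrite ltr_rat.
exists E; split => //; apply: subset_trans sE.
move=> w /= /negP; rewrite -ltNge => YY.
have [a Y0w] : exists a, Y0 w = a%:E.
  move: YY (Y00 w); case: (Y0 w) => [a _ _|//|//]; first by exists a.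
  by case: (Y w).
have [e ae eY] : exists2 e : R, a < e & (e%:E <= Y w)%E.
  move: YY; rewrite Y0w; case: (Y w) => [b|_|//]; last first.
    by exists (a + 1); rewrite ?leey// ltrDl.
  by rewrite lte_fin => ab; exists b.
have [s] := rat_in_itvoo ae; rewrite in_itv/= => /andP[as' se].
have [r] := rat_in_itvoo as'; rewrite in_itv/= => /andP[ar rs].
exists (choice.pickle (r, s)); first exact: I.
rewrite /F choice.pickleK /fst /snd -(ltr_rat R) rs.
split => /=; first by rewrite Y0w lte_fin.
by apply: lt_le_trans eY; rewrite lte_fin.
Qed.

Section conditioning.
Context d d' (T : measurableType d) (S : measurableType d') (R : realType).
Context (P : probability T R) (xi : nat -> {RV P >-> S}) (m : nat).
Context (mu : probability S R) (rho : probability (m.-tuple S) R).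
Local Notation X := (xi_tuple xi (initial m)).
Hypothesis rhoE : forall A, rho A = P (X @^-1` A).
Hypothesis rhoi : forall f : m.-tuple S -> \bar R, measurable_fun setT f ->
  (forall x, 0 <= f x)%E -> (\int[rho]_x f x = \int[P]_w f (X w))%E.
Hypothesis rhoP : is_power mu rho.
Variable J : {set 'I_m}.

Definition keep (j : 'I_m) : option 'I_m := if j \in J then Some j else None.

(** Invariance under changes of the coordinates outside [J]; this describes [sigma_xi] through sets
    of tuples. *)
Definition depends_on (A : set (m.-tuple S)) :=
  measurable A /\ forall y z, A (mix keep y z) <-> A y.

Lemma tnth_X j w : tnth (X w) j = xi (initial m j) w.
Proof. by rewrite tnth_mktuple. Qed.

Lemma sigma_xiP A : sigma_xi xi J A -> exists2 A', depends_on A' & A = X @^-1` A'.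
Proof.
move=> GA.
pose H := [set A | exists2 A', depends_on A' & A = X @^-1` A'].
suff : H A by [].
apply: GA; split; last first.
  move=> _ [k kJ [E mE ->]]; exists ((@tnth m S)^~ k @^-1` E); last first.
    by apply/seteqP; split => w; rewrite /preimage/= tnth_X.
  split; first by rewrite -[X in measurable X]setTI; exact: measurable_tnth.
  by move=> y z; rewrite /preimage/= tnth_mix /keep kJ.
split.
- by exists set0 => //; split.
- move=> _ [A' [mA' A'd] ->]; exists (~` A'); last by rewrite setTD.
  split; first exact: measurableC.
  move=> y z; split => h h'; apply: h; first exact: (proj2 (A'd y z) h').
  exact: (proj1 (A'd y z) h').
- move=> F HF.
  have /choice[F' F'P] : forall n, exists A', depends_on A' /\ F n = X @^-1` A'.
    by move=> n; have [A' ? ?] := HF n; exists A'.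
  exists (\bigcup_n F' n); last first.
    by rewrite preimage_bigcup; apply: eq_bigcupr => n _; case: (F'P n).
  split; first by apply: bigcupT_measurable => n; case: (F'P n) => -[].
  move=> y z; split => -[n _ h]; exists n => //; case: (F'P n) => -[_ h'] _.
    exact: (proj1 (h' y z) h).
  exact: (proj2 (h' y z) h).
Qed.

Lemma depends_on_sigma_xi A : depends_on A -> sigma_xi xi J (X @^-1` A).
Proof.
move=> [mA dA].
pose gens := [set A | exists2 k, k \in J & exists2 C, measurable C &
         A = xi (initial m k) @^-1` C].
(* Filling the coordinates outside [J] with a fixed tuple does not change membership in [A], and
   makes the map measurable for [sigma_xi]. *)
pose phi (w : g_sigma_algebraType gens) : m.-tuple S := mix keep (X w) point.
have mphi : measurable_fun setT phi.
  apply/measurable_fun_tnthP => k; rewrite (_ : _ \o _ =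
    fun w => if k \in J then xi (initial m k) w else tnth point k); last first.
    by apply/funext => w /=; rewrite tnth_mix /keep; case: ifP => // _; rewrite tnth_X.
  case: (boolP (k \in J)) => kJ; last exact: measurable_cst.
  move=> _ C mC; rewrite setTI; apply: sub_sigma_algebra.
  by exists k => //; exists C.
have := mphi measurableT A mA; rewrite setTI.
suff -> : phi @^-1` A = X @^-1` A by [].
apply/seteqP; split => w; rewrite /preimage /mkset /phi => h.
  exact: (proj1 (dA (X w) point) h).
exact: (proj2 (dA (X w) point) h).
Qed.

Lemma sigma_xi_measurable A : sigma_xi xi J A -> measurable A.
Proof.
move=> /sigma_xiP[A' [mA' _] ->]; rewrite -[X in measurable X]setTI.
exact: measurable_xi_tuple.
Qed.

Lemma keep_inj j j' i : keep j = Some i -> keep j' = Some i -> j = j'.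
Proof.
by rewrite /keep; case: ifP => // _ /Some_inj ->; case: ifP => // _ /Some_inj ->.
Qed.

Lemma integral_depends_on (F : m.-tuple S -> \bar R) A' :
  measurable_fun setT F -> (forall y, 0 <= F y)%E -> measurable A' ->
  (\int[P]_(w in X @^-1` A') F (X w) = \int[rho]_y (F y * (\1_A' y)%:E))%E.
Proof.
move=> mF F0 mA'.
rewrite rhoi; last 2 first.
- by apply: emeasurable_funM => //; exact/measurable_EFinP/measurable_indic.
- by move=> y; rewrite mule_ge0// lee_fin indicE.
rewrite integral_mkcond; apply: eq_integral => w _.
by rewrite epatch_indic/= indicE.
Qed.

Variable F : m.-tuple S -> \bar R.
Hypotheses (mF : measurable_fun setT F) (F0 : forall y, (0 <= F y)%E).

(** By independence, composing this with [X] gives an explicit version of the conditional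
    expectation. *)
Definition averaged_out (y : m.-tuple S) : \bar R :=
  (\int[rho]_z F (mix keep y z))%E.

Lemma averaged_out_ge0 y : (0 <= averaged_out y)%E.
Proof. exact: integral_ge0. Qed.

Lemma measurable_averaged_out : measurable_fun setT averaged_out.
Proof.
apply: (measurable_integral2 (fun y z => F (mix keep y z))) => //.
exact: (measurable_fun_comp mF (@measurable_mix _ S _ m keep)).
Qed.

Lemma averaged_out_mix y z : averaged_out (mix keep y z) = averaged_out y.
Proof.
apply: eq_integral => z' _; congr F; apply: eq_from_tnth => j.
by rewrite !tnth_mix /keep; case: ifP => // jJ; rewrite tnth_mix /keep jJ.
Qed.

Lemma integral_averaged_out A : sigma_xi xi J A ->
  (\int[P]_(w in A) F (X w) = \int[P]_(w in A) averaged_out (X w))%E.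
Proof.
move=> /sigma_xiP[A' [mA' dA'] ->].
rewrite !integral_depends_on//; last 2 first.
- exact: measurable_averaged_out.
- exact: averaged_out_ge0.
have m1 : measurable_fun setT (fun y : m.-tuple S => (\1_A' y)%:E : \bar R).
  exact/measurable_EFinP/measurable_indic.
rewrite -(integral_mix rhoP rhoP keep_inj); last 2 first.
- exact: emeasurable_funM.
- by move=> y; rewrite mule_ge0// lee_fin indicE.
apply: eq_integral => y _; rewrite /averaged_out muleC.
have yA z : \1_A' (mix keep y z) = \1_A' y :> R.
  have [ya|nya] := pselect (A' y).
    by rewrite !indicE (mem_set ya) (mem_set (proj2 (dA' y z) ya)).
  by rewrite !indicE (memNset nya) (memNset (fun e => nya (proj1 (dA' y z) e))).
rewrite -ge0_integralZl//.
- by apply: eq_integral => z _; rewrite yA muleC.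
- apply: (measurable_fun_comp2 (g := fun y z => F (mix keep y z))) => //.
  exact: (measurable_fun_comp mF (@measurable_mix _ S _ m keep)).
Qed.

Lemma averaged_out_cond_expectation :
  is_ge0_cond_expectation P (sigma_xi xi J) (F \o X) (averaged_out \o X).
Proof.
split; first by move=> w; exact: averaged_out_ge0.
- move=> A mA; apply: (@depends_on_sigma_xi (averaged_out @^-1` A)); split.
    by rewrite -[X in measurable X]setTI; exact: measurable_averaged_out.
  by move=> y z; rewrite /preimage/= averaged_out_mix.
- by move=> A GA; exact: integral_averaged_out.
Qed.

Lemma ge0_cond_expectationP : is_ge0_cond_expectation P (sigma_xi xi J) (F \o X)
  (ge0_cond_expectation P (sigma_xi xi J) (F \o X)).
Proof.
rewrite /ge0_cond_expectation; case: xgetP => [Y _ //|/(_ (averaged_out \o X))].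
by case; exact: averaged_out_cond_expectation.
Qed.

Lemma sigma_xiI A A' : sigma_xi xi J A -> sigma_xi xi J A' -> sigma_xi xi J (A `&` A').
Proof.
move=> /sigma_xiP[B [mB dB] ->] /sigma_xiP[B' [mB' dB'] ->].
apply: (@depends_on_sigma_xi (B `&` B')); split; first exact: measurableI.
by move=> y z; split => -[/dB h /dB' h'].
Qed.

(** The version selected by [xget] has the same integrals as the explicit one over the sets of
    [sigma_xi], among which are those used by [ae_le_of_integral_eq]. This direction transfers upper
    bounds on tails. *)
Lemma averaged_out_le_cond_expectation :
  {ae P, forall w, (averaged_out (X w) <=
    ge0_cond_expectation P (sigma_xi xi J) (F \o X) w)%E}.
Proof.
have [Y0 mY iY] := ge0_cond_expectationP.
have [A0 mA iA] := averaged_out_cond_expectation.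
have meas (Y : T -> \bar R) : measurable_wrt (sigma_xi xi J) Y ->
    measurable_fun setT Y.
  by move=> mY' _ C mC; rewrite setTI; apply: sigma_xi_measurable; exact: mY'.
apply: (ae_le_of_integral_eq (meas _ mY) (meas _ mA)) => // r s.
have GA : sigma_xi xi J ([set w | (ge0_cond_expectation P (sigma_xi xi J) (F \o X) w < r%:E)%E]
    `&` [set w | (s%:E < averaged_out (X w))%E]).
  apply: sigma_xiI.
    have := mY `]-oo, r%:E[%classic (emeasurable_itv _).
    by rewrite preimage_itvNyo.
  have := mA `]s%:E, +oo[%classic (emeasurable_itv _).
  by rewrite preimage_itvoy.
by rewrite /= -iY// -iA.
Qed.

End conditioning.

(** * Scalar functionals of Bochner integrals *)

Section bochner_functional.
Context d (T : measurableType d) (R : realType) (P : probability T R)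
  (B : normedModType R).
Hypothesis sepB : separable_space B.
Variables (f : B -> R) (bf : bounded_linear f).

Let norm_wm d' (T' : measurableType d') (F : T' -> B) : wmeasurable F ->
  measurable_fun setT (fun w => `|F w|).
Proof.
have [g ng] := exists_norming sepB (equivalent_norm_norm B).
exact: (wmeasurable_norm ng).
Qed.

Lemma simple_functional (A : set T) (s : T -> B) : measurable A ->
  simple_function s -> P.-integrable A (EFin \o (f \o s)) /\
  (\int[P]_(w in A) (f (s w))%:E = (f (simple_integral P A s))%:E)%E.
Proof.
move=> mA [fs ms].
have wms := borel_wmeasurable ms.
have ms1 v : measurable (s @^-1` [set v]).
  rewrite (_ : s @^-1` [set v] = (fun w => `|s w - v|) @^-1` [set 0]).
    rewrite -[X in measurable X]setTI; apply: norm_wm => //.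
    by apply: wmeasurableD => //; exact: wmeasurable_cst.
  apply/seteqP; split => w /=; first by move=> ->; rewrite subrr normr0.
  by move=> /normr0_eq0/eqP; rewrite subr_eq0 => /eqP.
have E w : f (s w) =
    \sum_(v <- fset_set (range s)) f v * \1_(s @^-1` [set v]) w.
  rewrite (bigD1_seq (s w)) ?fset_uniq//=; last first.
    by rewrite in_fset_set//; apply/mem_set; exists w.
  rewrite indicE mem_set// mulr1 big1 ?addr0// => v vs.
  rewrite indicE memNset ?mulr0//= => h.
  by rewrite h eqxx in vs.
have I1 v : P.-integrable A (fun w => (f v)%:E * (\1_(s @^-1` [set v]) w)%:E)%E.
  apply: integrableZl => //.
  apply: integrableS (integrable_indic _ _) => //.
have EE : EFin \o (f \o s) = (fun w =>
    \sum_(v <- fset_set (range s)) (f v)%:E * (\1_(s @^-1` [set v]) w)%:E)%E.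
  by apply/funext => w /=; rewrite E -sumEFin; apply: eq_bigr => v _; rewrite EFinM.
split; first by rewrite EE; exact: integrable_sum.
transitivity (\int[P]_(w in A) (EFin \o (f \o s)) w)%E; first by [].
rewrite EE integral_sum// /simple_integral fsbig_finite// bounded_linear_sum//.
rewrite -sumEFin; apply: eq_bigr => v _.
rewrite bounded_linearZ// mulrC EFinM fineK ?fin_num_measure//; last exact: measurableI.
rewrite integralZl//; last first.
  apply: integrableS (integrable_indic _ _) => //.
by rewrite integral_indic// setIC.
Qed.

(** The integrals of [f] along the approximating simple functions converge both to [f v], by
    continuity, and to the integral of [f \o X], because [f] is dominated by a multiple of the
    norm. *)
Lemma bochner_functional (A : set T) (X : T -> B) (v : B) : measurable A ->
  is_bochner_integral P A X v ->
  P.-integrable A (EFin \o (f \o X)) /\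
  (\int[P]_(w in A) (f (X w))%:E = (f v)%:E)%E.
Proof.
move=> mA [mX [s [ss e0 sv]]].
have wX := borel_wmeasurable mX.
have wXs n : wmeasurable (fun w => X w - s n w).
  apply: wmeasurableD => //; apply: wmeasurableN; apply: borel_wmeasurable.
  by case: (ss n).
have [_ [C fC]] := bf.
pose e n := (\int[P]_(w in A) (`|X w - s n w|)%:E)%E.
have mn n : measurable_fun A (fun w => (`|X w - s n w|)%:E).
  by apply/measurable_EFinP; apply: measurable_funTS; exact: norm_wm.
have [/= efin fe0] := proj1 (fine_cvgP _ _) e0.
have C1 : 0 < `|C| + 1 by rewrite ltr_pwDr.
have fC1 x : `|f x| <= (`|C| + 1) * `|x|.
  rewrite (le_trans (fC x))// ler_wpM2r//.
  by rewrite (le_trans (ler_norm C))// lerDl.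
have i1 n : e n \is a fin_num -> P.-integrable A (EFin \o (f \o (fun w => X w - s n w))) /\
    (`|\int[P]_(w in A) (f (X w - s n w))%:E| <= (`|C| + 1)%:E * e n)%E.
  move=> en.
  have mf : measurable_fun A (EFin \o (f \o (fun w => X w - s n w))).
    by apply/measurable_EFinP; apply: measurable_funTS; exact: wXs.
  have ni : P.-integrable A (fun w => (`|C| + 1)%:E * (`|X w - s n w|)%:E)%E.
    apply: integrableZl => //; apply/integrableP; split; first exact: mn.
    under eq_integral do rewrite gee0_abs ?lee_fin//.
    by rewrite -ge0_fin_numE// integral_ge0// => *; rewrite lee_fin.
  have le w : (`|(f (X w - s n w))%:E| <= (`|C| + 1)%:E * (`|X w - s n w|)%:E)%E.
    by rewrite abse_EFin -EFinM lee_fin.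
  split.
    apply: le_integrable ni => // w _.
    by rewrite (le_trans (le w))// lee_abs.
  apply: (le_trans (le_abse_integral _ mA mf)).
  rewrite -(ge0_integralZl P mA (mn n)); last 2 first.
  - by move=> w _; rewrite lee_fin.
  - by rewrite lee_fin ltW.
  apply: (ge0_le_integral _ mA).
  - by move=> w _.
  - exact: measurableT_comp.
  - exact: measurable_funeM.
  - by move=> w _; exact: le.
have iX n : e n \is a fin_num -> P.-integrable A (EFin \o (f \o X)).
  move=> en; have [i1n _] := i1 n en; have [sn _] := simple_functional mA (ss n).
  rewrite (_ : EFin \o _ = (EFin \o (f \o (fun w => X w - s n w)%R)) \+
      (EFin \o (f \o s n)))%E; first exact: integrableD.
  by apply/funext => w /=; rewrite (bounded_linearB bf) -EFinD subrK.
have [n0 en0] : exists n, e n \is a fin_num.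
  by case: efin => n _ h; exists n; apply: h => /=.
have iXA := iX n0 en0; split => //.
have Ifin : (\int[P]_(w in A) (f (X w))%:E)%E \is a fin_num.
  exact: integral_fune_fin_num iXA.
pose a := fine (\int[P]_(w in A) (f (X w))%:E)%E.
have aE : (\int[P]_(w in A) (f (X w))%:E)%E = a%:E by rewrite fineK.
rewrite aE; congr EFin.
pose b n := f (simple_integral P A (s n)).
have bv : b n @[n --> \oo] --> f v.
  apply: (cvg_comp _ _ sv); exact: (continuous_bounded_linear bf).
apply: (@cvg_unique _ _ (b n @[n --> \oo])) => //.
apply/cvgrPdist_le => r r0.
have rC : 0 < r / (`|C| + 1) by rewrite divr_gt0.
have fe0r := proj1 (cvgrPdist_lt _ _) fe0 _ rC.
near=> n.
have en : e n \is a fin_num by near: n.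
have : `|0 - fine (e n)| < r / (`|C| + 1) by near: n; exact: fe0r.
rewrite sub0r normrN => enr.
have [i1n i2n] := i1 n en; have [sn snE] := simple_functional mA (ss n).
have : (\int[P]_(w in A) (f (X w - s n w))%:E = (a - b n)%:E)%E.
  under eq_integral do rewrite (bounded_linearB bf) EFinB.
  by rewrite integralB// aE snE.
move=> E1; move: i2n; rewrite E1 abse_EFin -(fineK en) -EFinM lee_fin => h.
apply: (le_trans h); rewrite mulrC -ler_pdivlMr//.
by rewrite (le_trans (ler_norm _))// ltW.
Unshelve. all: by end_near.
Qed.

End bochner_functional.

Section degenerate.
Context d d' (T : measurableType d) (S : measurableType d') (R : realType).
Context (P : probability T R) (xi : nat -> {RV P >-> S}) (m : nat).
Context (mu : probability S R) (rho : probability (m.-tuple S) R).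
Local Notation X := (xi_tuple xi (initial m)).
Hypothesis rhoE : forall A, rho A = P (X @^-1` A).
Hypothesis rhoi : forall f : m.-tuple S -> \bar R, measurable_fun setT f ->
  (forall x, 0 <= f x)%E -> (\int[rho]_x f x = \int[P]_w f (X w))%E.
Hypothesis rhoP : is_power mu rho.
Context (B : normedModType R) (sepB : separable_space B).
Variable h : m.-tuple S -> B.
Hypothesis mh : measurable_fun setT (h : m.-tuple S -> borel B).
Hypothesis dh : degenerated P xi h.

Let J (l : 'I_m) : {set 'I_m} := (~: [set l])%SET.

Lemma averaged_out_upd (l : 'I_m) (F : m.-tuple S -> \bar R) y :
  measurable_fun setT F -> (forall y, 0 <= F y)%E ->
  averaged_out rho (J l) F y = (\int[mu]_s F (upd y l s))%E.
Proof.
move=> mF F0; rewrite /averaged_out (rhoP l).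
- have E z s : mix (keep (J l)) y (upd z l s) = upd y l s.
    apply: eq_from_tnth => j; rewrite tnth_mix /keep !inE !tnth_upd.
    by case: eqP.
  rewrite (_ : (fun z => _) = cst (\int[mu]_s F (upd y l s))%E).
    exact: probability_integral_cst.
  by apply/funext => z; apply: eq_integral => s _; rewrite E.
- apply: (measurable_fun_comp2 (g := fun y z => F (mix (keep (J l)) y z))) => //.
  exact: (measurable_fun_comp mF (@measurable_mix _ S _ m (keep (J l)))).
- by [].
Qed.

(** The positive and negative parts of [f \o h] have equal integrals over every set that depends on
    the coordinates other than [l]. Their averages over coordinate [l] depend on these coordinates
    only, hence agree almost everywhere. *)
Lemma degenerated_functional (f : B -> R) (l : 'I_m) : bounded_linear f ->
  {ae rho, forall x,
    mu.-integrable setT (EFin \o (f \o (fun s => h (upd x l s)))) /\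
    (\int[mu]_s (f (h (upd x l s)))%:E = 0)%E}.
Proof.
move=> bf.
pose g := EFin \o (f \o h).
have mg : measurable_fun setT g.
  by apply/measurable_EFinP; exact: (borel_wmeasurable mh).
have zero A : sigma_xi xi (J l) A -> P.-integrable A (g \o X) /\
    (\int[P]_(w in A) g (X w) = 0)%E.
  move=> GA; have mA := sigma_xi_measurable GA.
  have [_ /(_ A GA)[v [hv v0]]] := dh l.
  have [i1 ->] := bochner_functional sepB bf mA hv.
  split => //; have [_ <-] := bochner_functional sepB bf mA v0.
  under eq_integral do rewrite /cst (bounded_linear0 bf).
  by rewrite integral0.
pose Gp := averaged_out rho (J l) (g ^\+)%E.
pose Gn := averaged_out rho (J l) (g ^\-)%E.
have mgp : measurable_fun setT (g ^\+)%E by exact: measurable_funepos.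
have mgn : measurable_fun setT (g ^\-)%E by exact: measurable_funeneg.
have gp0 y : (0 <= (g ^\+) y)%E by exact: funepos_ge0.
have gn0 y : (0 <= (g ^\-) y)%E by exact: funeneg_ge0.
have mGp : measurable_fun setT Gp by exact: measurable_averaged_out.
have mGn : measurable_fun setT Gn by exact: measurable_averaged_out.
have Gp0 y : (0 <= Gp y)%E by exact: averaged_out_ge0.
have Gn0 y : (0 <= Gn y)%E by exact: averaged_out_ge0.
have rho_int A' (F : m.-tuple S -> \bar R) : measurable A' ->
    measurable_fun setT F -> (forall y, 0 <= F y)%E ->
    (\int[rho]_(y in A') F y = \int[P]_(w in X @^-1` A') F (X w))%E.
  move=> mA' mF F0; rewrite (integral_depends_on rhoi)// integral_mkcond.
  by apply: eq_integral => y _; rewrite epatch_indic/= indicE.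
have same A' : depends_on (J l) A' ->
    (\int[rho]_(y in A') Gp y = \int[rho]_(y in A') Gn y)%E.
  move=> dA'; have mA' := proj1 dA'.
  have GA : sigma_xi xi (J l) (X @^-1` A') by exact: depends_on_sigma_xi.
  have -> : (\int[rho]_(y in A') Gp y =
      \int[P]_(w in X @^-1` A') ((g \o X)^\+ w))%E.
    rewrite rho_int//; apply: esym.
    apply: etrans (integral_averaged_out rhoi rhoP mgp gp0 GA).
    by apply: eq_integral => w _; rewrite !funeposE.
  have -> : (\int[rho]_(y in A') Gn y =
      \int[P]_(w in X @^-1` A') ((g \o X)^\- w))%E.
    rewrite rho_int//; apply: esym.
    apply: etrans (integral_averaged_out rhoi rhoP mgn gn0 GA).
    by apply: eq_integral => w _; rewrite !funenegE.
  have [i1 z1] := zero _ GA.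
  have mA := sigma_xi_measurable GA.
  have fp := integrable_pos_fin_num mA i1; have fn := integrable_neg_fin_num mA i1.
  have : (\int[P]_(w in X @^-1` A') (g \o X)^\+ w -
      \int[P]_(w in X @^-1` A') (g \o X)^\- w = 0)%E.
    by rewrite -integralE.
  rewrite -(fineK fp) -(fineK fn) -EFinB => -[] /eqP; rewrite subr_eq0 => /eqP e.
  by rewrite -(fineK fp) -(fineK fn) e.
have dep (F1 F2 : m.-tuple S -> \bar R) r s : measurable_fun setT (averaged_out rho (J l) F1) ->
    measurable_fun setT (averaged_out rho (J l) F2) ->
    depends_on (J l) ([set w | (averaged_out rho (J l) F1 w < r)%E] `&`
      [set w | (s < averaged_out rho (J l) F2 w)%E]).
  move=> m1 m2; split.
    apply: measurableI; rewrite -[X in measurable X]setTI.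
      exact: emeasurable_fun_infty_o.
    exact: emeasurable_fun_o_infty.
  by move=> y z; rewrite /setI /mkset !averaged_out_mix.
have le1 : {ae rho, forall y, (Gn y <= Gp y)%E}.
  by apply: ae_le_of_integral_eq => // r s; apply: same; exact: dep.
have le2 : {ae rho, forall y, (Gp y <= Gn y)%E}.
  by apply: ae_le_of_integral_eq => // r s; apply/esym/same; exact: dep.
have GT : sigma_xi xi (J l) setT.
  rewrite -(preimage_setT X); apply: depends_on_sigma_xi.
  by split; first exact: measurableT.
(* Equal averages cancel only where they are finite; [g] is integrable, so the average of its
   absolute value is finite almost everywhere. *)
pose Ga := averaged_out rho (J l) (abse \o g).
have mabs : measurable_fun setT (abse \o g) by exact: measurableT_comp.
have abs0 y : (0 <= (abse \o g) y)%E by exact: abse_ge0.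
have mGa : measurable_fun setT Ga by exact: measurable_averaged_out.
have iGa : rho.-integrable setT Ga.
  apply/integrableP; split => //.
  have Ga0 y : (0 <= Ga y)%E by exact: averaged_out_ge0.
  under eq_integral do rewrite gee0_abs//.
  rewrite rho_int// preimage_setT -(integral_averaged_out rhoi rhoP)//.
  by have [/integrableP[]] := zero _ GT.
have fin := integrable_ae measurableT iGa.
apply: filterS3 le1 le2 fin => y l1 l2 /(_ Logic.I) fa.
have mgu : measurable_fun setT (EFin \o (f \o (fun s => h (upd y l s)))).
  apply/measurable_EFinP.
  apply: (measurable_fun_comp (g := f \o h) (a := fun s => upd y l s)).
    exact: (borel_wmeasurable mh).
  apply: (measurable_fun_comp2 (g := fun x s => upd x l s)); measurable_proj.
  exact: measurable_upd.
split.
  apply/integrableP; split => //.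
  have := fa; rewrite /Ga averaged_out_upd// ge0_fin_numE//.
  by apply: integral_ge0 => s _.
have Geq : Gp y = Gn y by apply/eqP; rewrite eq_le l1 l2.
rewrite integralE.
have EP : (\int[mu]_s ((fun s => (f (h (upd y l s)))%:E)^\+ s) = Gp y)%E.
  rewrite /Gp averaged_out_upd//.
  by apply: eq_integral => s _; rewrite !funeposE.
have EN : (\int[mu]_s ((fun s => (f (h (upd y l s)))%:E)^\- s) = Gn y)%E.
  rewrite /Gn averaged_out_upd//.
  by apply: eq_integral => s _; rewrite !funenegE.
rewrite EP EN Geq subee//.
have : (Gn y <= Ga y)%E.
  apply: (ge0_le_integral _ measurableT).
  - by [].
  - apply: (measurable_fun_comp2 (g := fun y z => (g ^\-)%E (mix (keep (J l)) y z))) => //.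
    exact: (measurable_fun_comp mgn (@measurable_mix _ S _ m (keep (J l)))).
  - apply: (measurable_fun_comp2 (g := fun y z => (abse \o g) (mix (keep (J l)) y z))) => //.
    exact: (measurable_fun_comp mabs (@measurable_mix _ S _ m (keep (J l)))).
  - by move=> z _; rewrite (fune_abse g) leeDr.
rewrite ge0_fin_numE// => /le_lt_trans; apply.
by rewrite -ge0_fin_numE//; exact: averaged_out_ge0.
Qed.

Lemma degenerated_mean_zero (f : nat -> B -> R) (l : 'I_m) :
  (forall k, bounded_linear (f k)) ->
  {ae rho, forall x, mean_zero mu f (fun s => h (upd x l s))}.
Proof.
by move=> bf; apply/ae_foralln => k; exact: degenerated_functional.
Qed.

End degenerate.

(** * Tail integrals and multi-indices *)

Lemma fsbig_image_pred (R : Type) (idx : R) (op : Monoid.com_law idx)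
    (I : finType) (K : choiceType) (g : I -> K) (Q : pred I) (A : set K)
    (F : K -> R) :
  {in Q &, injective g} -> (forall i, Q i -> A (g i)) ->
  (forall j, A j -> exists2 i, Q i & g i = j) ->
  \big[op/idx]_(j \in A) F j = \big[op/idx]_(i | Q i) F (g i).
Proof.
move=> ginj QA AQ.
have AE : A = [set` [seq g i | i <- enum Q]].
  apply/seteqP; split => [j /AQ[i Qi <-]|j /= /mapP[i]].
    by apply/mapP; exists i; rewrite ?mem_enum.
  by rewrite mem_enum => Qi ->; exact: QA.
have fA : finite_set A by rewrite AE; exact: finite_seq.
rewrite fsbig_finite// (perm_big [seq g i | i <- enum Q]).
  by rewrite big_map big_enum.
apply: uniq_perm; first exact: fset_uniq.
  rewrite map_inj_in_uniq ?enum_uniq// => i i'; rewrite !mem_enum; exact: ginj.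
move=> j; rewrite in_fset_set// AE.
by apply/idP/idP; rewrite inE.
Qed.

Lemma measure_le_ae d (T : measurableType d) (R : realType)
    (P : probability T R) (A A' : set T) :
  measurable A -> measurable A' -> {ae P, forall w, A w -> A' w} ->
  (P A <= P A')%E.
Proof.
move=> mA mA' [E [mE E0 sE]].
rewrite -(measureU0 mA' mE E0); apply: le_measure; rewrite ?inE//.
  exact: measurableU.
move=> w Aw; have [A'w|nA'w] := pselect (A' w); first by left.
by right; apply: sE => /= /(_ Aw).
Qed.

Lemma exists_geometric_small (R : realType) (e : R) : 0 < e ->
  exists i : nat, 64 ^- i <= e.
Proof.
move=> e0.
have : geometric 1 (64^-1 : R) @ \oo --> (0 : R).
  by apply: cvg_geometric; rewrite ger0_norm ?invr_ge0// invf_lt1// ltr1n.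
move=> /cvgrPdist_lt/(_ _ e0)[i _ h].
exists i; have := h i (leqnn i); rewrite /= mul1r sub0r normrN.
by rewrite ger0_norm ?exprn_ge0 ?invr_ge0// exprVn => /ltW.
Qed.

Section levels.
Context (R : realType).

(** On the shell from [theta ^+ j.+1] to [theta ^+ j], [1 - theta] is the relative length, and the
    minimum bounds [(u / theta ^+ j) ^ (q - 1)] from below for either sign of [q - 1]. *)
Definition tail_constant (q theta : R) : R :=
  (1 - theta) * Num.min 1 (theta `^ (q - 1)).

Lemma tail_constant_gt0 (q theta : R) : 0 < theta -> theta < 1 ->
  0 < tail_constant q theta.
Proof.
by move=> t0 t1; rewrite mulr_gt0 ?subr_gt0// lt_min ltr01 powR_gt0.
Qed.

Lemma powR_lt1 (x a : R) : 0 <= x -> x < 1 -> 0 < a -> x `^ a < 1.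
Proof.
move=> x0 x1 a0; rewrite -[ltRHS](_ : 1 `^ a = 1); last by rewrite powR1.
by apply: gt0_ltr_powR; rewrite ?nnegrE.
Qed.

Lemma powRN_lt1 (x a : R) : 1 < x -> 0 < a -> x `^ (- a) < 1.
Proof.
move=> x1 a0; have x0 : 0 < x by exact: lt_trans x1.
rewrite powRN -powR_inv1 ?powR_ge0// -powRrM mulrN1 -mulN1r powRrM powR_inv1 ?ltW//.
by apply: powR_lt1; rewrite ?invr_ge0 ?invf_lt1 ?ltW.
Qed.

Lemma powR_min (q theta u : R) : 0 < theta -> theta <= u -> u <= 1 ->
  Num.min 1 (theta `^ (q - 1)) <= u `^ (q - 1).
Proof.
move=> t0 tu u1; have u0 : 0 < u by exact: lt_le_trans tu.
have [q1|q1] := leP 0 (q - 1).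
  rewrite ge_min; apply/orP; right.
  by apply: ge0_ler_powR => //; rewrite nnegrE ltW.
rewrite ge_min; apply/orP; left.
rewrite -(opprK (q - 1)) powRN invf_ge1 ?powR_gt0//.
rewrite -[leRHS](_ : 1 `^ (- (q - 1)) = 1); last by rewrite powR1.
 apply: ge0_ler_powR => //.
- by rewrite oppr_ge0 ltW.
- by rewrite nnegrE ltW.
- by rewrite nnegrE.
Qed.

(** The shells between consecutive powers of [theta] are disjoint in [0, 1], and on each of them [D]
    is at least its value at the right end. *)
Lemma tail_integral (q theta : R) (D : R -> \bar R) :
  0 < theta -> theta < 1 -> measurable_fun setT D ->
  (forall u, 0 <= D u)%E -> (forall u v, u <= v -> (D v <= D u)%E) ->
  ((tail_constant q theta)%:E *
    \sum_(0 <= j <oo) ((theta `^ q) ^+ j)%:E * D (theta ^+ j)%R <=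
   \int[lebesgue_measure]_(u in `[0%R, 1%R]) ((u `^ (q - 1))%:E * D u))%E.
Proof.
move=> t0 t1 mD D0 Dle.
set eta := Num.min 1 (theta `^ (q - 1)).
have eta0 : 0 <= eta by rewrite le_min ler01 powR_ge0.
have K0 : 0 <= tail_constant q theta by rewrite mulr_ge0// subr_ge0 ltW.
have tj j : 0 < theta ^+ j by rewrite exprn_gt0.
have tjS j : theta ^+ j.+1 <= theta ^+ j.
  by rewrite exprS ler_piMl// ltW.
pose F u := ((u `^ (q - 1))%:E * D u)%E.
have mF (A : set R) : measurable_fun A F.
  apply: measurable_funTS; apply: emeasurable_funM => //.
  by apply/measurable_EFinP; exact: measurable_powR.
have F0 u : (0 <= F u)%E by rewrite mule_ge0// lee_fin powR_ge0.
have T0 j : (0 <= ((theta `^ q) ^+ j)%:E * D (theta ^+ j)%R)%E.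
  by rewrite mule_ge0// lee_fin exprn_ge0// powR_ge0.
rewrite -nneseriesZl//; apply: lime_le.
  by apply: is_cvg_nneseries => j _ _; rewrite mule_ge0.
apply: nearW => n.
suff : (\sum_(0 <= j < n) (tail_constant q theta)%:E *
    (((theta `^ q) ^+ j)%:E * D (theta ^+ j)%R) <=
    \int[lebesgue_measure]_(u in `](theta ^+ n)%R, 1%R]) F u)%E.
  move=> /le_trans; apply; apply: ge0_subset_integral => //.
  - exact: mF.
  by move=> u /=; rewrite !in_itv/= => /andP[/ltW h ->]; rewrite (le_trans _ h)// ltW.
elim: n => [|n IH].
  by rewrite big_geq//; apply: integral_ge0.
rewrite big_nat_recr//=.
have tn1 : theta ^+ n <= 1 by rewrite exprn_ile1// ltW.
have -> : `](theta ^+ n.+1), 1%R]%classic =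
    `](theta ^+ n.+1), (theta ^+ n)]%classic `|` `](theta ^+ n), 1%R]%classic :> set R.
  by rewrite -itv_bndbnd_setU// bnd_simp.
have dI : [disjoint (`](theta ^+ n.+1), (theta ^+ n)]%classic : set R) &
    (`](theta ^+ n), 1%R]%classic : set R)].
  rewrite disj_set2E; apply/eqP/seteqP; split => // u [] /=; rewrite !in_itv/=.
  by move=> /andP[_ h1] /andP[h2 _]; have := lt_le_trans h2 h1; rewrite ltxx.
have /= -> := ge0_integral_setU (lebesgue_measure : measure _ R) (measurable_itv _) (measurable_itv _) (mF _) (fun u _ => F0 u) dI.
rewrite [leLHS]addeC leeD//.
have mI : measurable (`](theta ^+ n.+1), (theta ^+ n)]%classic : set R) by [].
apply: (@le_trans _ _ (\int[lebesgue_measure]_(u in `](theta ^+ n.+1)%R, (theta ^+ n)%R])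
    (cst (((theta ^+ n) `^ (q - 1) * eta)%:E * D (theta ^+ n)%R)%E u))%E).
  rewrite integral_cst// [X in (_ <= _ * X)%E](lebesgue_measure_itv (`](theta ^+ n.+1), (theta ^+ n)]))/= lte_fin.
  have -> : theta ^+ n.+1 < theta ^+ n by rewrite exprS gtr_pMl.
  rewrite -EFinB muleAC -EFinM muleA -EFinM le_eqVlt; apply/orP; left; apply/eqP.
  congr (_%:E * _)%E; rewrite /tail_constant -/eta.
  have -> : (theta `^ q) ^+ n = (theta ^+ n) `^ (q - 1) * theta ^+ n.
    rewrite -[X in _ * X](powRr1 (ltW (tj n))) -powRD; last first.
      by rewrite (gt_eqF (tj n)) implybT.
    rewrite subrK -(powR_mulrn n (powR_ge0 theta q)) -(powR_mulrn n (ltW t0)).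
    by rewrite -!powRrM (mulrC q).
  by rewrite exprS; ring.
apply: (@ge0_le_integral _ _ _ (lebesgue_measure : measure _ R) _ mI).
- by move=> u _; rewrite mule_ge0// lee_fin mulr_ge0// powR_ge0.
- exact: measurable_cst.
- exact: mF.
- move=> u /=; rewrite in_itv/= => /andP[/ltW u1 u2].
  have u0 : 0 <= u by rewrite (le_trans _ u1)// ltW.
  apply: lee_pmul => //.
  + by rewrite lee_fin mulr_ge0// powR_ge0.
  + rewrite lee_fin -(@divfK _ (theta ^+ n) _ u) ?gt_eqF//.
    rewrite mulrC [leRHS]powRM ?divr_ge0// ?(ltW (tj n))//.
    rewrite ler_wpM2r ?powR_ge0//.
    apply: powR_min => //; first by rewrite ler_pdivlMr// -exprS.
    by rewrite ler_pdivrMr// mul1r.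
  + exact: Dle.
Qed.

(** Terms vanish as long as the level is at least [g]. From the first level [L0 / 64 ^+ j0 < g] on,
    the series is at most geometric, with leading weight
    [w ^+ j0 = (64 ^- j0)^k0 <= (g / L0)^k0]. *)
Lemma Psi_const (k0 L0 : R) (g : \bar R) (E : R -> \bar R) :
  let w := 64 `^ (- k0) in
  0 < k0 -> 0 < L0 -> (0 <= g)%E -> (forall y, 0 <= E y)%E ->
  (forall y, E y <= 1)%E -> (forall y, (g <= y%:E)%E -> E y = 0%E) ->
  (Psi w L0 E <= ((1 - w)^-1 * L0 `^ (- k0))%:E * g `^ k0)%E.
Proof.
move=> w k00 L00 g0 E0 E1 Eg.
have w0 : 0 < w by rewrite powR_gt0.
have w1 : w < 1 by apply: powRN_lt1; rewrite ?ltr1n.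
have C0 : 0 < (1 - w)^-1 * L0 `^ (- k0) by rewrite mulr_gt0 ?powR_gt0// invr_gt0 subr_gt0.
case: g g0 Eg => [v|_ _|//]; last first.
  by rewrite poweRyr ?gt_eqF// gt0_muley ?lte_fin// leey.
rewrite lee_fin => v0 Eg.
have lev0 j : 0 < L0 / 64 ^+ j by rewrite divr_gt0// exprn_gt0.
have [vE|vn0] := eqVneq v 0.
  rewrite /Psi eseries0 ?mule_ge0// ?lee_fin ?(ltW C0)// ?powR_ge0//.
  by move=> j _ _; rewrite Eg ?mule0// lee_fin vE ltW.
have {v0}v0 : 0 < v by rewrite lt_neqAle eq_sym vn0.
have exj : exists j, L0 / 64 ^+ j < v.
  have [i hi] := @exists_geometric_small R (v / L0 / 2) ltac:(by rewrite !divr_gt0).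
  exists i; have := ler_wpM2l (ltW L00) hi.
  have -> : L0 * (v / L0 / 2) = v / 2 by field; rewrite gt_eqF.
  by move=> /le_lt_trans; apply; rewrite ltr_pdivrMr// ltr_pMr// ltr1n.
case: (ex_minnP exj) => j0 j0v j0min.
have T0 j : (0 <= (w ^+ j)%:E * E (L0 / 64 ^+ j)%R)%E.
  by rewrite mule_ge0// lee_fin exprn_ge0// ltW.
have -> : Psi w L0 E = ((w ^+ j0)%:E * Psi w (L0 / 64 ^+ j0) E)%E.
  rewrite /Psi.
  have -> := @nneseries_split R (fun j => (w ^+ j)%:E * E (L0 / 64 ^+ j)%R)%E 0 j0
    (fun k _ => T0 k).
  rewrite add0n big_nat_cond big1 ?add0e; last first.
    move=> j; rewrite andbT => /andP[_ jj0]; rewrite Eg ?mule0// lee_fin leNgt.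
    by apply/negP => /j0min; rewrite leqNgt jj0.
  rewrite -(nneseries_addn (f := fun j => (w ^+ j)%:E * E (L0 / 64 ^+ j)%R)%E)//.
  rewrite -nneseriesZl; last first.
    by move=> j _; rewrite mule_ge0// lee_fin exprn_ge0// ltW.
  apply: eq_eseriesr => j _; rewrite muleA -EFinM addnC exprD; congr (_ * E _)%E.
  by rewrite exprD invfM mulrA.
apply: (@le_trans _ _ ((w ^+ j0)%:E * ((1 - w)^-1)%:E)%E).
  apply: lee_wpmul2l; first by rewrite lee_fin exprn_ge0// ltW.
  exact: Psi_le_geometric.
rewrite poweR_EFin -!EFinM lee_fin mulrC -mulrA ler_wpM2l ?invr_ge0 ?subr_ge0 ?(ltW w1)//.
have -> : w ^+ j0 = (64 ^+ j0)^-1 `^ k0.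
  have c0 : 0 <= (64 : R) ^+ j0 by exact: exprn_ge0.
  rewrite -(powR_mulrn j0 (ltW w0)) -(powR_inv1 c0) -(powR_mulrn j0 (ler0n R 64)).
  by rewrite /w -!powRrM; congr (_ `^ _); ring.
rewrite powRN ler_pdivlMl ?powR_gt0// -powRM ?invr_ge0 ?exprn_ge0 ?(ltW L00)//.
by apply: ge0_ler_powR; rewrite ?nnegrE ?(ltW k00) ?(ltW v0)// ltW.
Qed.

End levels.

Lemma poweR_lt (R : realType) (p a : R) (z : \bar R) : 0 < p -> 0 <= a ->
  ((a `^ p)%:E < z)%E -> (a%:E < z `^ p^-1)%E.
Proof.
move=> p0 a0; case: z => [z| |//].
  rewrite poweR_EFin !lte_fin => az.
  rewrite -[ltLHS](powRr1 a0) -(divff (lt0r_neq0 p0)) powRrM.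
  apply: gt0_ltr_powR => //; rewrite ?invr_gt0 ?nnegrE ?powR_ge0//.
  by rewrite (le_trans _ (ltW az))// powR_ge0.
by rewrite poweRyr ?ltry// gt_eqF// invr_gt0.
Qed.

Lemma Psi_ge_first (R : realType) (w L0 : R) (E : R -> \bar R) : 0 <= w ->
  (forall y, 0 <= E y)%E -> (E L0 <= Psi w L0 E)%E.
Proof.
move=> w0 E0; have T0 k : (0 <= (w ^+ k)%:E * E (L0 / 64 ^+ k)%R)%E.
  by rewrite mule_ge0// lee_fin exprn_ge0.
rewrite /Psi (@nneseries_split R (fun j => (w ^+ j)%:E * E (L0 / 64 ^+ j)%R)%E 0 1).
  rewrite add0n big_nat1 expr0 mul1e expr0 divr1 leeDl//.
  by apply: nneseries_ge0.
by move=> k _; exact: T0.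
Qed.

(** The shift [i] leaves room for a constant factor between the compared variables, at the price
    [w ^- i]. *)
Lemma Psi_le_tail (R : realType) (q theta L0 : R) (i : nat) (E D : R -> \bar R) :
  0 < theta -> theta < 1 -> (forall y, 0 <= E y)%E ->
  measurable_fun setT D -> (forall u, 0 <= D u)%E ->
  (forall u v, u <= v -> (D v <= D u)%E) ->
  (forall j, (E (L0 / 64 ^+ j)%R <= D (theta ^+ (j + i))%R)%E) ->
  (Psi (theta `^ q) L0 E <=
   ((theta `^ q) ^- i / tail_constant q theta)%:E *
   \int[lebesgue_measure]_(u in `[0%R, 1%R]) ((u `^ (q - 1))%:E * D u))%E.
Proof.
move=> t0 t1 E0 mD D0 Dle ED.
set w := theta `^ q; have w0 : 0 < w by exact: powR_gt0.
have tc0 := tail_constant_gt0 q t0 t1.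
have wj j : (0 <= (w ^+ j)%:E)%E by rewrite lee_fin exprn_ge0// ltW.
have T0 j : (0 <= (w ^+ j)%:E * D (theta ^+ j)%R)%E by rewrite mule_ge0.
have wi0 : 0 <= w ^- i by rewrite invr_ge0 exprn_ge0// ltW.
have sumE : (\sum_(0 <= j <oo) (w ^+ j)%:E * D (theta ^+ (j + i))%R =
    (w ^- i)%:E * \sum_(0 <= j <oo) (w ^+ (j + i))%:E * D (theta ^+ (j + i))%R)%E.
  rewrite -nneseriesZl; last by move=> j _; exact: T0.
  apply: eq_eseriesr => j _; rewrite muleA -EFinM (exprD w) mulrCA mulVf ?mulr1//.
  by rewrite expf_neq0// gt_eqF.
apply: (@le_trans _ _ (\sum_(0 <= j <oo) (w ^+ j)%:E * D (theta ^+ (j + i))%R)%E).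
  apply: lee_nneseries => [j _ _|j _]; first by rewrite mule_ge0.
  exact: lee_wpmul2l.
rewrite sumE EFinM -muleA; apply: lee_wpmul2l; first by rewrite lee_fin.
apply: (@le_trans _ _ (\sum_(0 <= j <oo) (w ^+ j)%:E * D (theta ^+ j)%R)%E).
  rewrite (nneseries_addn (f := fun j => (w ^+ j)%:E * D (theta ^+ j)%R)%E)//.
  rewrite [leRHS](@nneseries_split R (fun j => (w ^+ j)%:E * D (theta ^+ j)%R)%E 0 i).
    rewrite add0n leeDr// sume_ge0//.
  by move=> k _; exact: T0.
rewrite -(@lee_pmul2l _ (tail_constant q theta)%:E)//.
rewrite muleA -EFinM divff ?gt_eqF// mul1e.
exact: tail_integral.
Qed.

Lemma integral_measure_set d (X : measurableType d) (R : realType)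
    (P : probability X R) (A : set X) : measurable A ->
  P A = (\int[P]_x (\1_A x)%:E)%E.
Proof. by move=> mA; rewrite integral_indic// setIT. Qed.

Definition select (S : Type) K m (t : 'I_m -> 'I_K) (x : K.-tuple S) : m.-tuple S :=
  [tuple tnth x (t j) | j < m].

Lemma measurable_select d (S : measurableType d) K m (t : 'I_m -> 'I_K) :
  measurable_fun setT (@select S K m t).
Proof.
apply/measurable_fun_tnthP => k.
rewrite (_ : _ \o _ = fun x : K.-tuple S => tnth x (t k)); first exact: measurable_tnth.
by apply/funext => x /=; rewrite tnth_mktuple.
Qed.

Lemma law_select d (S : measurableType d) (R : realType) K m
    (mu : probability S R) (lam : probability (K.-tuple S) R)
    (rho : probability (m.-tuple S) R) (t : 'I_m -> 'I_K) (A : set (m.-tuple S)) :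
  is_power mu lam -> is_power mu rho -> injective t -> measurable A ->
  lam (select t @^-1` A) = rho A.
Proof.
move=> lamP rhoP tinj mA.
have mtA : measurable (select t @^-1` A).
  by rewrite -[X in measurable X]setTI; exact: measurable_select.
have m1 : measurable_fun setT (fun x : m.-tuple S => (\1_A x)%:E : \bar R).
  exact/measurable_EFinP/measurable_indic.
have m10 (x : m.-tuple S) : (0 <= (\1_A x)%:E :> \bar R)%E.
  by rewrite lee_fin indicE.
have tinj' j j' i : Some (t j) = Some i -> Some (t j') = Some i -> j = j'.
  by move=> /Some_inj <- /Some_inj/tinj.
apply: etrans (integral_measure_set lam mtA) _.
apply: etrans _ (esym (integral_measure_set rho mA)).
rewrite -(integral_mix lamP rhoP tinj' m1 m10).
apply: eq_integral => x _.
have E z : mix (fun j => Some (t j)) x z = select t x.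
  by apply: eq_from_tnth => j; rewrite tnth_mix.
under eq_integral do rewrite E.
by rewrite probability_integral_cst.
Qed.

Section indices.
Context (m n : nat).
Implicit Types (a b c : {ffun 'I_m -> 'I_n}) (J : {set 'I_m}).

(* Multi-indices with entries in [{1, ..., n}], encoded by the predecessors of
   their entries. *)
Definition succ_index c : {ffun 'I_m -> nat} := [ffun j => (c j).+1].

Definition increasing c := [forall j : 'I_m, forall j' : 'I_m, (j < j')%N ==> (c j < c j')%N].

Lemma increasingP c :
  reflect (forall j j' : 'I_m, (j < j')%N -> (c j < c j')%N) (increasing c).
Proof.
apply: (iffP forallP) => [h j j' jj'|h j].
  by have /forallP/(_ j')/implyP := h j; apply.
by apply/forallP => j'; apply/implyP; exact: h.
Qed.

Lemma succ_index_inj : injective succ_index.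
Proof.
move=> c c' /ffunP h; apply/ffunP => j; apply/val_inj.
by have := h j; rewrite !ffunE => -[].
Qed.

Lemma Inc_succ_index c : increasing c -> Inc m (succ_index c).
Proof.
move=> /increasingP h; split=> [j|j j' jj']; first by rewrite ffunE.
by rewrite !ffunE ltnS; exact: h.
Qed.

Lemma Inc_upto_succ_index k c : increasing c -> (forall j, (c j < k)%N) ->
  Inc_upto m k (succ_index c).
Proof. by move=> ic ck; split; [exact: Inc_succ_index|move=> j; rewrite ffunE]. Qed.

Lemma succ_index_Inc_upto k c : Inc_upto m k (succ_index c) ->
  increasing c /\ forall j, (c j < k)%N.
Proof.
move=> [[_ h] hk]; split; last by move=> j; have := hk j; rewrite ffunE.
by apply/increasingP => j j' /h; rewrite !ffunE ltnS.
Qed.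

Lemma Inc_upto_is_succ_index k (i : {ffun 'I_m -> nat}) : (k <= n)%N -> Inc_upto m k i ->
  exists c, succ_index c = i.
Proof.
move=> kn [[i1 _] ik].
have ilt j : ((i j).-1 < n)%N by rewrite prednK ?i1//; exact: leq_trans (ik j) kn.
by exists [ffun j => Ordinal (ilt j)]; apply/ffunP => j; rewrite !ffunE/= prednK ?i1.
Qed.

Lemma big_Inc_upto (V : Type) (idx : V) (op : Monoid.com_law idx) k
    (F : {ffun 'I_m -> nat} -> V) : (k <= n)%N ->
  \big[op/idx]_(i \in Inc_upto m k) F i =
  \big[op/idx]_(c | increasing c && [forall j, (c j < k)%N]) F (succ_index c).
Proof.
move=> kn; apply: fsbig_image_pred.
- by move=> c c' _ _; exact: succ_index_inj.
- by move=> c /andP[ic /forallP ck]; exact: Inc_upto_succ_index.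
- move=> i Ii; have [c cE] := Inc_upto_is_succ_index kn Ii; exists c => //.
  move: Ii; rewrite -cE => /succ_index_Inc_upto[-> ck]; exact/forallP.
Qed.

Lemma big_Inc_upto_all (V : Type) (idx : V) (op : Monoid.com_law idx)
    (F : {ffun 'I_m -> nat} -> V) :
  \big[op/idx]_(i \in Inc_upto m n) F i =
  \big[op/idx]_(c | increasing c) F (succ_index c).
Proof.
rewrite big_Inc_upto//; apply: eq_bigl => c.
by rewrite (_ : [forall j, _]) ?andbT//; apply/forallP => j; exact: ltn_ord.
Qed.

Lemma increasing_lt_last c (j0 : 'I_m) k : m = j0.+1 -> increasing c ->
  [forall j, (c j < k)%N] = (c j0 < k)%N.
Proof.
move=> mE /increasingP ic; apply/forallP/idP => [//|cj0 j].
have [->//|/eqP jj0] := eqVneq j j0.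
apply: ltn_trans cj0; apply: ic; rewrite ltn_neqAle.
have := ltn_ord j; rewrite [X in (_ < X)%N -> _]mE ltnS => ->.
by rewrite andbT; apply/eqP => /val_inj.
Qed.

(** Actual entries are successors, so 0 marks the positions outside [J]; sums of two such functions
    realize the decomposition along [J] and its complement. *)
Definition restricted_index J c : {ffun 'I_m -> nat} :=
  [ffun j => if j \in J then (c j).+1 else 0%N].

Lemma restricted_index_supported J c : supported_on J (restricted_index J c).
Proof. by move=> j /negbTE jJ; rewrite ffunE jJ. Qed.

Lemma restricted_index_add J a b : agree (~: J)%SET a b ->
  (restricted_index J a + restricted_index (~: J)%SET b)%R = succ_index b.
Proof.
move=> /agreeP ab; apply/ffunP => j; rewrite !ffunE inE.
have := ab j; rewrite inE negbK; case: (j \in J) => /= h; last by [].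
by rewrite h// addr0.
Qed.

Lemma restricted_index_inj J a : {in agree J a &, injective (restricted_index J)}.
Proof.
move=> b b' /agreeP ab /agreeP ab' /ffunP h; apply/ffunP => j.
have [jJ|jJ] := boolP (j \in J); last by rewrite -ab// ab'.
by apply/val_inj; have := h j; rewrite !ffunE jJ => -[].
Qed.

Lemma big_complementary (V : Type) (idx : V) (op : Monoid.com_law idx) J a
    (F : {ffun 'I_m -> nat} -> V) :
  \big[op/idx]_(k \in [set k | supported_on (~: J)%SET k /\
      Inc_upto m n (restricted_index J a + k)%R]) F (restricted_index J a + k)%R =
  \big[op/idx]_(b | agree (~: J)%SET a b && increasing b) F (succ_index b).
Proof.
rewrite (@fsbig_image_pred _ _ op _ _ (restricted_index (~: J)%SET)
    (fun b => agree (~: J)%SET a b && increasing b)).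
- by apply: eq_bigr => b /andP[ab _]; rewrite restricted_index_add.
- move=> b b' /andP[ab _] /andP[ab' _]; exact: (restricted_index_inj ab ab').
- move=> b /andP[ab ib]; split; first exact: restricted_index_supported.
  by rewrite restricted_index_add//; apply: Inc_upto_succ_index.
- move=> k [kJ Ik]; have [b bE] := Inc_upto_is_succ_index (leqnn n) Ik.
  have ab : agree (~: J)%SET a b.
    apply/agreeP => j; rewrite inE negbK => jJ; apply/val_inj.
    have /ffunP/(_ j) := bE; rewrite !ffunE jJ (kJ j) ?inE ?jJ// addr0.
    by move=> [].
  exists b.
    by rewrite ab/=; move: Ik; rewrite -bE => /succ_index_Inc_upto[].
  apply/ffunP => j; have /ffunP/(_ j) := bE; rewrite !ffunE inE.
  have := kJ j; rewrite inE negbK.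
  by case: (j \in J) => /= [->//|_ ->]; rewrite add0r.
Qed.

(** The iteration only produces entries between 1 and [n] on [J]; nonnegativity allows summing over
    all of [supported_on J]. *)
Lemma sum_agree_le_esum (R : realType) J a (I : {ffun 'I_m -> nat} -> \bar R) :
  (forall k, 0 <= I k)%E ->
  (\sum_(a' | agree J a a') I (restricted_index J a') <=
   \esum_(k in supported_on J) I k)%E.
Proof.
move=> I0.
pose X := [set` [seq restricted_index J a' | a' <- enum (agree J a)]].
apply: esum_ge; exists X.
  split; first exact: finite_seq.
  by move=> k /= /mapP[a' _ ->]; exact: restricted_index_supported.
rewrite (@fsbig_image_pred _ _ _ _ _ (restricted_index J) (agree J a))//.
- exact: restricted_index_inj.
- by move=> a' aa'; apply/mapP; exists a'; rewrite ?mem_enum.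
- by move=> k /= /mapP[a']; rewrite mem_enum => aa' ->; exists a'.
Qed.

End indices.

(** * Maximal inequality *)

Lemma lt_bigmax_nat (R : realType) (t : R) (a b : nat) (F : nat -> R) : 0 <= t ->
  (t < \big[Num.max/0]_(a <= k < b) F k) <->
  exists2 k, (a <= k < b)%N & t < F k.
Proof.
move=> t0; split=> [tF|[k kab tk]].
  apply: contrapT => nF; move: tF; rewrite ltNge => /negP; apply.
  rewrite big_nat; apply: (big_ind (fun x => x <= t)) => // [x y xt yt|k kab].
    by rewrite ge_max xt.
  by rewrite leNgt; apply/negP => tk; apply: nF; exists k.
apply: (lt_le_trans tk); apply: le_bigmax_seq => //.
by rewrite mem_index_iota.
Qed.

Lemma measurable_tail d (T : measurableType d) (R : realType)
    (P : probability T R) (t : R) (V : T -> \bar R) : measurable_fun setT V ->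
  measurable_fun setT (fun u : R => P [set z | ((t * u)%:E < V z)%E]).
Proof.
move=> mV.
have mA : measurable [set uz : R * T | ((t * uz.1)%:E < V uz.2)%E].
  rewrite -[X in measurable X]setTI; apply: measurable_lte => //.
    apply/measurable_EFinP; apply: measurable_funM => //.
  by apply: (measurable_fun_comp mV); measurable_proj.
have := measurable_fun_xsection P mA.
congr (measurable_fun _ _); apply/funext => u /=; congr (P _).
by apply/seteqP; split => z; rewrite /xsection/= inE.
Qed.

Section assembly.
Context (R : realType) (B : normedModType R) (N : B -> R) (p C c Cn : R).
Context (f : nat -> B -> R).
Hypotheses (sepB : separable_space B) (eN : equivalent_norm N)
  (nf : norming N f) (p1 : 1 < p) (p2 : p <= 2) (C2 : two_point N p C).
Hypotheses (c0 : 0 < c) (Cn0 : 0 < Cn) (cN : forall x, c * `|x| <= N x <= Cn * `|x|).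
Context d d' (T : measurableType d) (S : measurableType d').
Context (P : probability T R) (xi : nat -> {RV P >-> S}) (m n : nat).
Context (mu : probability S R) (lam : probability ((m + n).-tuple S) R)
  (rho : probability (m.-tuple S) R) (rhon : probability (n.-tuple S) R).
Hypotheses (lamP : is_power mu lam) (rhoP : is_power mu rho)
  (rhonP : is_power mu rhon).
Local Notation X := (xi_tuple xi (initial m)).
Local Notation Xn := (xi_tuple xi (initial n)).
Hypothesis rhoE : forall A, rho A = P (X @^-1` A).
Hypothesis rhoi : forall g : m.-tuple S -> \bar R, measurable_fun setT g ->
  (forall x, 0 <= g x)%E -> (\int[rho]_x g x = \int[P]_w g (X w))%E.
Hypothesis rhonE : forall A, rhon A = P (Xn @^-1` A).
Variable h : {ffun 'I_m -> nat} -> m.-tuple S -> B.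
Hypothesis mh : forall i, Inc m i -> measurable_fun setT (h i : m.-tuple S -> borel B).
Hypothesis dh : forall i, Inc m i -> degenerated P xi (h i).
Variables (q t : R) (i i2 : nat).
Hypotheses (q0 : 0 < q) (t0 : 0 < t).
Implicit Types (a b e : {ffun 'I_m -> 'I_n}) (J : {set 'I_m}).

(** Levels are compared with [p]-th powers, so a ratio 64 of levels is a ratio [theta] of norms. The
    top level [L0] is [(c t)^p] because a norm above [t] forces [N] above [c * t]. *)
Local Notation theta := ((64 : R) `^ (- p^-1)).
Local Notation w := (theta `^ q).
Local Notation L0 := ((c * t) `^ p).
Hypothesis small : C * 64 ^- i / 8 <= w / 2.
Hypothesis i2_small : theta ^+ i2 <= c / Cn.

Let p0 : 0 < p. Proof. exact: lt_trans p1. Qed.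

Let theta0 : 0 < theta. Proof. exact: powR_gt0. Qed.

Let theta1 : theta < 1.
Proof. by apply: powRN_lt1; rewrite ?ltr1n ?invr_gt0. Qed.

Let w0 : 0 < w. Proof. exact: powR_gt0. Qed.

Let w1 : w < 1.
Proof. by apply: powR_lt1 => //; exact: ltW. Qed.

Let ct0 : 0 < c * t. Proof. exact: mulr_gt0. Qed.

Let L00 : 0 < L0. Proof. exact: powR_gt0. Qed.

Lemma level_powR j : L0 / 64 ^+ j = (c * t * theta ^+ j) `^ p.
Proof.
have tj : 0 <= theta ^+ j by rewrite exprn_ge0// ltW.
rewrite [RHS]powRM//; last exact: ltW.
congr (_ * _); have c64 : 0 <= (64 : R) ^+ j by exact: exprn_ge0.
rewrite -(powR_inv1 c64) -(powR_mulrn j (ler0n R 64)) -(powR_mulrn j (ltW theta0)).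
by rewrite -!powRrM; congr (_ `^ _); field; rewrite gt_eqF.
Qed.

(** Extension by 0 turns sums over increasing multi-indices into sums over the full finite type,
    where coordinates can be reset independently. *)
Definition supp_h e : m.-tuple S -> B := if increasing e then h (succ_index e) else cst 0.

Lemma supp_hE e : increasing e -> supp_h e = h (succ_index e).
Proof. by rewrite /supp_h => ->. Qed.

Lemma supp_hN e x : ~~ increasing e -> supp_h e x = 0.
Proof. by rewrite /supp_h => /negbTE ->. Qed.

Lemma wmeasurable_supp_h e : wmeasurable (supp_h e).
Proof.
rewrite /supp_h; case: ifPn => ie; last exact: wmeasurable_cst.
by apply: borel_wmeasurable; apply: mh; exact: Inc_succ_index.
Qed.

Lemma supp_h_inc e (j j' : 'I_m) x : (j < j')%N -> ~~ (e j < e j')%N ->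
  supp_h e x = 0.
Proof.
move=> jj' ejj'; apply: supp_hN; apply/negP => /increasingP/(_ _ _ jj') ejj.
by rewrite ejj in ejj'.
Qed.

Lemma supp_h_centered e j :
  {ae rho, forall x, mean_zero mu f (fun s => supp_h e (upd x j s))}.
Proof.
have [ie|ie] := boolP (increasing e).
  rewrite supp_hE//; have bf : forall k, bounded_linear (f k) by case: nf.
  have Ie := Inc_succ_index ie.
  exact: (degenerated_mean_zero rhoi rhoP sepB (mh Ie) (dh Ie) j bf).
apply: aeW => x; rewrite (_ : (fun s => _) = fun=> 0); first exact: (mean_zero_cst0 nf).
by apply/funext => s; exact: supp_hN.
Qed.

Section maximum.
Variables (j0 : 'I_m) (a0 : {ffun 'I_m -> 'I_n}).
Hypothesis mE : m = j0.+1.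

Definition select_sum k (x : n.-tuple S) : B :=
  \sum_(e : {ffun 'I_m -> 'I_n} | (e j0 < k)%N) supp_h e (select e x).

Lemma select_xi_tuple e z : select e (Xn z) = xi_tuple xi (succ_index e) z.
Proof.
apply: eq_from_tnth => j; rewrite [LHS]tnth_mktuple !tnth_mktuple !ffunE.
by [].
Qed.

Lemma sum_Inc_upto_select k z : (k <= n)%N ->
  \sum_(l \in Inc_upto m k) h l (xi_tuple xi l z) = select_sum k (Xn z).
Proof.
move=> kn.
rewrite (@big_Inc_upto m n _ _ _ k (fun l => h l (xi_tuple xi l z)) kn).
rewrite /select_sum [RHS](bigID (@increasing m n))/= [X in _ + X]big1 ?addr0; last first.
  by move=> e /andP[_ ie]; exact: supp_hN.
apply: eq_big => [e|e /andP[ie _]].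
  by rewrite andbC; case: (boolP (increasing e)) => ie; rewrite ?andbF// (increasing_lt_last _ mE ie).
by rewrite supp_hE// select_xi_tuple.
Qed.

Lemma wmeasurable_select_sum k : wmeasurable (select_sum k).
Proof.
apply: wmeasurable_sum => e _.
exact: (wmeasurable_comp (@measurable_select _ S n m e) (wmeasurable_supp_h e)).
Qed.

Definition max_event : set (n.-tuple S) :=
  \bigcup_(k in [set k | (m <= k < n.+1)%N]) [set x | t < `|select_sum k x|].

Lemma measurable_max_event : measurable max_event.
Proof.
apply: bigcup_measurable => k _.
have [g ng] := exists_norming sepB (equivalent_norm_norm B).
have mk := wmeasurable_norm ng (wmeasurable_select_sum k).
rewrite (_ : mkset _ = (Num.norm \o select_sum k) @^-1` `]t, +oo[); last first.
  by apply/seteqP; split => x /=; rewrite in_itv/= andbT.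
by rewrite -[X in measurable X]setTI; exact: mk.
Qed.

Lemma max_eventE : [set z | t < \big[Num.max/0]_(m <= k < n.+1)
    `|\sum_(l \in Inc_upto m k) h l (xi_tuple xi l z)|] = Xn @^-1` max_event.
Proof.
apply/seteqP; split => z /=.
  move=> /(lt_bigmax_nat _ _ _ (ltW t0))[k kn tk]; exists k => //=.
  by rewrite -sum_Inc_upto_select//; case/andP: kn.
move=> [k /= kn tk]; apply/(lt_bigmax_nat _ _ _ (ltW t0)); exists k => //.
by rewrite sum_Inc_upto_select//; case/andP: kn.
Qed.

Local Notation r0 := [seq b <- index_enum {ffun 'I_m -> 'I_n} |
  agree (averaged j0.+1 finset.set0) a0 b].

(** With [J] empty and all positions summed, nothing is frozen or averaged: the layers add up to the
    partial sums read in the last [n] coordinates. *)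
Lemma max_event_exceeds x : max_event (select (@rshift m n) x) ->
  exceeds N p rho r0 (layer supp_h j0 finset.set0) n L0 x.
Proof.
move=> [k /= /andP[_ kn] tk]; exists k => //.
have E z : partial (layer supp_h j0 finset.set0) k x a0 z =
    select_sum k (select (@rshift m n) x).
  rewrite /partial /select_sum /layer; case: k kn {tk} => [|k] kn.
    by rewrite big_ord0 big_pred0// => e; rewrite ltn0.
  (* Partition by the last entry; [inord] needs a successor, whence the separate case of an empty
     sum. *)
  rewrite [RHS](partition_big (fun e : {ffun 'I_m -> 'I_n} => inord (e j0) : 'I_k.+1)
    xpredT)//=.
  apply: eq_bigr => l _; apply: eq_big => [e|e _].
    have -> : agree (low m j0.+1) a0 e.
      by apply/agreeP => j; rewrite inE -mE ltn_ord.
    apply/idP/andP => /= [/eqP el|[ek /eqP <-]]; last by rewrite inordK.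
    by rewrite el ltn_ord; split => //; apply/eqP/val_inj; rewrite /= inordK.
  congr (supp_h _ _); apply: eq_from_tnth => j.
  by rewrite tnth_mix /source -mE ltn_ord [RHS]tnth_mktuple tnth_mktuple.
rewrite /Vp big_filter.
apply: (lt_le_trans _ (le_sume_term (i := a0) (F := fun b =>
   \int[rho]_z npow N p (partial (layer supp_h j0 finset.set0) k x b z))%E _ _)).
- under eq_integral do rewrite E.
  rewrite (probability_integral_cst rho) /npow lte_fin.
  apply: gt0_ltr_powR; rewrite ?nnegrE ?(ltW ct0)//.
    exact: norm_nonneg.
  by apply: lt_le_trans (proj1 (andP (cN _))); rewrite ltr_pM2l.
- by apply/agreeP.
- by move=> b _; apply: integral_ge0 => z _; exact: npow_ge0.
Qed.

Lemma max_le_PsiMax :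
  (P [set z | (t < \big[Num.max/0]_(m <= k < n.+1)
     `|\sum_(l \in Inc_upto m k) h l (xi_tuple xi l z)|)%R] <=
   PsiMax N p lam rho supp_h w L0 j0 finset.set0 a0)%E.
Proof.
rewrite max_eventE -rhonE.
rewrite -(law_select lamP rhonP (@rshift_inj m n) measurable_max_event).
apply: (@le_trans _ _ (lam (exceeds N p rho r0 (layer supp_h j0 finset.set0) n L0))).
  apply: le_measure; rewrite ?inE; last exact: max_event_exceeds.
    rewrite -[X in measurable X]setTI; apply: measurable_select => //.
    exact: measurable_max_event.
  apply: (measurable_exceeds p nf rho) => l b.
  exact: (wmeasurable_layer wmeasurable_supp_h).
exact: (Psi_ge_first L0 (E := fun y => lam (exceeds N p rho r0
  (layer supp_h j0 finset.set0) n y)) (ltW w0) (fun y => measure_ge0 _ _)).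
Qed.

End maximum.

Definition leaf J a (x : m.-tuple S) : \bar R :=
  (\sum_(b | agree (~: J)%SET a b) averaged_out rho J (npow N p \o supp_h b) x)%E.

Lemma W_leaf J a x : W N p rho supp_h 0 J a x = leaf J a (select (@lshift m n) x).
Proof.
apply: eq_big => [b|b _].
  by congr (agree _ _ _); apply/finset.setP => j; rewrite !inE.
apply: eq_integral => z _; congr (npow _ _ _); rewrite /inner (big_pred1 b).
  congr (supp_h _ _); apply: eq_from_tnth => j; rewrite !tnth_mix /source /keep ltn0.
  by case: ifP => // _; rewrite tnth_mktuple.
move=> e; apply/agreeP/eqP => [be|->//].
by apply/ffunP => j; rewrite be// inE.
Qed.

Lemma measurable_npow_supp_h b : measurable_fun setT (npow N p \o supp_h b).
Proof. exact: (measurable_npow p nf (wmeasurable_supp_h b)). Qed.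

Lemma measurable_leaf J a : measurable_fun setT (leaf J a).
Proof.
rewrite /leaf; under eq_fun do rewrite -big_filter.
apply: emeasurable_sum => b; apply: measurable_averaged_out.
  exact: measurable_npow_supp_h.
by move=> y; exact: npow_ge0.
Qed.

(** At stage 0 only the slots of frozen variables are read, and these [m] slots have the law of the
    first [m] variables, whichever indices were frozen. *)
Lemma PsiW_leaf J a : PsiW N p lam rho supp_h w L0 0 J a =
  Psi w L0 (fun y => P [set z | (y%:E < leaf J a (X z))%E]).
Proof.
rewrite /PsiW.
suff E (y : R) : lam [set x | (y%:E < W N p rho supp_h 0 J a x)%E] =
    P [set z | (y%:E < leaf J a (X z))%E].
  by rewrite /Psi; apply: eq_eseriesr => j _; rewrite E.
have mA : measurable [set x : m.-tuple S | (y%:E < leaf J a x)%E].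
  rewrite -[X in measurable X]setTI; apply: emeasurable_fun_o_infty => //.
  exact: measurable_leaf.
have -> : [set x | (y%:E < W N p rho supp_h 0 J a x)%E] =
    select (@lshift m n) @^-1` [set x | (y%:E < leaf J a x)%E].
  by apply/funext => x; rewrite /preimage /mkset W_leaf.
apply: etrans (law_select lamP rhoP (@lshift_inj m n) mA) _.
exact: rhoE.
Qed.

Local Notation K2 := (w ^- i2 / tail_constant q theta).

(** A leaf above [(c t theta^j)^p] means [Y^(1/p) > (c / Cn) t theta^j], and [theta ^+ i2 <= c / Cn]
    turns this into a tail at [t theta^(j + i2)]. *)
Lemma PsiW_le_tail J a (Y : T -> \bar R) : measurable_fun setT Y ->
  {ae P, forall z, (leaf J a (X z) <= (Cn `^ p)%:E * Y z)%E} ->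
  (PsiW N p lam rho supp_h w L0 0 J a <= K2%:E *
    \int[lebesgue_measure]_(u in `[0%R, 1%R])
      ((u `^ (q - 1))%:E * P [set z | (t * u)%:E < Y z `^ p^-1]))%E.
Proof.
move=> mY leafY.
have mY1 : measurable_fun setT (fun z => (Y z `^ p^-1)%E).
  exact: (measurable_fun_comp (@measurable_poweR R p^-1) mY).
have mV (v : \bar R) (g : T -> \bar R) : measurable_fun setT g ->
    measurable [set z | (v < g z)%E].
  by move=> mg; rewrite -[X in measurable X]setTI; exact: emeasurable_fun_o_infty.
rewrite PsiW_leaf.
apply: (@Psi_le_tail R q theta L0 i2 (fun y => P [set z | (y%:E < leaf J a (X z))%E])
  (fun u => P [set z | ((t * u)%:E < Y z `^ p^-1)%E])) => //.
- exact: measurable_tail.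
- move=> u v uv; apply: le_measure; rewrite ?inE; [exact: mV|exact: mV|].
  by move=> z /=; apply: le_lt_trans; rewrite lee_fin ler_pM2l.
- move=> j; apply: measure_le_ae.
  + apply: mV; exact: (measurable_fun_comp (measurable_leaf J a) (measurable_xi_tuple xi (n:=m))).
  + exact: mV.
  + apply: filterS leafY => z le /= lt; apply: poweR_lt => //.
      by rewrite mulr_ge0 ?exprn_ge0 ?(ltW theta0) ?(ltW t0).
    rewrite ltNge; apply/negP => Yle.
    have := lt_le_trans lt le; rewrite ltNge => /negP; apply.
    apply: (@le_trans _ _ ((Cn `^ p)%:E * ((t * theta ^+ (j + i2)) `^ p)%:E)%E).
      by apply: lee_wpmul2l => //; rewrite lee_fin powR_ge0.
    have tj m' : 0 <= theta ^+ m' by rewrite exprn_ge0// ltW.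
    rewrite -EFinM lee_fin level_powR -powRM ?(ltW Cn0) ?mulr_ge0 ?(ltW t0)//.
    apply: ge0_ler_powR; rewrite ?nnegrE ?(ltW p0) ?mulr_ge0 ?(ltW c0) ?(ltW Cn0) ?(ltW t0)//.
    have := i2_small; rewrite ler_pdivlMr// => hi.
    rewrite exprD (_ : Cn * _ = t * theta ^+ j * (theta ^+ i2 * Cn)); last by ring.
    rewrite (_ : c * t * _ = t * theta ^+ j * c); last by ring.
    by rewrite ler_wpM2l// mulr_ge0// ltW.
Qed.

Local Notation hp := (fun b x => (`|h (succ_index b) x| `^ p)%:E).

Lemma measurable_hp b : increasing b -> measurable_fun setT (hp b).
Proof.
move=> ib; have [g ng] := exists_norming sepB (equivalent_norm_norm B).
have wh : wmeasurable (h (succ_index b)).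
  by apply: borel_wmeasurable; apply: mh; exact: Inc_succ_index.
by have := measurable_npow p ng wh.
Qed.

Lemma hp_ge0 b x : (0 <= hp b x)%E.
Proof. by rewrite lee_fin powR_ge0. Qed.

Lemma npow_supp_h_le b x : (npow N p (supp_h b x) <=
  (Cn `^ p)%:E * (if increasing b then hp b x else 0))%E.
Proof.
case: ifPn => ib; last by rewrite supp_hN// npow0// mule0.
rewrite supp_hE// /npow -EFinM lee_fin -powRM ?(ltW Cn0)//.
apply: ge0_ler_powR; rewrite ?nnegrE ?(ltW p0)//.
- exact: norm_nonneg.
- by rewrite mulr_ge0 ?(ltW Cn0).
- by case/andP: (cN (h (succ_index b) x)).
Qed.

Lemma leaf_le J a x : (leaf J a x <= (Cn `^ p)%:E *
  \sum_(b | agree (~: J)%SET a b && increasing b) averaged_out rho J (hp b) x)%E.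
Proof.
have A0 b : (0 <= averaged_out rho J (hp b) x)%E.
  by apply: averaged_out_ge0 => y; exact: hp_ge0.
rewrite ge0_sume_distrr// big_mkcondr/=; apply: lee_sum => b _.
have mm : measurable_fun setT (fun z : m.-tuple S => mix (keep J) x z).
  exact: (measurable_fun_comp (@measurable_mix _ S _ m (keep J)) (measurable_pair1 x)).
case: ifPn => ib; last first.
  rewrite /averaged_out integral0_eq// => z _ /=.
  by rewrite supp_hN// npow0.
rewrite -ge0_integralZl//; last 2 first.
- exact: (measurable_fun_comp (measurable_hp ib) mm).
- by rewrite lee_fin powR_ge0.
apply: ge0_le_integral => //.
- by move=> z _; exact: npow_ge0.
- exact: (measurable_fun_comp (measurable_npow_supp_h b) mm).
- by apply: measurable_funeM; exact: (measurable_fun_comp (measurable_hp ib) mm).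
- by move=> z _; have := npow_supp_h_le b (mix (keep J) x z); rewrite ib.
Qed.

Lemma PsiW_full a : (PsiW N p lam rho supp_h w L0 0 [set: 'I_m]%SET a <=
  if increasing a then K2%:E * \int[lebesgue_measure]_(u in `[0%R, 1%R])
    ((u `^ (q - 1))%:E *
      P [set z | (t * u < `|h (succ_index a) (X z)|)%R]) else 0)%E.
Proof.
have agreea b : agree (~: [set: 'I_m])%SET a b = (a == b).
  apply/agreeP/eqP => [ab|->//]; apply/ffunP => j; apply: ab.
  by rewrite !inE.
have leafa z : (leaf [set: 'I_m]%SET a (X z) <=
    (Cn `^ p)%:E * (if increasing a then hp a (X z) else 0))%E.
  apply: (le_trans (leaf_le _ _ _)).
  rewrite big_mkcondr/= (big_pred1 a); last by move=> b; rewrite agreea eq_sym.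
  apply: lee_wpmul2l; first by rewrite lee_fin powR_ge0.
  case: ifP => // _; rewrite /averaged_out.
  have mixE y z' : mix (keep [set: 'I_m]%SET) y z' = y :> m.-tuple S.
    by apply: eq_from_tnth => j; rewrite tnth_mix /keep inE.
  under eq_integral do rewrite mixE.
  by rewrite (probability_integral_cst rho).
case: ifPn leafa => ia leafa.
  have mY := measurable_fun_comp (measurable_hp ia) (measurable_xi_tuple xi (n:=m)).
  have := PsiW_le_tail mY (aeW P leafa).
  move=> /le_trans; apply; rewrite le_eqVlt; apply/orP; left; apply/eqP.
  congr (_ * _)%E; apply: eq_integral => u _; congr (_ * P _)%E.
  apply/seteqP; split => z /=.
    by rewrite -powRrM divff ?gt_eqF// powRr1// lte_fin.
  by rewrite -powRrM divff ?gt_eqF// powRr1// lte_fin.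
have := @PsiW_le_tail [set: 'I_m]%SET a (cst 0%E) (measurable_cst _) (aeW P leafa).
move=> /le_trans; apply; rewrite integral0_eq ?mule0// => u /=.
rewrite in_itv/= => /andP[u0 _].
rewrite (_ : [set z | _] = set0) ?measure0 ?mule0//.
apply/seteqP; split => // z /=.
by rewrite powR0 ?gt_eqF ?invr_gt0// lte_fin ltNge mulr_ge0// ltW.
Qed.

Local Notation condexp J i := (ge0_cond_expectation P (sigma_xi xi J)
  (fun z => (`|h i (X z)| `^ p)%:E)).

Lemma measurable_condexp J b : increasing b ->
  measurable_fun setT (condexp J (succ_index b)).
Proof.
move=> ib.
have [_ mY _] := ge0_cond_expectationP rhoi rhoP J (measurable_hp ib) (hp_ge0 b).
move=> _ A mA; rewrite setTI; apply: sigma_xi_measurable; exact: mY.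
Qed.

Lemma PsiW_conditioned J a : (PsiW N p lam rho supp_h w L0 0 J a <= K2%:E *
  \int[lebesgue_measure]_(u in `[0%R, 1%R])
    ((u `^ (q - 1))%:E *
     P [set z | (t * u)%:E <
       (\sum_(k \in [set k | supported_on (~: J)%SET k /\
             Inc_upto m n (restricted_index J a + k)%R])
           condexp J (restricted_index J a + k)%R z) `^ p^-1]))%E.
Proof.
have sumE z : (\sum_(k \in [set k | supported_on (~: J)%SET k /\
        Inc_upto m n (restricted_index J a + k)%R])
      condexp J (restricted_index J a + k)%R z =
    \sum_(b | agree (~: J)%SET a b && increasing b) condexp J (succ_index b) z)%E.
  exact: (@big_complementary m n _ _ _ J a (fun i => condexp J i z)).
apply: PsiW_le_tail.
  rewrite (funext sumE); under eq_fun do rewrite big_mkcond/=.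
  apply: emeasurable_sum => b.
  case: (boolP (agree (~: J)%SET a b && increasing b)) => [/andP[_ ib]|_]; last exact: measurable_cst.
  exact: measurable_condexp.
have ce : {ae P, forall z, forall b, increasing b ->
    (averaged_out rho J (hp b) (X z) <= condexp J (succ_index b) z)%E}.
  apply: filter_forall => b; case: (boolP (increasing b)) => ib; last first.
    exact: aeW.
  apply: filterS (averaged_out_le_cond_expectation rhoi rhoP J (measurable_hp ib) (hp_ge0 b)).
  by move=> z le _; exact: le.
apply: filterS ce => z le; apply: (le_trans (leaf_le _ _ _)).
apply: lee_wpmul2l; first by rewrite lee_fin powR_ge0.
by rewrite sumE; apply: lee_sum => b /andP[_ ib]; exact: le.
Qed.

(** The leaf is at most a constant, [Cn^p] times the sum of the moments, so [Psi_const] applies with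
    exponent [q / p]; the powers of [c] and [t] come from [L0 = (c t)^p]. *)
Lemma PsiW_empty a : (PsiW N p lam rho supp_h w L0 0 finset.set0 a <=
  ((1 - w)^-1 * c `^ (- q) * Cn `^ q)%:E * (t `^ (- q))%:E *
  (\sum_(l \in Inc_upto m n)
     'E_P[fun z => (`|h l (X z)| `^ p)%R]) `^ (q / p))%E.
Proof.
set s := (\sum_(l \in _) _)%E.
have keep0 y z : mix (keep (finset.set0 : {set 'I_m})) y z = z :> m.-tuple S.
  by apply: eq_from_tnth => j; rewrite tnth_mix /keep inE.
have sE : s = (\sum_(b | increasing b) \int[rho]_z hp b z)%E.
  rewrite /s (@big_Inc_upto_all m n _ _ _ (fun l => 'E_P[fun z => (`|h l (X z)| `^ p)%R]%E)).
  apply: eq_bigr => b ib; rewrite unlock.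
  by rewrite (rhoi (measurable_hp ib) (hp_ge0 b)).
have s0 : (0 <= s)%E.
  by rewrite sE; apply: sume_ge0 => b _; apply: integral_ge0 => z _; exact: hp_ge0.
have leafs x : (leaf finset.set0 a x <= (Cn `^ p)%:E * s)%E.
  apply: (le_trans (leaf_le _ _ _)); apply: lee_wpmul2l; first by rewrite lee_fin powR_ge0.
  rewrite sE le_eqVlt; apply/orP; left; apply/eqP.
  apply: eq_big => [b|b _]; last first.
    by rewrite /averaged_out; apply: eq_integral => z _; rewrite keep0.
  rewrite (_ : agree _ _ _)//; apply/agreeP => j; rewrite finset.setC0 inE.
  by [].
rewrite PsiW_leaf.
have wE : w = 64 `^ (- (q / p)).
  by rewrite -powRrM; congr (_ `^ _); ring.
have k0 : 0 < q / p by rewrite divr_gt0.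
have g0 : (0 <= (Cn `^ p)%:E * s)%E by rewrite mule_ge0// lee_fin powR_ge0.
have := @Psi_const R (q / p) L0 ((Cn `^ p)%:E * s)%E
  (fun y => P [set z | (y%:E < leaf finset.set0 a (X z))%E]) k0 L00 g0
  (fun y => measure_ge0 _ _).
rewrite /= -wE => /(_ _ _)/le_trans; apply.
- move=> y; apply: probability_le1.
  rewrite -[X in measurable X]setTI; apply: emeasurable_fun_o_infty => //.
  exact: (measurable_fun_comp (measurable_leaf _ a) (measurable_xi_tuple xi (n:=m))).
- move=> y gy; rewrite (_ : [set z | _] = set0) ?measure0//.
  apply/seteqP; split => // z /=; apply/negP; rewrite -leNgt.
  exact: le_trans (leafs _) gy.
have qp (x : R) : 0 <= x -> (x `^ p) `^ (q / p) = x `^ q.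
  by move=> x0; rewrite -powRrM; congr (_ `^ _); field; rewrite gt_eqF.
rewrite poweRM ?lee_fin ?powR_ge0// poweR_EFin qp ?(ltW Cn0)//.
rewrite powRN qp ?(ltW ct0)// -powRN powRM ?(ltW c0) ?(ltW t0)//.
rewrite muleA -!EFinM le_eqVlt; apply/orP; left; apply/eqP.
by congr (_%:E * _)%E; ring.
Qed.

Local Notation I_full l := (\int[lebesgue_measure]_(u in `[0%R, 1%R])
  ((u `^ (q - 1))%:E * P [set z | (t * u < `|h l (X z)|)%R]))%E.

Local Notation I_cond J v := (\int[lebesgue_measure]_(u in `[0%R, 1%R])
  ((u `^ (q - 1))%:E * P [set z | (t * u)%:E <
     (\sum_(k \in [set k | supported_on (~: J)%SET k /\ Inc_upto m n (v + k)%R])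
        condexp J (v + k)%R z) `^ p^-1]))%E.

Local Notation K0 := ((1 - w)^-1 * c `^ (- q) * Cn `^ q).
(** The power comes from the [m] absorptions, [K2] from the comparison with tail integrals and [K0]
    from the deterministic term. *)
Local Notation K := ((2 * w ^- i.+1) ^+ m * (K2 + K0)).

Lemma maximal_inequality_weighted : (0 < m)%N -> (m <= n)%N ->
  (P [set z | (t < \big[Num.max/0]_(m <= k < n.+1)
     `|\sum_(l \in Inc_upto m k) h l (xi_tuple xi l z)|)%R] <=
   K%:E * (\sum_(l \in Inc_upto m n) I_full l) +
   K%:E * (\sum_(J : {set 'I_m} |
        (finset.set0 \proper J) && (J \proper [set: 'I_m]%SET))
        \esum_(v in supported_on J) I_cond J v) +
   K%:E * (t `^ (- q))%:E * (\sum_(l \in Inc_upto m n)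
     'E_P[fun z => (`|h l (X z)| `^ p)%R]) `^ (q / p))%E.
Proof.
move=> m0 mn.
have tc0 := tail_constant_gt0 q theta0 theta1.
have K20 : 0 <= K2 by rewrite divr_ge0 ?invr_ge0 ?exprn_ge0 ?(ltW w0) ?(ltW tc0).
have K00 : 0 <= K0 by rewrite !mulr_ge0 ?powR_ge0// invr_ge0 subr_ge0 ltW.
have K10 : 0 <= (2 * w ^- i.+1) ^+ m.
  by rewrite exprn_ge0// mulr_ge0// invr_ge0 exprn_ge0// ltW.
have m1m : (m.-1 < m)%N by rewrite prednK.
pose j0 : 'I_m := Ordinal m1m.
have mE : m = j0.+1 by rewrite /= prednK.
(* An arbitrary starting multi-index: nothing is frozen yet. It exists because [n >= m > 0]. *)
pose a0 : {ffun 'I_m -> 'I_n} := [ffun=> Ordinal (leq_trans m0 mn)].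
have I_ge0 (A : R -> set T) : (0 <= \int[lebesgue_measure]_(u in `[0%R, 1%R])
    ((u `^ (q - 1))%:E * P (A u)))%E.
  by apply: integral_ge0 => u _; rewrite mule_ge0// lee_fin powR_ge0.
set F := (\sum_(l \in _) I_full l)%E; set E := ((\sum_(l \in _) 'E_P[_]) `^ _)%E.
have F0 : (0 <= F)%E.
  by rewrite /F (@big_Inc_upto_all m n _ _ _ (fun l => I_full l)); apply: sume_ge0 => e _; exact: I_ge0.
have E00 : (0 <= E)%E by exact: poweR_ge0.
have E0 : (0 <= (t `^ (- q))%:E * E)%E by rewrite mule_ge0 ?poweR_ge0// lee_fin powR_ge0.
set D := (\sum_(J | _) _)%E.
have D0 : (0 <= D)%E.
  by apply: sume_ge0 => J _; apply: esum_ge0 => v _; exact: I_ge0.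
apply: (le_trans (max_le_PsiMax a0 mE)).
apply: (le_trans (PsiMax_le_leaves eN nf p1 p2 C2 lamP rhoP wmeasurable_supp_h
  supp_h_inc supp_h_centered w0 w1 L00 small a0 mE)).
rewrite -muleA !EFinM -!muleA -!ge0_muleDr ?mule_ge0 ?adde_ge0 ?lee_fin ?addr_ge0 ?powR_ge0//.
apply: lee_wpmul2l; first by rewrite lee_fin.
(* The full and the empty [J] are distinct because [m > 0]; they give the first and the third
   term. *)
rewrite (bigD1 [set: 'I_m]%SET)//= (bigD1 finset.set0)/=; last first.
  by apply/eqP => /finset.setP/(_ j0); rewrite !inE.
rewrite (eq_bigl (fun J : {set 'I_m} =>
  (finset.set0 \proper J) && (J \proper [set: 'I_m]%SET))); last first.
  by move=> J; rewrite finset.proper0 finset.properT andbC.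
rewrite [leRHS]ge0_muleDr ?adde_ge0// ge0_muleDr// -addeA leeD//.
- apply: (@le_trans _ _ (K2%:E * F)%E); last first.
    by apply: lee_wpmul2r => //; rewrite lee_fin lerDl.
  rewrite /F (@big_Inc_upto_all m n _ _ _ (fun l => I_full l)) ge0_sume_distrr//.
  rewrite big_mkcond [leRHS]big_mkcond; apply: lee_sum => e _.
  rewrite (_ : agree _ _ _); last by apply/agreeP => j; rewrite inE.
  exact: PsiW_full.
rewrite [leRHS]addeC leeD//.
- rewrite (big_pred1 a0); last first.
    move=> e; apply/agreeP/eqP => [ae|->//].
    by apply/ffunP => j; rewrite ae// inE.
  apply: (le_trans (PsiW_empty a0)); rewrite -muleA.
  by apply: lee_wpmul2r => //; rewrite lee_fin lerDr.
- rewrite /D ge0_sume_distrr; last by move=> J _; apply: esum_ge0 => v _; exact: I_ge0.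
  apply: lee_sum => J _.
  apply: (@le_trans _ _ (K2%:E * \esum_(v in supported_on J) I_cond J v)%E); last first.
    by apply: lee_wpmul2r; [apply: esum_ge0 => v _; exact: I_ge0|rewrite lee_fin lerDl].
  apply: (@le_trans _ _ (K2%:E * \sum_(e | agree J a0 e) I_cond J (restricted_index J e))%E).
    rewrite ge0_sume_distrr; last by move=> e _; exact: I_ge0.
    by apply: lee_sum => e _; exact: PsiW_conditioned.
  apply: lee_wpmul2l; first by rewrite lee_fin.
  exact: (sum_agree_le_esum J a0 (fun v => I_ge0 _)).
Qed.
End assembly.

Theorem theorem1p3 (R : realType) (B : completeNormedModType R) (m : nat)
    (p q : R) (sepB : separable_space B) (m_ge1 : (1 <= m)%N)
    (p_gt1 : 1 < p) (q_gt0 : 0 < q) :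
  exists2 K : R, 0 < K &
  forall r : R, 1 < r <= 2 -> smooth_space B r -> p <= r ->
  forall (d d' : measure_display) (T : measurableType d)
    (S : measurableType d') (P : probability T R) (xi : nat -> {RV P >-> S})
    (h : {ffun 'I_m -> nat} -> m.-tuple S -> B),
  iid P xi ->
  (forall i, Inc m i -> measurable_fun setT (h i : m.-tuple S -> borel B)) ->
  (forall i, Inc m i -> degenerated P xi (h i)) ->
  forall (t : R) (N : nat), 0 < t -> (m <= N)%N ->
  (P [set w | (t < \big[Num.max/0]_(m <= n < N.+1)
                     `|\sum_(i \in Inc_upto m n) h i (xi_tuple xi i w)|)%R]
   <= K%:E * (\sum_(i \in Inc_upto m N)
        \int[lebesgue_measure]_(u in `[0%R, 1%R])
          ((u `^ (q - 1))%:E *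
           P [set w | (t * u < `|h i (xi_tuple xi (initial m) w)|)%R]))
    + K%:E * (\sum_(J : {set 'I_m} |
                   (finset.set0 \proper J) && (J \proper [set: 'I_m]%SET))
        \esum_(iJ in supported_on J)
        \int[lebesgue_measure]_(u in `[0%R, 1%R])
          ((u `^ (q - 1))%:E *
           P [set w | (t * u)%:E <
              (\sum_(iJc \in [set k | supported_on (~: J)%SET k /\
                                      Inc_upto m N (iJ + k)%R])
                 ge0_cond_expectation P (sigma_xi xi J)
                   (fun w' => (`|h (iJ + iJc)%R
                                 (xi_tuple xi (initial m) w')| `^ p)%:E) w)
              `^ p^-1]))
    + K%:E * (t `^ (- q))%:E *
        (\sum_(i \in Inc_upto m N)
           'E_P[fun w => (`|h i (xi_tuple xi (initial m) w)| `^ p)%R])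
        `^ (q / p))%E.
Proof.
(* The constant is chosen before [r], so one asks first whether an admissible [r] exists: any one
   yields the two-point inequality for [p], and without one the claim is vacuous. *)
have [[r0 [r012 sr0 pr0]]|nosmooth] := pselect (exists r,
    [/\ 1 < r <= 2, smooth_space B r & p <= r]); last first.
  exists 1 => // r r12 sr pr; exfalso; apply: nosmooth; exists r; split => //.
have p0 : 0 < p by exact: lt_trans p_gt1.
have p2 : p <= 2 by rewrite (le_trans pr0)//; case/andP: r012.
have [N eN supN] := sr0.
have [_ [c [Cn [c0 Cn0 cN]]]] := eN.
have [f nf] := exists_norming sepB eN.
have pr02 : p <= r0 <= 2 by rewrite pr0; case/andP: r012.
have [C C2] := smooth_two_point eN p_gt1 pr02 supN.
have C0 : 0 < C by case: C2.
pose theta : R := 64 `^ (- p^-1); pose w := theta `^ q.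
have theta0 : 0 < theta by exact: powR_gt0.
have w0 : 0 < w by exact: powR_gt0.
(* This makes the good-lambda factor [C 64^-i / 8] at most [w / 2]. *)
have [i hi] : exists i : nat, 64 ^- i <= 4 * w / C.
  by apply: exists_geometric_small; rewrite divr_gt0// mulr_gt0.
have small : C * 64 ^- i / 8 <= w / 2.
  by have := ler_wpM2l (ltW C0) hi; rewrite [C * (_ / C)]mulrC divfK ?gt_eqF//; lra.
(* After taking roots of order [p], this is the room needed to pass between [N] and the original
   norm. *)
have [i2 hi2] : exists i : nat, 64 ^- i <= (c / Cn) `^ p.
  by apply: exists_geometric_small; rewrite powR_gt0// divr_gt0.
have i2_small : theta ^+ i2 <= c / Cn.
  have cCn0 : 0 <= c / Cn by rewrite divr_ge0// ltW.
  have -> : theta ^+ i2 = (64 ^- i2) `^ p^-1.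
    have c64 : 0 <= (64 : R) ^+ i2 by exact: exprn_ge0.
    rewrite -(powR_mulrn i2 (ltW theta0)) -(powR_inv1 c64) -(powR_mulrn i2 (ler0n R 64)).
    by rewrite -!powRrM; congr (_ `^ _); ring.
  have -> : c / Cn = ((c / Cn) `^ p) `^ p^-1.
    by rewrite -powRrM divff ?gt_eqF// powRr1.
  apply: ge0_ler_powR => //; rewrite ?nnegrE ?powR_ge0//.
  by rewrite invr_ge0 ltW.
exists ((2 * w ^- i.+1) ^+ m * (w ^- i2 / tail_constant q theta +
    (1 - w)^-1 * c `^ (- q) * Cn `^ q)).
  have theta1 : theta < 1 by apply: powRN_lt1; rewrite ?ltr1n ?invr_gt0.
  have w1 : w < 1 by apply: powR_lt1 => //; exact: ltW.
  rewrite mulr_gt0 ?exprn_gt0 ?mulr_gt0 ?invr_gt0 ?exprn_gt0//.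
  rewrite addr_gt0 ?mulr_gt0 ?invr_gt0 ?powR_gt0 ?exprn_gt0 ?subr_gt0//.
  exact: tail_constant_gt0.
move=> r _ _ _ d d' T S P xi h iid_xi mh dh t n t0 mn.
have [mu laws] := iid_power iid_xi.
have [rho [rhoE rhoi rhoP]] := laws m.
have [rhon [rhonE _ rhonP]] := laws n.
have [lam [_ _ lamP]] := laws (m + n)%N.
exact: (maximal_inequality_weighted sepB eN nf p_gt1 p2 C2 c0 Cn0 cN lamP rhoP rhonP
  rhoE rhoi rhonE mh dh q_gt0 t0 small i2_small m_ge1 mn).
Qed.
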